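(* Let $A$ be an Aharonov--Bohm potential on $\mathbb H^1\setminus\mathcal Z$, where $\mathcal Z=\{(0,0,z):z\in\mathbb R\}$. Then, up to gauge invariance, $A=A_\alpha:=\alpha\,d\varphi \mod\omega$ for some $\alpha\in\mathbb R$, and the inequality $$-\Delta_{A_\alpha}\ \ge\ \frac{d(\alpha,\mathbb Z)^2}{r^2}\qquad\text{in } L^2(\mathbb H^1\setminus\mathcal Z)$$ holds in the sense of quadratic forms, where $r(x,y,z)=\sqrt{x^2+y^2}$. Moreover, the inequality is optimal in the sense that no positive function can be added to its right-hand side.
   Context: The Heisenberg group $\mathbb H^1$ is $\mathbb R^3$ with coordinates $(x,y,z)$ and left-invariant vector fields $X=\partial_x-\frac y2\partial_z$, $Y=\partial_y+\frac x2\partial_z$, $Z=\partial_z$. The contact form is $\omega=dz-\frac12(x\,dy-y\,dx)$; $\{dx,dy,\omega\}$ is dual to $\{X,Y,Z\}$. On $\mathbb H^1\setminus\mathcal Z$ use cylindrical coordinates $(r,\varphi,z)\in(0,\infty)\times\mathbb S^1\times\mathbb R$, $(x,y)=(r\cos\varphi,r\sin\varphi)$. $dq$ is Lebesgue measure. For open $U\subset\mathbb H^1$, horizontal $1$-forms (vector potentials) are elements of $\Omega^1_{\mathrm H}(U)=\Omega^1(U)/\operatorname{span}\{\omega\}$ (smooth real $1$-forms modulo multiples of $\omega$), written $A=A_x\,dx+A_y\,dy\mod\omega$. The horizontal differential of a function is $d_{\mathrm H}f=(Xf)dx+(Yf)dy\mod\omega$. The Rumin operator $D$ sends $A\in\Omega_{\mathrm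 H}^1(U)$ to $DA=d\tilde A$, where $\tilde A$ is the unique $1$-form with $\tilde A=A\mod\omega$ and $d\tilde A\in\operatorname{span}\{dx\wedge\omega,dy\wedge\omega\}$ (span over smooth functions). An Aharonov--Bohm potential on $U$ is an $A\in\Omega^1_{\mathrm H}(U)$ that is closed ($DA=0$) but not exact (there is no $f\in C^\infty(U)$ with $A=d_{\mathrm H}f$). Two vector potentials $A$ and $A+d_{\mathrm H}f$, with $f\in C^\infty(U)$ real-valued, are called gauge equivalent; the associated magnetic sub-Laplacians are unitarily equivalent. For a vector potential $A=A_x\,dx+A_y\,dy\mod\omega$ on $U=\mathbb H^1\setminus\mathcal Z$, set $$Q_A(u)=\int_{\mathbb H^1}\left(|(X+iA_x)u|^2+|(Y+iA_y)u|^2\right)dq,\qquad u\in C^\infty_c(U).$$ $-\Delta_A$ is the self-adjoint operator in $L^2(U)$ associated with the closure of $Q_A$ (Friedrichs extension). Concretely, $Q_{A_\alpha}(u)=\int\left(|\partial_ru|^2+\left|\left(\frac1r\partial_\varphi+\frac r2\partial_z+\frac{i\alpha}{r}\right)u\right|^2\right)r\,dr\,d\varphi\,dz$. The inequality $-\Delta_{A_\alpha}\ge w$ in the sense of quadratic forms means $Q_{A_\alpha}(u)\ge\int w|u|^2\,dq$ for all $u\in C_c^\infty(\mathbb H^1\setminus\mathcal Z)$. $d(\alpha,\mathbb Z)$ is the distance from $\alpha$ to the integers.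
   Formalization: ''No positive function can be added'' is stated only for measurable w ≥ 0 independent of z (then w = 0 a.e.); for z-dependent w the claim is false: e.g. for α = 1, d(α,ℤ) = 0 and the positive weight r²/(r⁴+16z²) can be added. *)

(* Defs.v *)
From HB Require Import structures.
From mathcomp Require Import all_boot all_order all_algebra.
From mathcomp Require Import all_classical all_reals all_analysis.
From mathcomp Require Import complex.

Set Implicit Arguments.
Unset Strict Implicit.
Unset Printing Implicit Defensive.

Import Order.TTheory GRing.Theory Num.Theory.
Import numFieldNormedType.Exports.

Local Open Scope classical_set_scope.
Local Open Scope ring_scope.

Section Heisenberg.
Variable R : realType.

(* The point (x, y, z) of H^1 is the triple ((x, y), z); the same type is used
   for tangent vectors, in the coordinate frame d/dx, d/dy, d/dz. *)
Definition heis : Type := (R * R * R)%type.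

Definition cx (q : heis) : R := q.1.1.
Definition cy (q : heis) : R := q.1.2.
Definition cz (q : heis) : R := q.2.
Definition rad (q : heis) : R := Num.sqrt (cx q ^+ 2 + cy q ^+ 2).

Definition heis_mu :=
  (@lebesgue_measure R \x @lebesgue_measure R \x @lebesgue_measure R)%E.

Definition zaxis : set heis := [set q | cx q = 0 /\ cy q = 0].
Definition heis_off_axis : set heis := ~` zaxis.

Definition e_x : heis := (1, 0, 0).
Definition e_y : heis := (0, 1, 0).
Definition e_z : heis := (0, 0, 1).

Definition frame (i : 'I_3) : heis := [:: e_x; e_y; e_z]`_i.

(* [U] is meant to be open: all conditions at q are about f near q. *)
Fixpoint Ck (k : nat) (U : set heis) (f : heis -> R) : Prop :=
  (forall q, U q -> {for q, continuous f}) /\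
  match k with
  | 0 => True
  | k'.+1 => forall i : 'I_3,
      (forall q, U q -> derivable f q (frame i)) /\ Ck k' U ('D_(frame i) f)
  end.

Definition smooth (U : set heis) (f : heis -> R) : Prop := forall k, Ck k U f.

Definition vecX (q : heis) : heis := (1, 0, - (cy q / 2)).
Definition vecY (q : heis) : heis := (0, 1, cx q / 2).

Definition opX (f : heis -> R) (q : heis) : R :=
  'D_e_x f q - cy q / 2 * 'D_e_z f q.
Definition opY (f : heis -> R) (q : heis) : R :=
  'D_e_y f q + cx q / 2 * 'D_e_z f q.

(* [th q v] is the value of the 1-form th at q on the tangent vector v;
   similarly [Om q v w] for 2-forms. *)
Definition form1 : Type := heis -> heis -> R.
Definition form2 : Type := heis -> heis -> heis -> R.

Definition smooth_form1 (U : set heis) (th : form1) : Prop :=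
  (forall q, U q -> forall (a : R) (v w : heis),
     th q (a *: v + w) = a * th q v + th q w) /\
  (forall v, smooth U (fun q => th q v)).

Definition dx : form1 := fun _ v => cx v.
Definition dy : form1 := fun _ v => cy v.
Definition omega : form1 :=
  fun q v => cz v - 2^-1 * (cx q * cy v - cy q * cx v).

Definition wedge (th eta : form1) : form2 :=
  fun q v w => th q v * eta q w - th q w * eta q v.

(* Exterior derivative; v and w are constant vector fields, so there is no
   bracket term. *)
Definition extd (th : form1) : form2 :=
  fun q v w => 'D_v (fun p => th p w) q - 'D_w (fun p => th p v) q.

(* Horizontal forms, i.e. elements of Omega^1(U) / span {omega}, are handled
   through representatives; [eq_mod_omega U] is equality in the quotient. *)
Definition eq_mod_omega (U : set heis) (th eta : form1) : Prop :=
  exists2 f, smooth U f &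
    forall q, U q -> forall v, th q v = eta q v + f q * omega q v.

(* Coefficients in A = A_x dx + A_y dy mod omega: since {dx, dy, omega} is
   dual to {X, Y, Z}, they are A(X) and A(Y), whatever the representative. *)
Definition coefx (A : form1) (q : heis) : R := A q (vecX q).
Definition coefy (A : form1) (q : heis) : R := A q (vecY q).

Definition dH (f : heis -> R) : form1 :=
  fun q v => opX f q * dx q v + opY f q * dy q v.

Definition rumin_lift (U : set heis) (A At : form1) : Prop :=
  [/\ smooth_form1 U At, eq_mod_omega U At A &
      exists a b : heis -> R, [/\ smooth U a, smooth U b &
        forall q, U q -> forall v w,
          extd At q v w = a q * wedge dx omega q v w
                          + b q * wedge dy omega q v w]].

(* [is_rumin U A Om] means D A = Om on U. *)
Definition is_rumin (U : set heis) (A : form1) (Om : form2) : Prop :=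
  exists2 At, rumin_lift U A At &
    forall q, U q -> forall v w, Om q v w = extd At q v w.

Definition rumin_closed (U : set heis) (A : form1) : Prop :=
  is_rumin U A (fun _ _ _ => 0).

Definition horizontally_exact (U : set heis) (A : form1) : Prop :=
  exists2 f, smooth U f & eq_mod_omega U A (dH f).

Definition aharonov_bohm (U : set heis) (A : form1) : Prop :=
  [/\ smooth_form1 U A, rumin_closed U A & ~ horizontally_exact U A].

Definition gauge_equivalent (U : set heis) (A B : form1) : Prop :=
  exists2 f, smooth U f & eq_mod_omega U A (fun q v => B q v + dH f q v).

(* The differential of the angle phi, i.e. (x dy - y dx) / r^2. *)
Definition dphi : form1 :=
  fun q v => (cx q * cy v - cy q * cx v) / rad q ^+ 2.

Definition A_alpha (alpha : R) : form1 := fun q v => alpha * dphi q v.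

Definition ReF (u : heis -> R[i]) (q : heis) : R := complex.Re (u q).
Definition ImF (u : heis -> R[i]) (q : heis) : R := complex.Im (u q).

(* Functions in C_c^oo(U), extended by zero outside U. *)
Definition test_fun (U : set heis) (u : heis -> R[i]) : Prop :=
  [/\ smooth U (ReF u), smooth U (ImF u) &
      exists K : set heis, [/\ compact K, K `<=` U & forall q, ~ K q -> u q = 0]].

Definition cplx (T : (heis -> R) -> heis -> R) (u : heis -> R[i]) (q : heis)
  : R[i] := (T (ReF u) q +i* T (ImF u) q)%C.

Definition magX (A : form1) (u : heis -> R[i]) (q : heis) : R[i] :=
  cplx opX u q + 'i%C * (coefx A q)%:C%C * u q.
Definition magY (A : form1) (u : heis -> R[i]) (q : heis) : R[i] :=
  cplx opY u q + 'i%C * (coefy A q)%:C%C * u q.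

Definition Qform (A : form1) (u : heis -> R[i]) : \bar R :=
  (\int[heis_mu]_q
     (ComplexField.Normc.normc (magX A u q) ^+ 2
      + ComplexField.Normc.normc (magY A u q) ^+ 2)%:E)%E.

(* - Delta_A >= w in L^2(U), in the sense of quadratic forms. *)
Definition sublaplacian_ge (U : set heis) (A : form1) (w : heis -> R) : Prop :=
  forall u, test_fun U u ->
    (\int[heis_mu]_(q in U) (w q * ComplexField.Normc.normc (u q) ^+ 2)%:E
     <= Qform A u)%E.

Definition dist_int (a : R) : R := inf [set `|a - k%:~R| | k in [set: int]].

Definition hardy_weight (alpha : R) (q : heis) : R :=
  dist_int alpha ^+ 2 / rad q ^+ 2.

(* Like the weight d(alpha, Z)^2 / r^2 itself, the added function w does not
   depend on z.  For w depending on z the assertion would fail: for alpha an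
   integer, - Delta_{A_alpha} is unitarily equivalent to the free
   sub-Laplacian, which is bounded below by r^2 / (r^4 + 16 z^2). *)
Definition hardy_optimal (U : set heis) (alpha : R) : Prop :=
  forall w : heis -> R,
    measurable_fun U w ->
    (forall q, U q -> 0 <= w q) ->
    (forall x y z z' : R, w (x, y, z) = w (x, y, z')) ->
    sublaplacian_ge U (A_alpha alpha) (fun q => hardy_weight alpha q + w q) ->
    {ae heis_mu, forall q, U q -> w q = 0}.

End Heisenberg.

(* Main.v *)
(* Gauge: a lift of A is a closed 1-form off the axis; by the Poincare lemma on
   four half-spaces it differs from alpha dphi, alpha its period over 2 pi, by an
   exact form.

   Inequality: for u = r w and d = d(alpha, Z), Q(u) is the integral of
   |(E + 1) w|^2 + |(V + i alpha + (r^2/2) d_z) w|^2 with E = x d_x + y d_y and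
   V = x d_y - y d_x.  On an angular mode, with m = k + alpha in place of
   V / i + alpha, completing a square bounds this below by d^2 |w|^2 up to terms
   of zero integral.  Fourier series are avoided: Q(u) - d^2 |w|^2 is the value at
   t = 0 of the sum of the correlations of these functions with their rotations by
   t, whose cosine coefficients are energies of modes, hence nonnegative; testing
   against (1 + cos t)^n shows that the value at 0 is nonnegative.

   Optimality: take u = e^(i k phi) c(log(r^2) / n) c(z / L) with |k + alpha| = d,
   c a smooth cutoff and L = n e^n.  The excess Q(u) - d^2 int |u|^2 / r^2 is
   O(L / n), so an added weight independent of z has integral O(1 / n) over any
   fixed annulus. *)
Require Import Defs.
From HB Require Import structures.
From mathcomp Require Import all_boot all_order all_algebra.
From mathcomp Require Import all_classical all_reals all_analysis.
From mathcomp Require Import measurable_realfun.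
From mathcomp Require Import complex ring lra.
Set Implicit Arguments.
Unset Strict Implicit.
Unset Printing Implicit Defensive.
Import Order.TTheory GRing.Theory Num.Theory.
Import numFieldNormedType.Exports.
Local Open Scope classical_set_scope.
Local Open Scope ring_scope.

(** Polar coordinates are never introduced, since the angle is not a function on the whole domain. A
    function supported in a shell away from the axis extends by zero to a smooth function on the
    whole space. For such functions division by r is harmless, and the integrals in the inequality
    become iterated integrals over a box [-M, M]^3. Angular modes are averages over rotations of the
    Cartesian variable, and rotation invariance of the integral is obtained by differentiating in
    the angle.

    The two terms of zero integral come from commutators. For Lebesgue measure E + 1 is
    antisymmetric and T = -i r^2 d_z is symmetric, with [E + 1, T] = 2 T. Hence Re <(E + 1) w, w> =
    0 and Re <(E + 1) w, T w> + <w, T w> = 0. The second identity is the decisive one: the twisted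
    square contains a cross term m <w, T w> without a sign, and the identity trades it for a cross
    term with (E + 1) w, which the radial square can absorb. *)

Lemma continuous_pair (T U V : topologicalType) (f : T -> U) (g : T -> V) x :
  {for x, continuous f} -> {for x, continuous g} ->
  {for x, continuous (fun y => (f y, g y))}.
Proof. by move=> cf cg; exact: (cvg_pair cf cg). Qed.

Lemma is_derive_line (R : realType) (V : normedModType R) (f : V -> R) (q v : V) (s : R) d :
  is_derive (s *: v + q) v f d -> is_derive s (1 : R) (fun r : R => f (r *: v + q)) d.
Proof.
move=> [dd <-].
have E : (fun r : R => r^-1 *: (f (r *: v + (s *: v + q)) - f (s *: v + q))) =
   (fun r : R => r^-1 *: (f ((r *: (1:R) + s) *: v + q) - f (s *: v + q))).
  by apply/funext => r; rewrite scalerDl addrA /GRing.scale /= mulr1.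
by split; [move: dd; rewrite /derivable E|rewrite /derive E].
Qed.

(** * Integrals over a segment that depend on a parameter *)

Section ParametricIntegral.
Variable R : realType.
Implicit Types (a b : R) (f g : R -> R).

Definition sint a b f : R := \int[@lebesgue_measure R]_(t in `[a, b]) f t.

(** Two-sided continuity at every point, endpoints included: this is what a function continuous on
    an open set offers, and it avoids one-sided limits at the ends. *)
Definition cont_seg a b f := forall t, t \in `[a, b] -> {for t, continuous f}.

Lemma cont_seg_within a b f : cont_seg a b f -> {within `[a, b], continuous f}.
Proof.
move=> cf; apply: continuous_in_subspaceT => t /set_mem /= h; exact: cf.
Qed.

Lemma cont_seg_int a b f : cont_seg a b f ->
  (@lebesgue_measure R).-integrable `[a, b] (EFin \o f).
Proof.
move=> cf; apply: continuous_compact_integrable; first exact: segment_compact.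
exact: cont_seg_within.
Qed.

Lemma sintD a b f g : cont_seg a b f -> cont_seg a b g ->
  sint a b (fun t => f t + g t) = sint a b f + sint a b g.
Proof.
by move=> cf cg; rewrite /sint RintegralD//; exact: cont_seg_int.
Qed.

Lemma sintB a b f g : cont_seg a b f -> cont_seg a b g ->
  sint a b (fun t => f t - g t) = sint a b f - sint a b g.
Proof.
by move=> cf cg; rewrite /sint RintegralB//; exact: cont_seg_int.
Qed.

Lemma sintZ a b k f : cont_seg a b f ->
  sint a b (fun t => k * f t) = k * sint a b f.
Proof.
by move=> cf; rewrite /sint RintegralZl//; exact: cont_seg_int.
Qed.

Lemma sint_cst a b k : a <= b -> sint a b (fun=> k) = k * (b - a).
Proof.
move=> ab; rewrite /sint Rintegral_cst//= lebesgue_measure_itv /= lte_fin.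
by move: ab; rewrite le_eqVlt => /predU1P[->|->//]; rewrite ltxx subrr.
Qed.

Lemma eq_sint a b f g : (forall t, t \in `[a, b] -> f t = g t) ->
  sint a b f = sint a b g.
Proof. by move=> fg; apply: eq_Rintegral => t /set_mem; exact: fg. Qed.

Lemma le_sint a b f g : cont_seg a b f -> cont_seg a b g ->
  (forall t, t \in `[a, b] -> f t <= g t) -> sint a b f <= sint a b g.
Proof.
by move=> cf cg fg; apply: le_Rintegral => //; exact: cont_seg_int.
Qed.

Lemma cont_seg_norm a b f : cont_seg a b f -> cont_seg a b (fun t => `|f t|).
Proof. by move=> cf t /cf; apply: cvg_norm. Qed.

Lemma sint_norm_le a b f k : a <= b -> cont_seg a b f ->
  (forall t, t \in `[a, b] -> `|f t| <= k) -> `|sint a b f| <= k * (b - a).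
Proof.
move=> ab cf fk; apply: (le_trans (le_normr_Rintegral _ _)) => //.
  exact: cont_seg_int.
rewrite -(sint_cst k ab); apply: le_sint => //; last by move=> t _; exact: cvg_cst.
exact: cont_seg_norm.
Qed.

Lemma sint_FTC a b (f F : R -> R) : a <= b -> cont_seg a b f ->
  (forall t, t \in `[a, b] -> is_derive t 1 F (f t)) ->
  sint a b f = F b - F a.
Proof.
rewrite le_eqVlt => /predU1P[<-|ab] cf dF.
  by rewrite /sint set_itv1 Rintegral_set1 subrr.
have dF1 t : t \in `[a, b] -> derivable F t 1 by move=> /dF[].
rewrite /sint /Rintegral (@continuous_FTC2 _ f F)//.
- exact: cont_seg_within.
- have cF t : t \in `[a, b] -> {for t, continuous F}.
    by move=> /dF1 /derivable1_diffP /differentiable_continuous.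
  split.
  + by move=> t /subset_itv_oo_cc; exact: dF1.
  + apply: cvg_at_right_filter; apply: cF.
    by rewrite in_itv /= lexx ltW.
  + apply: cvg_at_left_filter; apply: cF.
    by rewrite in_itv /= lexx ltW.
- move=> t /subset_itv_oo_cc /dF [? <-].
  by rewrite derive1E.
Qed.

(** The sign of [h] is arbitrary and the bound on [c] symmetric, so that limits as h tends to 0 need
    no distinction of sides. *)
Lemma mvt_line (V : normedModType R) (f f' : V -> R) (q v : V) (h : R) :
  (forall s : R, `|s| <= `|h| -> is_derive (s *: v + q) v f (f' (s *: v + q))) ->
  exists2 c : R, `|c| <= `|h| & f (h *: v + q) - f q = h * f' (c *: v + q).
Proof.
move=> df.
have dline (s : R) : `|s| <= `|h| ->
    is_derive s (1 : R) (fun r : R => f (r *: v + q)) (f' (s *: v + q)).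
  by move=> sh; apply: is_derive_line; exact: df.
have cl (s : R) : `|s| <= `|h| -> {for s, continuous (fun r : R => f (r *: v + q))}.
  by move=> /dline[/derivable1_diffP /differentiable_continuous].
have [hp|hn] := ltP 0 h.
  have nh (s : R) : s \in `[0, h] -> `|s| <= `|h|.
    by rewrite in_itv /= => /andP[s0 sh]; rewrite !ger0_norm// ltW.
  have D1 (s : R) : s \in `]0, h[ ->
      is_derive s (1 : R) (fun r : R => f (r *: v + q)) (f' (s *: v + q)).
    by move=> /subset_itv_oo_cc /nh; exact: dline.
  have D2 := cont_seg_within (fun s sh => cl s (nh s sh)).
  have [c /nh ch E] := MVT_segment (ltW hp) D1 D2.
  exists c => //; move: E.
  by rewrite subr0 scale0r add0r mulrC.
have nh (s : R) : s \in `[h, 0] -> `|s| <= `|h|.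
  by rewrite in_itv /= => /andP[s0 sh]; rewrite !ler0_norm// lerN2.
have D1 (s : R) : s \in `]h, 0[ ->
    is_derive s (1 : R) (fun r : R => f (r *: v + q)) (f' (s *: v + q)).
  by move=> /subset_itv_oo_cc /nh; exact: dline.
have D2 := cont_seg_within (fun s sh => cl s (nh s sh)).
have [c /nh ch E] := MVT_segment hn D1 D2.
exists c => //; move: E; rewrite sub0r scale0r add0r mulrN mulrC => E.
by rewrite -(opprB (f q)) E opprK.
Qed.

Section Param.
Variable V : normedModType R.
Implicit Types (F : V -> R -> R) (q : V).

Definition jcont (O : set V) a b F := forall q t, O q -> t \in `[a, b] ->
  {for (q, t), continuous (fun p : V * R => F p.1 p.2)}.

Lemma jcont_seg O a b F q : jcont O a b F -> O q -> cont_seg a b (F q).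
Proof.
move=> cF Oq t tab.
apply: (@continuous_comp _ _ _ (fun s : R => (q, s)) (fun p : V * R => F p.1 p.2)).
  by apply: continuous_pair; [exact: cvg_cst|exact: cvg_id].
exact: cF.
Qed.

(** The tube lemma: compactness of the segment turns joint continuity at each point (q, t) into an
    estimate uniform in t. *)
Lemma param_unif O a b F q : jcont O a b F -> O q -> forall e, 0 < e ->
  \forall p \near q, forall t, t \in `[a, b] -> `|F p t - F q t| <= e.
Proof.
move=> cF Oq e e0.
have e20 : 0 < e / 2 by rewrite divr_gt0.
have := @segment_compact R a b; rewrite compact_near_coveringP.
move=> /(_ V (nbhs q) (fun p t => `|F p t - F q t| <= e) _); apply => t tab.
have /cvgrPdist_lt /(_ _ e20) := cF q t Oq tab.
have /cvgrPdist_lt /(_ _ e20) := jcont_seg cF Oq tab.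
move=> c1 [[A B] [/= nA nB] AB]; exists (B `&` [set s | `|F q t - F q s| < e / 2], A).
  by split => //=; apply: filterI.
move=> [s p] /= [[Bs h1] Ap].
have := AB (p, s) (conj Ap Bs) => /= h2.
rewrite (splitr e) (le_trans _ (lerD (ltW h2) (ltW h1)))//.
rewrite -[F p s - F q s](subrKA (F q t)) (le_trans (ler_normD _ _))//.
by rewrite distrC [X in _ <= X]addrC addrC.
Qed.

Lemma sint_param_continuous O a b F q : open O -> a <= b -> jcont O a b F -> O q ->
  {for q, continuous (fun p => sint a b (F p))}.
Proof.
move=> oO ab cF Oq; apply/cvgrPdist_le => e e0.
(* The summand 1 keeps the denominator positive when a = b. *)
have e1 : 0 < e / (b - a + 1) by rewrite divr_gt0// ltr_wpDl// subr_ge0.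
have nU := param_unif cF Oq e1.
have nO := open_nbhs_nbhs (conj oO Oq).
near=> p.
have Op : O p by near: p.
have hU : forall t, t \in `[a, b] -> `|F p t - F q t| <= e / (b - a + 1).
  by near: p.
rewrite -sintB; [|exact: jcont_seg cF _ ..].
apply: (@le_trans _ _ (e / (b - a + 1) * (b - a))); last first.
  rewrite mulrAC ler_pdivrMr ?ltr_wpDl ?subr_ge0//.
  by rewrite ler_pM2l// lerDl.
apply: sint_norm_le => //.
  by move=> t tab; apply: cvgB; [exact: (jcont_seg cF Oq)|exact: (jcont_seg cF Op)].
by move=> t tab; rewrite distrC; exact: hU.
Unshelve. all: by end_near. Qed.

(** Leibniz rule without dominated convergence: for each t the mean value theorem replaces the
    difference quotient by [dF] at an intermediate point, and [param_unif] brings these values close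
    to [dF q t] uniformly in t, although the point depends on t. *)
Lemma sint_param_derive O a b F dF q v : open O -> a <= b ->
  jcont O a b F -> jcont O a b dF ->
  (forall p t, O p -> t \in `[a, b] -> is_derive p v (F ^~ t) (dF p t)) ->
  O q ->
  is_derive q v (fun p => sint a b (F p)) (sint a b (dF q)).
Proof.
move=> oO ab cF cdF dFE Oq.
suff H : h^-1 *: (sint a b (F (h *: v + q)) - sint a b (F q)) @[h --> 0^'] -->
    sint a b (dF q).
  have dv : derivable (fun p => sint a b (F p)) q v.
    by apply/cvg_ex; exists (sint a b (dF q)).
  by split => //; exact: cvg_lim.
apply/cvgrPdist_le => e e0.
have e1 : 0 < e / (b - a + 1) by rewrite divr_gt0// ltr_wpDl// subr_ge0.
(* The intermediate points of the mean value theorem are unknown, so the estimate must hold on the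
   whole segment around [q] for all small [h]. *)
have near_line (P : set V) : nbhs q P ->
    \forall h \near (0 : R)^', forall s, `|s| <= `|h| -> P (s *: v + q).
  move=> nP.
  have : nbhs (0 : R) [set s | P (s *: v + q)].
    have : (fun s : R => s *: v + q) s @[s --> (0:R)] --> q.
      rewrite -[X in _ --> X]add0r -(scale0r v).
      by apply: cvgD; [apply: cvgZr_tmp; exact: cvg_id|exact: cvg_cst].
    by apply.
  move=> /nbhs_ballP[d /= d0 hd]; apply: nbhs_dnbhs.
  near=> h => s hs; apply: hd; rewrite -ball_normE /= sub0r normrN.
  by rewrite (le_lt_trans hs)//; near: h; exact: nbhs0_lt.
have nO := open_nbhs_nbhs (conj oO Oq).
have nU := near_line _ (param_unif cdF Oq e1).
have {}near_line := near_line _ nO.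
near=> h.
have h0 : h != 0 by near: h; exact: nbhs_dnbhs_neq.
have hO : forall s, `|s| <= `|h| -> O (s *: v + q) by near: h.
have hU : forall s, `|s| <= `|h| -> forall t, t \in `[a, b] ->
    `|dF (s *: v + q) t - dF q t| <= e / (b - a + 1).
  by near: h.
have Oh := hO h (lexx _).
rewrite /GRing.scale /= -sintB; [|exact: jcont_seg cF _ ..].
have cs1 := jcont_seg cF Oh. have cs2 := jcont_seg cF Oq. have cs3 := jcont_seg cdF Oq.
have csB : cont_seg a b (fun t => F (h *: v + q) t - F q t).
  by move=> t tab; apply: cvgB; [exact: cs1|exact: cs2].
rewrite -sintZ// -sintB//; last first.
  by move=> t tab; apply: cvgM; [exact: cvg_cst|exact: csB].
apply: (@le_trans _ _ (e / (b - a + 1) * (b - a))); last first.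
  rewrite mulrAC ler_pdivrMr ?ltr_wpDl ?subr_ge0//.
  by rewrite ler_pM2l// lerDl.
apply: sint_norm_le => //.
  move=> t tab; apply: cvgB; first exact: cs3.
  by apply: cvgM; [exact: cvg_cst|exact: csB].
move=> t tab.
have [c ch ->] := @mvt_line V (F ^~ t) (dF ^~ t) q v h
  (fun s sh => dFE _ _ (hO s sh) tab).
by rewrite mulKf// distrC; exact: hU.
Unshelve. all: by end_near. Qed.

End Param.
End ParametricIntegral.

(** * Closure properties of smooth functions *)

Section Smooth.
Variable R : realType.
Local Notation heis := (heis R).
Implicit Types (U : set heis) (f g : heis -> R).

Lemma is_derive_additive (l : heis -> R) (q v : heis) :
  (forall (h : R) u, l (h *: v + u) = h * l v + l u) -> is_derive q v l (l v).
Proof.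
move=> ll.
have H : h^-1 *: (l (h *: v + q) - l q) @[h --> 0^'] --> l v.
  apply: cvg_near_cst; near=> h.
  have h0 : h != 0 by near: h; exact: nbhs_dnbhs_neq.
  by rewrite ll addrK /GRing.scale /= mulKf.
by split; [apply/cvg_ex; exists (l v)|exact: cvg_lim].
Unshelve. all: by end_near. Qed.

Lemma is_derive_cx (q v : heis) : is_derive q v (@cx R) (cx v).
Proof. exact: is_derive_additive. Qed.
Lemma is_derive_cy (q v : heis) : is_derive q v (@cy R) (cy v).
Proof. exact: is_derive_additive. Qed.
Lemma is_derive_cz (q v : heis) : is_derive q v (@cz R) (cz v).
Proof. exact: is_derive_additive. Qed.

Lemma continuous_cx : continuous (@cx R).
Proof.
by move=> q; apply: (@continuous_comp _ _ _ (fun q : heis => q.1) fst); exact: cvg_fst.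
Qed.
Lemma continuous_cy : continuous (@cy R).
Proof.
move=> q; apply: (@continuous_comp _ _ _ (fun q : heis => q.1) snd).
  exact: cvg_fst.
exact: cvg_snd.
Qed.
Lemma continuous_cz : continuous (@cz R).
Proof. by move=> q; exact: cvg_snd. Qed.

Lemma Ck_continuous k U f q : Ck k U f -> U q -> {for q, continuous f}.
Proof. by case: k => [|k] [cf _]; exact: cf. Qed.

(** Openness turns equality on [U] into equality near each point of [U], so that the derivatives
    agree as well. *)
Lemma eq_Ck k U f g : open U -> (forall q, U q -> f q = g q) -> Ck k U f -> Ck k U g.
Proof.
move=> oU; elim: k f g => [|k IH] f g fg [cf df].
  have nfg q : U q -> \near q, f q = g q.
    by move=> Uq; apply: filterS (open_nbhs_nbhs (conj oU Uq)) => p; exact: fg.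
  split=> // q Uq; have fgq := fg q Uq.
  rewrite /prop_for /continuous_at -fgq.
  by apply: cvg_trans (cf q Uq); apply: near_eq_cvg; exact: nfg.
have nfg q : U q -> \near q, f q = g q.
  by move=> Uq; apply: filterS (open_nbhs_nbhs (conj oU Uq)) => p; exact: fg.
split=> [q Uq|i].
  have fgq := fg q Uq.
  rewrite /prop_for /continuous_at -fgq.
  by apply: cvg_trans (cf q Uq); apply: near_eq_cvg; exact: nfg.
have [d1 d2] := df i.
have D q : U q -> is_derive q (frame R i) g ('D_(frame R i) f q).
  move=> Uq; apply: near_eq_is_derive (nfg _ Uq) _.
  by apply: derivableP; exact: d1.
split=> [q Uq|]; first by case: (D q Uq).
by apply: IH d2 => q Uq; case: (D q Uq).
Qed.

Lemma eq_smooth U f g : open U -> (forall q, U q -> f q = g q) -> smooth U f -> smooth U g.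
Proof. by move=> oU fg sf k; exact: eq_Ck (sf k). Qed.

Lemma smooth_continuous U f q : smooth U f -> U q -> {for q, continuous f}.
Proof. by move=> /(_ 0%N); exact: Ck_continuous. Qed.

Lemma smooth_derive U f i : smooth U f -> smooth U ('D_(frame R i) f).
Proof. by move=> sf k; case: (sf k.+1) => _ /(_ i) []. Qed.

Lemma smooth_is_derive U f i q : smooth U f -> U q ->
  is_derive q (frame R i) f ('D_(frame R i) f q).
Proof.
by move=> /(_ 1%N) [_ /(_ i) [d _]] Uq; apply: derivableP; exact: d.
Qed.

Lemma smooth_subset U U' f : U' `<=` U -> smooth U f -> smooth U' f.
Proof.
move=> UU' + k => /(_ k); elim: k f => [|k IH] f [cf df].
  by split => // q /UU'; exact: cf.
split=> [q /UU'|i]; first exact: cf.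
by have [d1 d2] := df i; split=> [q /UU'|]; [exact: d1|exact: IH].
Qed.

Lemma smooth_setU U U' f : smooth U f -> smooth U' f -> smooth (U `|` U') f.
Proof.
move=> + + k => /(_ k) + /(_ k); elim: k f => [|k IH] f [cf df] [cf' df'].
  by split => // q [|]; [exact: cf|exact: cf'].
split=> [q [|]|i]; [exact: cf|exact: cf'|].
have [d1 d2] := df i; have [d1' d2'] := df' i.
by split=> [q [|]|]; [exact: d1|exact: d1'|exact: IH].
Qed.

(** A coinduction principle. Induction on the order fails for a single operation, because the
    derivative of a product is a sum of products; a family closed under partial derivatives carries
    all the shapes that occur. *)
Lemma smooth_family U (S : (heis -> R) -> Prop) : open U ->
  (forall f, S f -> (forall q, U q -> {for q, continuous f}) /\
    forall i, exists2 f', S f' & forall q, U q -> is_derive q (frame R i) f (f' q)) ->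
  forall f, S f -> smooth U f.
Proof.
move=> oU SH f Sf k; elim: k f Sf => [|k IH] f /[dup] Sf /SH [cf df].
  by split.
split=> // i; have [f' Sf' df'] := df i; split=> [q /df' []//|].
by apply: eq_Ck (IH _ Sf') => // q /df' [].
Qed.

(** Replaces smoothness in one variable: inverse powers, inverse square roots, logarithms and flat
    functions each lie in a small explicit family stable under differentiation on [J]. *)
Definition derive_closed (J : set R) (P : (R -> R) -> Prop) := forall phi, P phi ->
  exists2 phi', P phi' & forall x, J x -> is_derive x (1 : R) phi (phi' x).

Inductive smooth_expr U : (heis -> R) -> Prop :=
| SE_smooth f : smooth U f -> smooth_expr U f
| SE_cst k : smooth_expr U (fun=> k)
| SE_cx : smooth_expr U (@cx R)
| SE_cy : smooth_expr U (@cy R)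
| SE_cz : smooth_expr U (@cz R)
| SE_add f g : smooth_expr U f -> smooth_expr U g -> smooth_expr U (fun q => f q + g q)
| SE_mul f g : smooth_expr U f -> smooth_expr U g -> smooth_expr U (fun q => f q * g q)
| SE_comp J P phi f : derive_closed J P -> P phi -> smooth_expr U f ->
   (forall q, U q -> J (f q)) -> smooth_expr U (fun q => phi (f q)).

(** Since [phi] has one real variable, restriction to the line through [q] along [v] reduces this to
    the one-dimensional chain rule; the derivative of [f] in the single direction [v] suffices. *)
Lemma is_derive_comp1 (V : normedModType R) (f : V -> R) (phi : R -> R) (q v : V) d d' :
  is_derive q v f d -> is_derive (f q) (1 : R) phi d' ->
  is_derive q v (fun p => phi (f p)) (d' * d).
Proof.
move=> df dphi.
have df0 : is_derive (0 : R) (1 : R) (fun r : R => f (r *: v + q)) d.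
  by apply: is_derive_line; rewrite scale0r add0r.
have := @is_derive1_comp R phi (fun r : R => f (r *: v + q)) 0 d' d.
rewrite scale0r add0r => /(_ dphi df0) [c1 c2].
have E : (fun h : R => h^-1 *: (((phi \o (fun r : R => f (r *: v + q))) (h *: (1:R) + 0)) -
   ((phi \o (fun r : R => f (r *: v + q))) 0))) =
   (fun h : R => h^-1 *: (phi (f (h *: v + q)) - phi (f q))).
  by apply/funext => h; rewrite /= addr0 scale0r add0r /GRing.scale /= mulr1.
split; first by move: c1; rewrite /derivable E.
by rewrite -c2 /derive E.
Qed.

Lemma smooth_exprP U f : open U -> smooth_expr U f -> smooth U f.
Proof.
move=> oU; move: f; apply: smooth_family => // f Sf.
have dk k : forall i, exists2 f' : heis -> R, smooth_expr U f' &
    forall q, U q -> is_derive q (frame R i) (fun=> k) (f' q).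
  move=> i; exists (fun=> 0); first exact: SE_cst.
  by move=> q _; exact: is_derive_cst.
elim: Sf => {f}.
- move=> f sf; split=> [q Uq|i]; first exact: (smooth_continuous sf).
  exists ('D_(frame R i) f); first by apply: SE_smooth; exact: smooth_derive.
  by move=> q; exact: smooth_is_derive.
- by move=> k; split=> [q Uq|//]; exact: cvg_cst.
- split=> [q Uq|i]; first exact: continuous_cx.
  by exists (fun=> cx (frame R i)) => *; [exact: SE_cst|exact: is_derive_cx].
- split=> [q Uq|i]; first exact: continuous_cy.
  by exists (fun=> cy (frame R i)) => *; [exact: SE_cst|exact: is_derive_cy].
- split=> [q Uq|i]; first exact: continuous_cz.
  by exists (fun=> cz (frame R i)) => *; [exact: SE_cst|exact: is_derive_cz].
- move=> f g Sf [cf df] Sg [cg dg]; split=> [q Uq|i].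
    by apply: cvgD; [exact: cf|exact: cg].
  have [f' Sf' df'] := df i; have [g' Sg' dg'] := dg i.
  exists (fun q => f' q + g' q); first exact: SE_add.
  by move=> q Uq; apply: is_deriveD; [exact: df'|exact: dg'].
- move=> f g Sf [cf df] Sg [cg dg]; split=> [q Uq|i].
    by apply: cvgM; [exact: cf|exact: cg].
  have [f' Sf' df'] := df i; have [g' Sg' dg'] := dg i.
  exists (fun q => f q * g' q + g q * f' q).
    by apply: SE_add; apply: SE_mul.
  by move=> q Uq; apply: is_deriveM; [exact: df'|exact: dg'].
- move=> J P phi f PJ Pphi Sf [cf df] fJ.
  have [phi' Pphi' dphi'] := PJ _ Pphi.
  split=> [q Uq|i].
    apply: (@continuous_comp _ _ _ f phi); first exact: cf.
    have [/derivable1_diffP/differentiable_continuous + _] := dphi' _ (fJ q Uq).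
    exact.
  have [f' Sf' df'] := df i.
  exists (fun q => phi' (f q) * f' q).
    by apply: SE_mul => //; exact: SE_comp PJ Pphi' Sf fJ.
  by move=> q Uq; apply: is_derive_comp1; [exact: df'|exact: dphi' (fJ q Uq)].
Qed.

Lemma smoothD U f g : open U -> smooth U f -> smooth U g -> smooth U (fun q => f q + g q).
Proof.
by move=> oU sf sg; apply: smooth_exprP => //; apply: SE_add; exact: SE_smooth.
Qed.

Lemma smoothM U f g : open U -> smooth U f -> smooth U g -> smooth U (fun q => f q * g q).
Proof.
by move=> oU sf sg; apply: smooth_exprP => //; apply: SE_mul; exact: SE_smooth.
Qed.

Lemma smooth_cst U k : open U -> smooth U (fun=> k).
Proof. by move=> oU; apply: smooth_exprP => //; exact: SE_cst. Qed.

Lemma smooth_cx U : open U -> smooth U (@cx R).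
Proof. by move=> oU; apply: smooth_exprP => //; exact: SE_cx. Qed.

Lemma smooth_cy U : open U -> smooth U (@cy R).
Proof. by move=> oU; apply: smooth_exprP => //; exact: SE_cy. Qed.

Lemma smooth_cz U : open U -> smooth U (@cz R).
Proof. by move=> oU; apply: smooth_exprP => //; exact: SE_cz. Qed.

Lemma smooth_comp U J P phi f : open U -> derive_closed J P -> P phi -> smooth U f ->
   (forall q, U q -> J (f q)) -> smooth U (fun q => phi (f q)).
Proof.
by move=> oU PJ Pphi sf fJ; apply: smooth_exprP => //; apply: SE_comp PJ Pphi _ fJ; exact: SE_smooth.
Qed.

End Smooth.

(** * Total differentiability from continuous partial derivatives *)

Section C1.
Variable R : realType.
Local Notation heis := (heis R).

Lemma mvt_x (f f1 : heis -> R) (O : set heis) (x y z h : R) :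
  (forall p, O p -> is_derive p (e_x R) f (f1 p)) ->
  (forall s, `|s| <= `|h| -> O (s + x, y, z)) ->
  exists2 c, `|c| <= `|h| & f (h + x, y, z) - f (x, y, z) = h * f1 (c + x, y, z).
Proof.
move=> d1 hO.
have ex (s : R) : s *: e_x R + (x, y, z) = (s + x, y, z).
  by congr (_, _, _); rewrite /= /GRing.scale /= ?mulr1 ?mulr0 ?add0r.
have [|c ch] := @mvt_line R _ f f1 (x, y, z) (e_x R) h.
  by move=> s sh; apply: d1; rewrite ex; exact: hO.
by rewrite !ex; exists c.
Qed.

Lemma mvt_y (f f1 : heis -> R) (O : set heis) (x y z h : R) :
  (forall p, O p -> is_derive p (e_y R) f (f1 p)) ->
  (forall s, `|s| <= `|h| -> O (x, s + y, z)) ->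
  exists2 c, `|c| <= `|h| & f (x, h + y, z) - f (x, y, z) = h * f1 (x, c + y, z).
Proof.
move=> d1 hO.
have ex (s : R) : s *: e_y R + (x, y, z) = (x, s + y, z).
  by congr (_, _, _); rewrite /= /GRing.scale /= ?mulr1 ?mulr0 ?add0r.
have [|c ch] := @mvt_line R _ f f1 (x, y, z) (e_y R) h.
  by move=> s sh; apply: d1; rewrite ex; exact: hO.
by rewrite !ex; exists c.
Qed.

Lemma mvt_z (f f1 : heis -> R) (O : set heis) (x y z h : R) :
  (forall p, O p -> is_derive p (e_z R) f (f1 p)) ->
  (forall s, `|s| <= `|h| -> O (x, y, s + z)) ->
  exists2 c, `|c| <= `|h| & f (x, y, h + z) - f (x, y, z) = h * f1 (x, y, c + z).
Proof.
move=> d1 hO.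
have ex (s : R) : s *: e_z R + (x, y, z) = (x, y, s + z).
  by congr (_, _, _); rewrite /= /GRing.scale /= ?mulr1 ?mulr0 ?add0r.
have [|c ch] := @mvt_line R _ f f1 (x, y, z) (e_z R) h.
  by move=> s sh; apply: d1; rewrite ex; exact: hO.
by rewrite !ex; exists c.
Qed.

(** The way from q to h + q is broken into three segments parallel to the axes, first x, then y,
    then z. The mean value theorem on each one compares a partial derivative near q with its value
    at q, at a cost of e/3. *)
Lemma C1_estimate (f f1 f2 f3 : heis -> R) (O : set heis) q : open O -> O q ->
  (forall p, O p -> is_derive p (e_x R) f (f1 p)) ->
  (forall p, O p -> is_derive p (e_y R) f (f2 p)) ->
  (forall p, O p -> is_derive p (e_z R) f (f3 p)) ->
  {for q, continuous f1} -> {for q, continuous f2} -> {for q, continuous f3} ->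
  forall e : R, 0 < e -> \forall h \near (0 : heis),
   `|f (h + q) - (f q + (cx h * f1 q + cy h * f2 q + cz h * f3 q))| <= e * `|h|.
Proof.
move=> oO Oq d1 d2 d3 c1 c2 c3 e e0.
have e3 : 0 < e / 3 by rewrite divr_gt0.
have nO := open_nbhs_nbhs (conj oO Oq).
have N : nbhs q [set p | O p /\ [/\ `|f1 p - f1 q| <= e / 3,
    `|f2 p - f2 q| <= e / 3 & `|f3 p - f3 q| <= e / 3]].
  near=> p; split; first by near: p.
  split; rewrite distrC; near: p.
  - by move/cvgrPdist_le : c1; apply.
  - by move/cvgrPdist_le : c2; apply.
  - by move/cvgrPdist_le : c3; apply.
have /nbhs_ballP[d /= d0 hd] := N.
have nlt : \forall h \near (0 : heis), `|h| < d.
  have := @nbhs0_lt R (R * R * R)%type d d0.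
  exact.
apply: filterS nlt => h hlt.
have hx : `|cx h| <= `|h| by rewrite !prod_normE !le_max lexx.
have hy : `|cy h| <= `|h| by rewrite !prod_normE !le_max lexx orbT.
have hz : `|cz h| <= `|h| by rewrite !prod_normE !le_max lexx orbT.
have B (x y z : R) : `|x| <= `|cx h| -> `|y| <= `|cy h| -> `|z| <= `|cz h| ->
   [set p | O p /\ [/\ `|f1 p - f1 q| <= e / 3,
    `|f2 p - f2 q| <= e / 3 & `|f3 p - f3 q| <= e / 3]] (x + q.1.1, y + q.1.2, z + q.2).
  move=> xh yh zh; apply: hd.
  have E (a b : R) : `|a| < d -> ball b d (a + b).
    by move=> ad; rewrite /ball /= opprD addrCA subrr addr0 normrN.
  by split; [split|]; apply: E; apply: le_lt_trans hlt;
    [apply: le_trans hx|apply: le_trans hy|apply: le_trans hz].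
case: h hlt hx hy hz B => [[x y] z]; rewrite /cx /cy /cz /= => hlt hx hy hz B.
case: q Oq c1 c2 c3 nO N hd B => [[a b] c] Oq c1 c2 c3 nO N hd B.
have O1 (s : R) : `|s| <= `|x| -> O (s + a, y + b, z + c) /\ `|f1 (s + a, y + b, z + c) - f1 (a, b, c)| <= e / 3.
  by move=> sx; have [? []] := B s y z sx (lexx _) (lexx _).
have O2 (s : R) : `|s| <= `|y| -> O (a, s + b, z + c) /\ `|f2 (a, s + b, z + c) - f2 (a, b, c)| <= e / 3.
  move=> sy; have [] := B 0 s z _ sy (lexx _); first by rewrite normr0.
  by rewrite /= add0r => ? [].
have O3 (s : R) : `|s| <= `|z| -> O (a, b, s + c) /\ `|f3 (a, b, s + c) - f3 (a, b, c)| <= e / 3.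
  move=> sz; have [] := B 0 0 s _ _ sz; rewrite ?normr0 //.
  by rewrite /= !add0r => ? [].
have [s1 hs1 E1] := mvt_x d1 (fun s hs => (O1 s hs).1).
have [s2 hs2 E2] := mvt_y d2 (fun s hs => (O2 s hs).1).
have [s3 hs3 E3] := mvt_z d3 (fun s hs => (O3 s hs).1).
have {hs1} := (O1 _ hs1).2; have {hs2} := (O2 _ hs2).2; have {hs3} := (O3 _ hs3).2.
set F1 := f1 (a, b, c) in E1 *; set F2 := f2 (a, b, c) in E2 *; set F3 := f3 (a, b, c) in E3 *.
move=> k3 k2 k1; change ((x, y, z) + (a, b, c)) with (x + a, y + b, z + c).
have -> : f (x + a, y + b, z + c) - (f (a, b, c) + (x * F1 + y * F2 + z * F3)) =
  x * (f1 (s1 + a, y + b, z + c) - F1) + y * (f2 (a, s2 + b, z + c) - F2) + z * (f3 (a, b, s3 + c) - F3).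
  rewrite !mulrBr -E1 -E2 -E3.
  ring.
set N0 := `|_| in hlt hx hy hz *.
have T (u v w : R) : `|u| <= N0 -> `|w| <= e / 3 -> `|u * w| <= e / 3 * N0.
  by move=> hu hw; rewrite normrM mulrC ler_pM.
have := T _ 0 _ hx k1; have := T _ 0 _ hy k2; have := T _ 0 _ hz k3.
set A1 := x * _; set A2 := y * _; set A3 := z * _ => t3 t2 t1.
have := ler_normD (A1 + A2) A3; have := ler_normD A1 A2.
set n12 := `|A1 + A2|; set n123 := `|_ + A3|.
clear -t1 t2 t3 e0; move: t1 t2 t3; set m1 := `|A1|; set m2 := `|A2|; set m3 := `|A3|.
rewrite [e * N0](_ : _ = e / 3 * N0 + e / 3 * N0 + e / 3 * N0); last by field.
lra.
Unshelve. all: by end_near. Qed.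

Lemma C1_differentiable (f f1 f2 f3 : heis -> R) (O : set heis) q : open O -> O q ->
  (forall p, O p -> is_derive p (e_x R) f (f1 p)) ->
  (forall p, O p -> is_derive p (e_y R) f (f2 p)) ->
  (forall p, O p -> is_derive p (e_z R) f (f3 p)) ->
  {for q, continuous f1} -> {for q, continuous f2} -> {for q, continuous f3} ->
  is_diff q f (fun h => cx h * f1 q + cy h * f2 q + cz h * f3 q).
Proof.
move=> oO Oq d1 d2 d3 c1 c2 c3.
pose l (h : heis) := cx h * f1 q + cy h * f2 q + cz h * f3 q.
have ll : linear l.
  move=> a [[x y] z] [[x' y'] z']; rewrite /l /cx /cy /cz /= /GRing.scale /=; ring.
pose L := GRing.isLinear.Build R heis R *%R l ll.
pose lin : {linear heis -> R} := HB.pack l L.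
have cl : continuous lin.
  move=> p; rewrite /= /l.
  by apply: cvgD; [apply: cvgD|]; apply: cvgM; try exact: cvg_cst;
    [exact: continuous_cx|exact: continuous_cy|exact: continuous_cz].
have E : f \o shift q = cst (f q) + lin +o_ (0 : heis) id.
  apply/eqaddoP => e e0.
  have := C1_estimate oO Oq d1 d2 d3 c1 c2 c3 e0.
  by apply: filterS => h /=.
have df : 'd f q = lin :> (heis -> R) by exact: diff_unique.
split; first by apply/diff_locallyP; rewrite df.
by rewrite df.
Qed.

Lemma is_diff_derive (f : heis -> R) q L v : is_diff q f L -> is_derive q v f (L v).
Proof.
move=> [df dL]; split; first exact: diff_derivable.
by rewrite deriveE// dL.
Qed.

(** Directional derivatives do not determine the derivative along a curved path such as the orbit of
    a rotation; the total differential does. *)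
Lemma is_diff_curve (f : heis -> R) (g1 g2 g3 : R -> R) t a b c L :
  is_diff (g1 t, g2 t, g3 t) f L ->
  is_derive t (1 : R) g1 a -> is_derive t (1 : R) g2 b -> is_derive t (1 : R) g3 c ->
  is_derive t (1 : R) (fun s => f (g1 s, g2 s, g3 s)) (L (a, b, c)).
Proof.
move=> [df dL] [d1 e1] [d2 e2] [d3 e3].
have D1 : differentiable g1 t by apply/derivable1_diffP.
have D2 : differentiable g2 t by apply/derivable1_diffP.
have D3 : differentiable g3 t by apply/derivable1_diffP.
have D12 : differentiable (fun s => (g1 s, g2 s)) t by exact: differentiable_pair.
have D123 : differentiable (fun s => (g1 s, g2 s, g3 s)) t by exact: differentiable_pair.
have DD : differentiable (f \o (fun s => (g1 s, g2 s, g3 s))) t by exact: differentiable_comp.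
split; first exact/derivable1_diffP.
rewrite (_ : (fun s => f (g1 s, g2 s, g3 s)) = f \o (fun s => (g1 s, g2 s, g3 s)))//.
rewrite deriveE// diff_comp//= dL; congr L.
rewrite (@diff_pair _ _ _ _ (fun s => (g1 s, g2 s)) g3)//= (@diff_pair _ _ _ _ g1 g2)//=.
by rewrite -e1 -e2 -e3 !deriveE.
Qed.

Lemma smooth_is_diff U (f : heis -> R) q : open U -> smooth U f -> U q ->
  is_diff q f (fun h => cx h * 'D_(e_x R) f q + cy h * 'D_(e_y R) f q + cz h * 'D_(e_z R) f q).
Proof.
move=> oU sf Uq.
have S i := smooth_derive i sf.
apply: (@C1_differentiable f ('D_(e_x R) f) ('D_(e_y R) f) ('D_(e_z R) f) U q oU Uq).
- by move=> p Up; exact: (smooth_is_derive (ord0 : 'I_3) sf).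
- by move=> p Up; exact: (smooth_is_derive (Ordinal (isT : 1 < 3)%N) sf).
- by move=> p Up; exact: (smooth_is_derive (Ordinal (isT : 2 < 3)%N) sf).
- exact: (smooth_continuous (S (ord0 : 'I_3))).
- exact: (smooth_continuous (S (Ordinal (isT : 1 < 3)%N))).
- exact: (smooth_continuous (S (Ordinal (isT : 2 < 3)%N))).
Qed.

Lemma smooth_dx U (f : heis -> R) : smooth U f -> smooth U ('D_(e_x R) f).
Proof. exact: (@smooth_derive R U f (ord0 : 'I_3)). Qed.
Lemma smooth_dy U (f : heis -> R) : smooth U f -> smooth U ('D_(e_y R) f).
Proof. exact: (@smooth_derive R U f (Ordinal (isT : 1 < 3)%N)). Qed.
Lemma smooth_dz U (f : heis -> R) : smooth U f -> smooth U ('D_(e_z R) f).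
Proof. exact: (@smooth_derive R U f (Ordinal (isT : 2 < 3)%N)). Qed.

End C1.

(** * The Poincare lemma on starlike sets *)

Section Poincare.
Variable R : realType.
Local Notation heis := (heis R).
Local Notation frame := (frame R).
Implicit Types (O : set heis).

Lemma continuous_sum (T : topologicalType) n (f : 'I_n -> T -> R) (x : T) :
  (forall i, {for x, continuous (f i)}) ->
  {for x, continuous (fun y => \sum_(i < n) f i y)}.
Proof.
move=> cf.
have E : \sum_(i < n) f i = (fun y => \sum_(i < n) f i y).
  by apply/funext => y; rewrite fct_sumE.
suff H : {for x, continuous (\sum_(i < n) f i)}.
  exact: (eq_ind _ (fun h => {for x, continuous h}) H _ E).
elim/big_ind : _ => //; first exact: cvg_cst.
by move=> g h cg ch; apply: cvgD.
Qed.

Lemma is_derive_sumE (V : normedModType R) n (f : 'I_n -> V -> R) (df : 'I_n -> R) (x v : V) :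
  (forall i, is_derive x v (f i) (df i)) ->
  is_derive x v (fun y => \sum_(i < n) f i y) (\sum_(i < n) df i).
Proof.
move=> d; have -> : (fun y => \sum_(i < n) f i y) = \sum_(i < n) f i.
  by apply/funext => y; rewrite fct_sumE.
exact: is_derive_sum.
Qed.

(** Coordinates indexed in the same way as [frame], so that the value of a 1-form is a finite
    sum. *)
Definition crd (i : 'I_3) (v : heis) : R := [:: cx v; cy v; cz v]`_i.

Lemma smooth_is_diff_sum O (f : heis -> R) q : open O -> smooth O f -> O q ->
  is_diff q f (fun h => \sum_(i < 3) crd i h * 'D_(frame i) f q).
Proof.
move=> oO sf Oq.
suff -> : (fun h => \sum_(i < 3) crd i h * 'D_(frame i) f q) =
  (fun h => cx h * 'D_(e_x R) f q + cy h * 'D_(e_y R) f q + cz h * 'D_(e_z R) f q).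
  exact: smooth_is_diff oO sf Oq.
by apply/funext => h; rewrite !big_ord_recr big_ord0 /= add0r.
Qed.

Lemma is_derive_affine (A : heis -> heis) (f : heis -> R) q v w d :
  (forall h : R, A (h *: v + q) = h *: w + A q) -> is_derive (A q) w f d ->
  is_derive q v (fun p => f (A p)) d.
Proof.
move=> hA [d1 d2].
have E : (fun h : R => h^-1 *: (f (A (h *: v + q)) - f (A q))) =
  (fun h : R => h^-1 *: (f (h *: w + A q) - f (A q))).
  by apply/funext => h; rewrite hA.
by split; [move: d1; rewrite /derivable E|rewrite -d2 /derive E].
Qed.

Lemma crd_frame i j : crd i (frame j) = (i == j)%:R.
Proof. by case: i => -[|[|[|//]]] ?; case: j => -[|[|[|//]]] ?. Qed.

Lemma crdZ i (a : R) v : crd i (a *: v) = a * crd i v.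
Proof. by case: i => -[|[|[|//]]] ?. Qed.

Lemma is_derive_crd i q v : is_derive q v (crd i) (crd i v).
Proof.
apply: is_derive_additive => h u.
by case: i => -[|[|[|//]]] ?.
Qed.

Lemma continuous_crd i : continuous (crd i).
Proof.
move=> q; case: i => -[|[|[|//]]] ?; rewrite /crd /=.
- exact: continuous_cx.
- exact: continuous_cy.
- exact: continuous_cz.
Qed.

(** Beyond the derivatives, [Ck] asks for continuity of [g] itself. The existence of partial
    derivatives alone would not give it; their continuity does, through total differentiability. *)
Lemma smooth_of_gradient O (g : heis -> R) (B : 'I_3 -> heis -> R) : open O ->
  (forall i q, O q -> is_derive q (frame i) g (B i q)) -> (forall i, smooth O (B i)) ->
  smooth O g.
Proof.
move=> oO dg sB.
have cg q : O q -> {for q, continuous g}.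
  move=> Oq.
  have [] := @C1_differentiable R g (B (inord 0)) (B (inord 1)) (B (inord 2)) O q oO Oq.
  - by move=> p Op; have := dg (inord 0) p Op; rewrite /Defs.frame inordK.
  - by move=> p Op; have := dg (inord 1) p Op; rewrite /Defs.frame inordK.
  - by move=> p Op; have := dg (inord 2) p Op; rewrite /Defs.frame inordK.
  - exact: (smooth_continuous (sB _)).
  - exact: (smooth_continuous (sB _)).
  - exact: (smooth_continuous (sB _)).
  - by move=> /differentiable_continuous.
case=> [|k]; split => // i; split=> [q /(dg i) []//|].
by apply: (eq_Ck oO _ (sB i k)) => q /(dg i) [].
Qed.

Definition starlike O (p : heis) := forall q (t : R), O q -> t \in `[0, 1] ->
  O (t *: (q - p) + p).

(** The potential is the integral of [B] along the segment from [p0] to q, differentiated under the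
    integral sign. *)
Lemma poincare O (p0 : heis) (B : 'I_3 -> heis -> R) : open O ->
  starlike O p0 -> (forall i, smooth O (B i)) ->
  (forall i j q, O q -> 'D_(frame i) (B j) q = 'D_(frame j) (B i) q) ->
  exists g : heis -> R, forall i q, O q -> is_derive q (frame i) g (B i q).
Proof.
move=> oO star sB clB.
pose gam (q : heis) (t : R) : heis := t *: (q - p0) + p0.
have cgam (x : heis * R) : {for x, continuous (fun x : heis * R => gam x.1 x.2)}.
  apply: cvgD; last exact: cvg_cst.
  apply: (@cvgZ _ _ _ _ _ snd (fun x : heis * R => x.1 - p0)); first exact: cvg_snd.
  by apply: cvgB; [exact: cvg_fst|exact: cvg_cst].
have jB (f : heis -> R) : smooth O f -> jcont O 0 1 (fun q t => f (gam q t)).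
  move=> sf q t Oq t01.
  apply: (@continuous_comp _ _ _ (fun x : heis * R => gam x.1 x.2) f).
    exact: cgam.
  by apply: (smooth_continuous sf); exact: star.
pose F (q : heis) (t : R) := \sum_(i < 3) crd i (q - p0) * B i (gam q t).
pose dF j (q : heis) (t : R) := B j (gam q t) +
  t * \sum_(i < 3) crd i (q - p0) * 'D_(frame j) (B i) (gam q t).
have ccrd i (x : heis * R) : {for x, continuous (fun x : heis * R => crd i (x.1 - p0))}.
  apply: (@continuous_comp _ _ _ (fun x : heis * R => x.1 - p0) (crd i)).
    by apply: cvgB; [exact: cvg_fst|exact: cvg_cst].
  exact: continuous_crd.
have jF : jcont O 0 1 F.
  move=> q t Oq t01; apply: continuous_sum => i.
  by apply: cvgM; [exact: ccrd|exact: (jB _ (sB i) q t Oq t01)].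
have jdF j : jcont O 0 1 (dF j).
  move=> q t Oq t01; apply: cvgD; first exact: (jB _ (sB j) q t Oq t01).
  apply: cvgM; first exact: cvg_snd.
  apply: continuous_sum => i; apply: cvgM; first exact: ccrd.
  exact: (jB _ (smooth_derive j (sB i)) q t Oq t01).
exists (fun q => sint 0 1 (F q)) => j q Oq.
(* Closedness allows the two indices in [dF] to be exchanged, which makes [dF j q t] the
   t-derivative of t B_j(gam q t). The factor t kills the boundary value at 0, and [gam q 1] is
   q. *)
have -> : B j q = sint 0 1 (dF j q).
  have e1 : gam q 1 = q by rewrite /gam scale1r subrK.
  transitivity (1 * B j (gam q 1) - 0 * B j (gam q 0)).
    by rewrite mul1r mul0r subr0 e1.
  apply/esym/(@sint_FTC R 0 1 (dF j q) (fun t => t * B j (gam q t))).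
  - exact: ler01.
  - exact: (jcont_seg (jdF j)).
  move=> t t01.
  have dB : is_derive t (1 : R) (fun t => B j (gam q t))
     (\sum_(i < 3) crd i (q - p0) * 'D_(frame i) (B j) (gam q t)).
    apply: is_derive_line.
    apply: (is_diff_derive (q - p0) (smooth_is_diff_sum oO (sB j) (star _ _ Oq t01))).
  apply: is_derive_eq (is_deriveM (is_derive_id t (1 : R)) dB) _.
  rewrite /dF addrC /GRing.scale /= mulr1; congr (_ + t * _).
  by apply: eq_bigr => i _; rewrite clB//; exact: star.
apply: (@sint_param_derive _ _ O 0 1 F (dF j) q (frame j)) => // p t Op t01.
have -> : dF j p t = \sum_(i < 3) (crd i (p - p0) * (t * 'D_(frame j) (B i) (gam p t)) +
     B i (gam p t) * crd i (frame j)).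
  rewrite /dF big_split /= addrC; congr (_ + _).
    rewrite (bigD1 j)//= crd_frame eqxx mulr1 big1 ?addr0// => i /negPf ij.
    by rewrite crd_frame ij mulr0.
  by rewrite mulr_sumr; apply: eq_bigr => i _; rewrite mulrCA.
apply: is_derive_sumE => i; apply: is_deriveM.
  apply: (@is_derive_affine (fun p => p - p0) (crd i) p (frame j) (frame j)).
    by move=> h; rewrite addrA.
    exact: is_derive_crd.
apply: (@is_derive_affine (fun p => gam p t) (B i) p (frame j) (t *: frame j)).
  by move=> h; rewrite /gam -addrA scalerDr -addrA scalerA mulrC -scalerA.
have := is_diff_derive (t *: frame j) (smooth_is_diff_sum oO (sB i) (star _ _ Op t01)).
rewrite (bigD1 j)//= big1 ?addr0; last first.
  by move=> k /negPf kj; rewrite crdZ crd_frame kj mulr0 mul0r.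
by rewrite crdZ crd_frame eqxx mulr1.
Qed.

Lemma zero_gradient_cst O (f : heis -> R) p q : open O -> starlike O p ->
  (forall i q, O q -> is_derive q (frame i) f 0) -> O p -> O q -> f q = f p.
Proof.
move=> oO star df Op Oq.
have sf : smooth O f.
  by apply: (smooth_of_gradient oO df) => i; exact: smooth_cst.
have D (t : R) : t \in `[0, 1] -> is_derive t (1 : R) (fun t => f (t *: (q - p) + p)) 0.
  move=> t01; apply: is_derive_line.
  have := is_diff_derive (q - p) (smooth_is_diff_sum oO sf (star _ _ Oq t01)).
  rewrite big1 // => i _.
  by have [_ ->] := df i _ (star _ _ Oq t01); rewrite mulr0.
have := @sint_FTC R 0 1 (fun=> 0) _ ler01 _ D.
rewrite scale1r subrK scale0r add0r (sint_cst _ ler01) mul0r => /(_ _)/eqP.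
by rewrite eq_sym subr_eq0 => /(_ _)/eqP; apply=> t _; exact: cvg_cst.
Qed.

End Poincare.

(** * Closed forms off the axis and the reduction to [A_alpha] *)

Section Gauge.
Variable R : realType.
Local Notation heis := (heis R).
Local Notation frame := (frame R).
Local Notation U := (@heis_off_axis R).

Local Notation rad := (@Defs.rad R).

(** The square of the radius is a polynomial, smooth across the axis, unlike [rad]. *)
Definition rad2 (q : heis) : R := cx q ^+ 2 + cy q ^+ 2.

Lemma rad2E (q : heis) : rad q ^+ 2 = rad2 q.
Proof. by rewrite /rad sqr_sqrtr// addr_ge0// sqr_ge0. Qed.

Lemma rad2_gt0 (q : heis) : U q -> 0 < rad2 q.
Proof.
move=> Uq; rewrite lt_neqAle eq_sym addr_ge0 ?sqr_ge0// andbT.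
rewrite paddr_eq0 ?sqr_ge0// !sqrf_eq0; apply/negP => /andP[/eqP x0 /eqP y0].
exact: Uq.
Qed.

Lemma continuous_rad2 : continuous rad2.
Proof.
move=> q; rewrite /rad2 /=; apply: (@cvgD _ R^o); apply: (@cvgM R).
- exact: continuous_cx.
- exact: continuous_cx.
- exact: continuous_cy.
- exact: continuous_cy.
Qed.

Lemma off_axisE : U = rad2 @^-1` [set x | 0 < x].
Proof.
apply/seteqP; split=> q; first exact: rad2_gt0.
move=> /= r0 [x0 y0]; move: r0.
by rewrite /rad2 x0 y0 expr0n addr0 ltxx.
Qed.

Lemma open_off_axis : open U.
Proof.
rewrite off_axisE; apply: open_comp; last exact: open_gt.
by move=> q _; exact: continuous_rad2.
Qed.

Lemma smooth_rad2 O : open O -> smooth O rad2.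
Proof.
move=> oO; apply: smooth_exprP => //; apply: SE_add; apply: SE_mul.
- exact: SE_cx.
- exact: SE_cx.
- exact: SE_cy.
- exact: SE_cy.
Qed.

Lemma is_derive_inv (x : R) : x != 0 -> is_derive x (1 : R) (fun x : R => x^-1) (- x ^- 2).
Proof.
move=> x0.
have H := is_deriveV (f := id) x0 (is_derive_id x (1 : R)).
by apply: is_derive_eq H _; rewrite /GRing.scale /= mulr1.
Qed.

Lemma is_derive_pow n (x : R) :
  is_derive x (1 : R) (fun y : R => y ^+ n) (n%:R * x ^+ n.-1).
Proof.
rewrite (_ : (fun y : R => y ^+ n) = (id : R -> R) ^+ n); last first.
  by apply/funext => y; rewrite exprfctE.
apply: is_derive_eq (is_deriveX n (is_derive_id x (1 : R))) _.
by rewrite /GRing.scale /= mulr1.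
Qed.

Definition inv_family (phi : R -> R) := exists c n, phi = fun x => c * x^-1 ^+ n.

Lemma inv_family_closed : derive_closed [set x : R | x != 0] inv_family.
Proof.
move=> _ [c [n ->]]; exists (fun x => (- (c * n%:R)) * x^-1 ^+ n.+1).
  by exists (- (c * n%:R)), n.+1.
move=> x /= x0.
have di := is_derive_inv x0.
have dp : is_derive (x^-1) (1 : R) (fun y : R => c * y ^+ n) (c * (n%:R * x^-1 ^+ n.-1)).
  apply: is_derive_eq (is_deriveM (is_derive_cst c _ _) (is_derive_pow n _)) _.
  by rewrite /GRing.scale /= mulr0 addr0.
apply: is_derive_eq (is_derive1_comp dp di) _.
case: n dp => [|n] dp; first by rewrite !(mul0r, mulr0) oppr0 mul0r.
by rewrite -[x ^- 2]exprVn !exprS expr0 /=; ring.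
Qed.

Lemma smooth_inv (O : set heis) (f : heis -> R) : open O -> smooth O f -> (forall q, O q -> f q != 0) ->
  smooth O (fun q => (f q)^-1).
Proof.
move=> oO sf f0; apply: (smooth_comp oO inv_family_closed _ sf f0).
by exists 1, 1%N; apply/funext => x; rewrite mul1r.
Qed.

Lemma smooth_dphi v : smooth U (fun q => dphi q v).
Proof.
rewrite (_ : (fun q => dphi q v) = (fun q => (cx q * cy v + (- cx v) * cy q) * (rad2 q)^-1)); last first.
  by apply/funext => q; rewrite /dphi rad2E mulNr [cx v * _]mulrC.
have oU := open_off_axis.
apply: (smoothM oU); last first.
  apply: (smooth_inv oU (smooth_rad2 oU)) => q Uq.
  by rewrite gt_eqF// rad2_gt0.
apply: (smoothD oU); apply: (smoothM oU).
- exact: smooth_cx.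
- exact: smooth_cst.
- exact: smooth_cst.
- exact: smooth_cy.
Qed.

(** On each half-space where x keeps its sign this is a branch of the angle up to a constant; the
    next primitive serves the half-spaces where y keeps its sign. *)
Lemma is_derive_atan_yx (q v : heis) : cx q != 0 ->
  is_derive q v (fun q => atan (cy q / cx q)) (dphi q v).
Proof.
move=> x0.
have di : is_derive q v (fun q => (cx q)^-1) (- cx q ^- 2 * cx v).
  apply: is_derive_comp1; first exact: is_derive_cx.
  exact: is_derive_inv.
have dq := is_deriveM (is_derive_cy q v) di.
apply: is_derive_eq (is_derive_comp1 dq (is_derive1_atan _)) _.
rewrite /dphi rad2E /rad2 /GRing.scale /=.
have r0 : cx q ^+ 2 + cy q ^+ 2 != 0.
  by rewrite gt_eqF// rad2_gt0// => -[/eqP]; rewrite (negPf x0).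
have r1 : 1 + (cy q / cx q) ^+ 2 != 0 by rewrite gt_eqF// ltr_wpDr// sqr_ge0.
rewrite [X in 1 + X ^+ 2](_ : _ = cy q / cx q)//.
by field; rewrite r0 x0.
Qed.

Lemma is_derive_atan_xy (q v : heis) : cy q != 0 ->
  is_derive q v (fun q => - atan (cx q / cy q)) (dphi q v).
Proof.
move=> x0.
have di : is_derive q v (fun q => (cy q)^-1) (- cy q ^- 2 * cy v).
  apply: is_derive_comp1; first exact: is_derive_cy.
  exact: is_derive_inv.
have dq := is_deriveM (is_derive_cx q v) di.
apply: is_derive_eq (is_deriveN (is_derive_comp1 dq (is_derive1_atan _))) _.
rewrite /dphi rad2E /rad2 /GRing.scale /=.
have r0 : cx q ^+ 2 + cy q ^+ 2 != 0.
  by rewrite gt_eqF// rad2_gt0// => -[_ /eqP]; rewrite (negPf x0).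
rewrite [X in 1 + X ^+ 2](_ : _ = cx q / cy q)//.
by field; rewrite r0 x0.
Qed.

Definition half (l : heis -> R) : set heis := [set q | 0 < l q].

Definition additive_form (l : heis -> R) := forall (h : R) v u, l (h *: v + u) = h * l v + l u.

Lemma starlike_half l p : additive_form l -> 0 < l p -> starlike (half l) p.
Proof.
move=> ll lp q t lq; rewrite in_itv /= => /andP[t0 t1].
have lqp : l (q - p) = l q - l p.
  by have := ll (-1) p q; rewrite scaleN1r addrC => ->; ring.
rewrite /half /= in lq *; rewrite ll lqp.
have -> : t * (l q - l p) + l p = t * l q + (1 - t) * l p by ring.
have [->|tn0] := eqVneq t 0; first by rewrite mul0r subr0 mul1r add0r.
by rewrite ltr_wpDr ?mulr_ge0 ?subr_ge0 ?(ltW lp)// mulr_gt0// lt_neqAle eq_sym tn0.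
Qed.

Lemma starlikeI (O O' : set heis) p : starlike O p -> starlike O' p -> starlike (O `&` O') p.
Proof. by move=> s s' q t [Oq O'q] t01; split; [exact: s|exact: s']. Qed.

Lemma open_half (l : heis -> R) : continuous l -> open (half l).
Proof.
move=> cl; rewrite (_ : half l = l @^-1` [set x | 0 < x])//.
by apply: open_comp; [move=> q _; exact: cl|exact: open_gt].
Qed.

Let lx (q : heis) := cx q.
Let ly (q : heis) := cy q.
Let mx (q : heis) := - cx q.
Let my (q : heis) := - cy q.

Lemma half_forms :
  [/\ additive_form lx, additive_form ly, additive_form mx & additive_form my] /\
  [/\ open (half lx), open (half ly), open (half mx) & open (half my)] /\
  [/\ half lx `<=` U, half ly `<=` U, half mx `<=` U & half my `<=` U].
Proof.
split; last split.
- by split=> h v u //; rewrite /mx /my mulrN -opprD.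
- split; apply: open_half => q.
  + exact: continuous_cx.
  + exact: continuous_cy.
  + by apply: cvgN; exact: continuous_cx.
  + by apply: cvgN; exact: continuous_cy.
- by split=> q + [x0 y0]; rewrite /half /lx /ly /mx /my /= ?x0 ?y0 ?oppr0 ltxx.
Qed.

(* The monodromy of the closed form B around the axis determines alpha. *)
Lemma closed_off_axis (B : 'I_3 -> heis -> R) :
  (forall i, smooth U (B i)) ->
  (forall i j q, U q -> 'D_(frame i) (B j) q = 'D_(frame j) (B i) q) ->
  exists alpha (g : heis -> R), forall i q, U q ->
    is_derive q (frame i) g (B i q - alpha * dphi q (frame i)).
Proof.
move=> sB clB.
have [aa4 [oo4 uu4]] := half_forms.
have [a1 a2 a3 a4] := aa4; have [op1 op2 op3 op4] := oo4; have [u1 u2 u3 u4] := uu4.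
have P l p : additive_form l -> open (half l) -> half l `<=` U -> 0 < l p ->
    exists g : heis -> R, forall i q, half l q -> is_derive q (frame i) g (B i q).
  move=> al ol lU lp.
  apply: (poincare ol (starlike_half al lp)) => [i|i j q /lU]; last exact: clB.
  exact: smooth_subset lU (sB i).
have [g1 d1] := P lx (1, 0, 0) a1 op1 u1 (ltr01 : 0 < lx (1, 0, 0)).
have [g2 d2] := P ly (0, 1, 0) a2 op2 u2 (ltr01 : 0 < ly (0, 1, 0)).
have m1 : 0 < - (-1) :> R by rewrite opprK.
have [g3 d3] := P mx (-1, 0, 0) a3 op3 u3 (m1 : 0 < mx (-1, 0, 0)).
have [g4 d4] := P my (0, -1, 0) a4 op4 u4 (m1 : 0 < my (0, -1, 0)).
pose p12 : heis := (1, 1, 0). pose p23 : heis := (-1, 1, 0).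
pose p34 : heis := (-1, -1, 0). pose p41 : heis := (1, -1, 0).
(* Turning counterclockwise through the overlaps of neighbouring half-spaces, [c2], [c3] and [c4]
   make consecutive primitives agree at one point of each overlap. The mismatch [m] left after a
   full turn is the period of [B]. *)
pose c2 := g1 p12 - g2 p12. pose c3 := g2 p23 + c2 - g3 p23.
pose c4 := g3 p34 + c3 - g4 p34. pose m := g4 p41 + c4 - g1 p41.
pose al := m / (2 * pi).
have pi0 : 2 * pi != 0 :> R by rewrite mulf_neq0// gt_eqF// pi_gt0.
have mE : m = al * (2 * pi) by rewrite /al mulfVK.
pose aa (q : heis) : R := atan (cy q / cx q). pose bb (q : heis) : R := - atan (cx q / cy q).
(* Each primitive loses [al] times a branch of the angle. The four branches agree on the first three
   overlaps and differ by 2 pi on the last one, which cancels [m]. *)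
pose G1 q := g1 q - al * aa q.
pose G2 q := g2 q + c2 - al * (pi / 2 + bb q).
pose G3 q := g3 q + c3 - al * (pi + aa q).
pose G4 q := g4 q + c4 - al * (3 * pi / 2 + bb q).
pose W i q := B i q - al * dphi q (frame i).
have E (g f : heis -> R) (c k : R) i q : is_derive q (frame i) g (B i q) ->
    is_derive q (frame i) f (dphi q (frame i)) ->
    is_derive q (frame i) (fun q => g q + c - al * (k + f q)) (W i q).
  move=> dg df.
  apply: is_derive_eq (is_deriveB (is_deriveD dg (is_derive_cst c _ _))
    (is_deriveM (is_derive_cst al _ _) (is_deriveD (is_derive_cst k _ _) df))) _.
  by rewrite /W /GRing.scale /= mulr0 !addr0 add0r.
have D1 i q : half lx q -> is_derive q (frame i) G1 (W i q).
  move=> h; have x0 : cx q != 0 by rewrite gt_eqF.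
  have := E g1 aa 0 0 i q (d1 i q h) (is_derive_atan_yx _ x0).
  rewrite (_ : (fun q => g1 q + 0 - al * (0 + aa q)) = G1)//.
  by apply/funext => p; rewrite addr0 add0r.
have D2 i q : half ly q -> is_derive q (frame i) G2 (W i q).
  move=> h; have y0 : cy q != 0 by rewrite gt_eqF.
  exact: E (d2 i q h) (is_derive_atan_xy _ y0).
have D3 i q : half mx q -> is_derive q (frame i) G3 (W i q).
  move=> h; have x0 : cx q != 0 by rewrite lt_eqF// -oppr_gt0.
  exact: E (d3 i q h) (is_derive_atan_yx _ x0).
have D4 i q : half my q -> is_derive q (frame i) G4 (W i q).
  move=> h; have y0 : cy q != 0 by rewrite lt_eqF// -oppr_gt0.
  exact: E (d4 i q h) (is_derive_atan_xy _ y0).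
have glue l l' p G G' q : additive_form l -> additive_form l' ->
    open (half l) -> open (half l') -> 0 < l p -> 0 < l' p ->
    (forall i q, half l q -> is_derive q (frame i) G (W i q)) ->
    (forall i q, half l' q -> is_derive q (frame i) G' (W i q)) ->
    G p = G' p -> 0 < l q -> 0 < l' q -> G q = G' q.
  move=> hl hl' ol ol' lp l'p dG dG' GG' lq l'q.
  apply/eqP; rewrite -subr_eq0.
  suff -> : G q - G' q = G p - G' p by rewrite GG' subrr.
  apply: (@zero_gradient_cst R (half l `&` half l') (fun q => G q - G' q) p q); last 2 first.
  - by split.
  - by split.
  - exact: openI.
  - by apply: starlikeI; exact: starlike_half.
  - move=> i r [lr l'r]; apply: is_derive_eq (is_deriveB (dG i r lr) (dG' i r l'r)) _.
    by rewrite subrr.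
have mm1 : (-1) / (-1) = 1 :> R by rewrite divff// oppr_eq0 oner_eq0.
have m1m : 1 / (-1) = -1 :> R by rewrite invrN1 mul1r.
have q12 q : 0 < lx q -> 0 < ly q -> G1 q = G2 q.
  apply: (glue lx ly p12) => //.
  by rewrite /G1 /G2 /aa /bb /p12 /cx /cy /= divr1 atan1 /c2 -/p12; field.
have q23 q : 0 < ly q -> 0 < mx q -> G2 q = G3 q.
  apply: (glue ly mx p23) => //.
  by rewrite /G2 /G3 /aa /bb /p23 /cx /cy /= divr1 m1m atanN atan1 /c3 -/p23; field.
have q34 q : 0 < mx q -> 0 < my q -> G3 q = G4 q.
  apply: (glue mx my p34) => //.
  by rewrite /G3 /G4 /aa /bb /p34 /cx /cy /= mm1 atan1 /c4 -/p34; field.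
have q41 q : 0 < my q -> 0 < lx q -> G4 q = G1 q.
  apply: (glue my lx p41) => //.
  rewrite /G4 /G1 /aa /bb /p41 /cx /cy /= divr1 m1m atanN atan1 -/p41.
  have -> : g4 p41 + c4 = al * (2 * pi) + g1 p41 by rewrite -mE /m subrK.
  by field.
(* Opposite half-spaces are disjoint, so the agreement on the four overlaps of neighbours makes the
   value independent of the order of the tests. *)
pose g q := if 0 < lx q then G1 q else if 0 < ly q then G2 q else
            if 0 < mx q then G3 q else G4 q.
exists al, g => i q Uq.
have N l G : open (half l) -> 0 < l q -> (forall p, 0 < l p -> G p = g p) ->
    is_derive q (frame i) G (W i q) -> is_derive q (frame i) g (W i q).
  move=> ol lq Gg; apply: near_eq_is_derive.
  by apply: filterS (open_nbhs_nbhs (conj ol lq)) => p; exact: Gg.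
have [h|hx] := ltP 0 (lx q).
  by apply: (N lx G1 op1 h _ (D1 i q h)) => p hp; rewrite /g hp.
have [h|hy] := ltP 0 (ly q).
  apply: (N ly G2 op2 h _ (D2 i q h)) => p hp; rewrite /g hp.
  by case: ifPn => // hp'; rewrite q12.
have [h|hmx] := ltP 0 (mx q).
  apply: (N mx G3 op3 h _ (D3 i q h)) => p hp; rewrite /g hp.
  case: ifPn => [hp'|_]; last by case: ifPn => // hp'; rewrite q23.
  by move: hp hp'; rewrite /mx /lx oppr_gt0 => /lt_trans h1 /h1; rewrite ltxx.
have h : 0 < my q.
  rewrite /my oppr_gt0 lt_neqAle hy andbT; apply/negP => /eqP y0.
  apply: Uq; split=> //; apply/eqP; rewrite eq_le hx /=.
  by move: hmx; rewrite /mx oppr_le0.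
apply: (N my G4 op4 h _ (D4 i q h)) => p hp; rewrite /g.
case: ifPn => [hp'|_]; first by rewrite q41.
case: ifPn => [hp'|_].
  by move: hp hp'; rewrite /my /ly oppr_gt0 => /lt_trans h1 /h1; rewrite ltxx.
by case: ifPn => // hp'; rewrite q34.
Qed.

Lemma form_frame (th : form1 R) (q : heis) : smooth_form1 U th -> U q -> forall v,
  th q v = cx v * th q (e_x R) + cy v * th q (e_y R) + cz v * th q (e_z R).
Proof.
move=> [lth _] Uq v; have L := lth q Uq.
have L0 : th q 0 = 0.
  have := L 1 0 0; rewrite scaler0 addr0 mul1r => /eqP.
  by rewrite -subr_eq0 opprD addNKr oppr_eq0 => /eqP.
have -> : v = cx v *: e_x R + (cy v *: e_y R + (cz v *: e_z R + 0)).
  case: v => [[x y] z]; rewrite /cx /cy /cz addr0.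
  by congr (_, _, _); rewrite /= /GRing.scale /= !(mulr0, mulr1) ?addr0 ?add0r.
rewrite !L L0 addr0 addrA.
by rewrite /cx /cy /cz /= /GRing.scale /= !(mulr0, mulr1, addr0, add0r).
Qed.

Lemma gauge_A_alpha (A : form1 R) : aharonov_bohm U A ->
  exists alpha : R, gauge_equivalent U A (A_alpha alpha).
Proof.
move=> [sA [At [sAt [f0 sf0 Atf0] _] clAt] _].
have sB (i : 'I_3) : smooth U (fun q => At q (frame i)) by apply: sAt.2.
have [|al [g dg]] := closed_off_axis sB.
  move=> i j q Uq; have := clAt q Uq (frame i) (frame j); rewrite /extd => /eqP.
  by rewrite eq_sym subr_eq0 => /eqP.
have oU := open_off_axis.
have sg : smooth U g.
  apply: (smooth_of_gradient oU dg) => i.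
  rewrite (_ : (fun q => _) = (fun q => At q (frame i) + (- al) * dphi q (frame i))); last first.
    by apply/funext => q; rewrite mulNr.
  apply: (smoothD oU); first exact: sB.
  by apply: (smoothM oU); [exact: smooth_cst|exact: smooth_dphi].
(* The full differential of [g] is [dH g] plus its z-derivative times omega, and [f0] is the
   multiple of omega by which the lift exceeds [A]; their difference is the coefficient of omega. *)
exists al, g => //; exists (fun q => 'D_(e_z R) g q + (-1) * f0 q).
  apply: (smoothD oU); first exact: smooth_dz.
  by apply: (smoothM oU) => //; exact: smooth_cst.
move=> q Uq v.
have := Atf0 q Uq v; rewrite (form_frame sAt Uq) => /(canLR (addrK _)) <-.
have dx : At q (e_x R) = 'D_(e_x R) g q + al * dphi q (e_x R).
  by have [_ ->] := dg (ord0 : 'I_3) q Uq; rewrite subrK.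
have dy : At q (e_y R) = 'D_(e_y R) g q + al * dphi q (e_y R).
  by have [_ ->] := dg (Ordinal (isT : 1 < 3)%N) q Uq; rewrite subrK.
have dz : At q (e_z R) = 'D_(e_z R) g q + al * dphi q (e_z R).
  by have [_ ->] := dg (Ordinal (isT : 2 < 3)%N) q Uq; rewrite subrK.
rewrite dx dy dz /A_alpha /dH /opX /opY /dphi /omega /Defs.dx /Defs.dy rad2E.
have r0 : rad2 q != 0 by rewrite gt_eqF// rad2_gt0.
have -> : cx (e_x R) = 1 by []. have -> : cy (e_x R) = 0 by [].
have -> : cx (e_y R) = 0 by []. have -> : cy (e_y R) = 1 by [].
have -> : cx (e_z R) = 0 by []. have -> : cy (e_z R) = 0 by [].
move: (rad2 q) r0 (cx q) (cy q) (cx v) (cy v) (cz v) ('D_(e_x R) g q) ('D_(e_y R) g q)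
  ('D_(e_z R) g q) (f0 q) => r r0 x y vx vy vz gx gy gz f.
by field.
Qed.

End Gauge.

(** * Measurability of continuous functions on products, and Fubini on rectangles *)

Section Measurability.
Variable R : realType.

(* f is the pointwise limit of the functions obtained by rounding the second
   variable down to a multiple of 1/n. *)
Lemma caratheodory_measurable d (T : measurableType d) (f : T * R -> R) :
  (forall z, measurable_fun setT (fun t => f (t, z))) ->
  (forall t, continuous (fun z => f (t, z))) -> measurable_fun setT f.
Proof.
move=> mf cf.
pose rd (n : nat) (z : R) : R := (Num.floor (z * n.+1%:R))%:~R / n.+1%:R.
apply: (@measurable_fun_cvg _ _ R setT (fun n p => f (p.1, rd n p.2))).
  move=> n _ B mB; rewrite setTI.
  rewrite (_ : _ @^-1` _ = \bigcup_(k in [set: int])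
     (((fun t => f (t, k%:~R / n.+1%:R)) @^-1` B) `*`
      [set` `[(k%:~R / n.+1%:R : R), ((k + 1)%:~R / n.+1%:R : R)[])); last first.
    have n0 : 0 < n.+1%:R :> R by [].
    apply/seteqP; split=> [[t z] /= Bt|[t z] [k _ [/= Bt]]].
      exists (Num.floor (z * n.+1%:R)) => //; split=> //=.
      by rewrite in_itv /= ler_pdivrMr// ltr_pdivlMr//; exact: floor_itv.
    rewrite in_itv /= ler_pdivrMr// ltr_pdivlMr// => kz.
    by rewrite /rd (floor_def kz).
  apply: countable_bigcupT_measurable => // k.
  apply: measurableX; last exact: measurable_itv.
  by rewrite -[X in measurable X]setTI; exact: mf.
move=> [t z] _ /=.
apply: (@cvg_comp _ _ _ (fun n => rd n z) (fun y => f (t, y)) _ _ _ _ (cf t z)).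
apply/cvgrPdist_le => e e0.
near=> n.
have n0 : 0 < n.+1%:R :> R by [].
have /andP[h1 h2] := floor_itv (z * n.+1%:R).
have -> : z - rd n z = (z * n.+1%:R - (Num.floor (z * n.+1%:R))%:~R) / n.+1%:R.
  by rewrite /rd mulrBl mulfK// gt_eqF.
rewrite normrM ger0_norm ?subr_ge0// ger0_norm ?invr_ge0 ?ler0n//.
rewrite ler_pdivrMr// (@le_trans _ _ 1)//.
  by rewrite lerBlDl -intrD1 ltW.
rewrite mulrC -ler_pdivrMr// div1r.
near: n; exists (Num.bound e^-1) => // n /= hn.
have := archi_boundP (ltW (_ : 0 < e^-1)); rewrite invr_gt0 => /(_ e0) h.
rewrite ltW// (lt_le_trans h)// ler_nat; exact: leq_trans hn _.
Unshelve. all: by end_near. Qed.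

Lemma continuous_measurable2 (f : R * R -> R) : continuous f -> measurable_fun setT f.
Proof.
move=> cf; apply: caratheodory_measurable => [z|t].
  apply: continuous_measurable_fun => x.
  apply: (@continuous_comp _ _ _ (fun x => (x, z)) f); last exact: cf.
  by apply: continuous_pair; [exact: cvg_id|exact: cvg_cst].
move=> z; apply: (@continuous_comp _ _ _ (fun x => (t, x)) f); last exact: cf.
by apply: continuous_pair; [exact: cvg_cst|exact: cvg_id].
Qed.

Lemma continuous_measurable3 (f : heis R -> R) : continuous f -> measurable_fun setT f.
Proof.
move=> cf; apply: caratheodory_measurable => [z|t].
  apply: continuous_measurable2 => x.
  apply: (@continuous_comp _ _ _ (fun x => (x, z)) f); last exact: cf.
  by apply: continuous_pair; [exact: cvg_id|exact: cvg_cst].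
move=> z; apply: (@continuous_comp _ _ _ (fun x => (t, x)) f); last exact: cf.
by apply: continuous_pair; [exact: cvg_cst|exact: cvg_id].
Qed.

Local Notation leb := (@lebesgue_measure R).

Lemma integral_sint a b (g : R -> R) : cont_seg a b g ->
  (\int[leb]_(x in `[a, b]) (g x)%:E = (sint a b g)%:E)%E.
Proof.
move=> cg; rewrite /sint /Rintegral fineK//.
exact/integrable_fin_num/cont_seg_int.
Qed.

Lemma integralT_sint a b (g : R -> R) : cont_seg a b g ->
  (forall x, x \notin `[a, b] -> g x = 0) ->
  (\int[leb]_x (g x)%:E = (sint a b g)%:E)%E.
Proof.
move=> cg g0; rewrite -integral_sint// [RHS]integral_mkcond.
apply: eq_integral => x _; rewrite patchE; case: ifPn => // xab.
by rewrite g0//; apply: contra xab => h; rewrite inE.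
Qed.

Lemma continuous_sint (V : normedModType R) (F : V -> R -> R) a b : a <= b ->
  continuous (fun p : V * R => F p.1 p.2) -> continuous (fun q => sint a b (F q)).
Proof.
move=> ab cF q.
by apply: (@sint_param_continuous R V setT a b F q) => //; [exact: openT|move=> ? ? _ _; exact: cF].
Qed.

Lemma swap_ge0 (F : R -> R -> R) a b c d : a <= b -> c <= d ->
  continuous (fun p : R * R => F p.1 p.2) -> (forall x y, 0 <= F x y) ->
  sint a b (fun x => sint c d (F x)) = sint c d (fun y => sint a b (F ^~ y)).
Proof.
move=> ab cd cF F0.
have cF' : continuous (fun p : R * R => F p.2 p.1).
  move=> p; apply: (@continuous_comp _ _ _ (fun p : R * R => (p.2, p.1)) (fun p : R * R => F p.1 p.2)).
    by apply: continuous_pair; [exact: cvg_snd|exact: cvg_fst].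
  exact: cF.
have c1 x : continuous (F x).
  move=> y; apply: (@continuous_comp _ _ _ (fun y => (x, y)) (fun p : R * R => F p.1 p.2)).
    by apply: continuous_pair; [exact: cvg_cst|exact: cvg_id].
  exact: cF.
have c2 y : continuous (F ^~ y).
  move=> x; apply: (@continuous_comp _ _ _ (fun x => (x, y)) (fun p : R * R => F p.1 p.2)).
    by apply: continuous_pair; [exact: cvg_id|exact: cvg_cst].
  exact: cF.
have cs1 := continuous_sint cd cF. have cs2 := @continuous_sint _ (fun y => F ^~ y) _ _ ab cF'.
(* Restriction to the rectangle by zero extension lets Tonelli be applied on the whole plane. *)
pose G : R * R -> \bar R := (fun p : R * R => (F p.1 p.2)%:E) \_ (`[a, b]%classic `*` `[c, d]%classic).
have mG : measurable_fun [set: (measurableTypeR R * measurableTypeR R)%type] G.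
  apply/(measurable_restrict _ _ _); rewrite ?setTI//; first by apply: measurableX; exact: measurable_itv.
  apply/measurable_EFinP; apply: measurable_funTS.
  exact: (continuous_measurable2 cF).
have G0 p : (0 <= G p)%E by rewrite /G patchE; case: ifP => // _; rewrite lee_fin.
have GE x y : G (x, y) = if (x \in `[a, b]) && (y \in `[c, d]) then (F x y)%:E else 0%E.
  rewrite /G patchE /= [in LHS](_ : ((x, y) \in _) = (x \in `[a, b]) && (y \in `[c, d]))//.
  apply/idP/idP => [|/andP[h1 h2]]; last by rewrite inE.
  by rewrite inE => -[/= h1 h2]; rewrite h1 h2.
have := @fubini_tonelli _ _ _ _ R leb leb G mG G0.
have E1 x : (\int[leb]_y G (x, y) = ((fun x => (sint c d (F x))%:E) \_ `[a, b]) x)%E.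
  rewrite patchE; case: ifPn => [|] xab.
    rewrite -integral_sint; last by move=> ? _; exact: c1.
    rewrite [RHS]integral_mkcond; apply: eq_integral => y _.
    by rewrite GE patchE mem_setE; move: xab; rewrite mem_setE => ->.
  rewrite integral0_eq// => y _; rewrite GE; move: xab; rewrite mem_setE.
  by move=> /negPf ->.
have E2 y : (\int[leb]_x G (x, y) = ((fun y => (sint a b (F ^~ y))%:E) \_ `[c, d]) y)%E.
  rewrite patchE; case: ifPn => [|] ycd.
    rewrite -integral_sint; last by move=> ? _; exact: c2.
    rewrite [RHS]integral_mkcond; apply: eq_integral => x _.
    by rewrite GE patchE mem_setE; move: ycd; rewrite mem_setE => ->; rewrite andbT.
  rewrite integral0_eq// => x _; rewrite GE; move: ycd; rewrite mem_setE.
  by move=> /negPf ->; rewrite andbF.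
under eq_integral do rewrite E1.
under [in RHS]eq_integral do rewrite E2.
rewrite -!integral_mkcond !integral_sint; last 2 first.
- by move=> ? _; exact: cs2.
- by move=> ? _; exact: cs1.
by move=> [].
Qed.

Lemma sint_swap (F : R -> R -> R) a b c d : a <= b -> c <= d ->
  continuous (fun p : R * R => F p.1 p.2) ->
  sint a b (fun x => sint c d (F x)) = sint c d (fun y => sint a b (F ^~ y)).
Proof.
move=> ab cd cF.
have cF' : continuous (fun p : R * R => F p.2 p.1).
  move=> p; apply: (@continuous_comp _ _ _ (fun p : R * R => (p.2, p.1)) (fun p : R * R => F p.1 p.2)).
    by apply: continuous_pair; [exact: cvg_snd|exact: cvg_fst].
  exact: cF.
have sec (G : R -> R -> R) x : continuous (fun p : R * R => G p.1 p.2) -> continuous (G x).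
  move=> cG y; apply: (@continuous_comp _ _ _ (fun y => (x, y)) (fun p : R * R => G p.1 p.2)).
    by apply: continuous_pair; [exact: cvg_cst|exact: cvg_id].
  exact: cG.
(* [F] is the difference of these two functions, both continuous and nonnegative, so that the
   nonnegative case covers signed integrands. *)
pose A x y := `|F x y|. pose B x y := `|F x y| - F x y.
have cA : continuous (fun p : R * R => A p.1 p.2) by move=> p; apply: cvg_norm; exact: cF.
have cB : continuous (fun p : R * R => B p.1 p.2) by move=> p; apply: cvgB; [exact: cA|exact: cF].
have cA' : continuous (fun p : R * R => A p.2 p.1) by move=> p; apply: cvg_norm; exact: cF'.
have cB' : continuous (fun p : R * R => B p.2 p.1) by move=> p; apply: cvgB; [exact: cA'|exact: cF'].
have E x y : F x y = A x y - B x y by rewrite /A /B opprB addrC subrK.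
have -> : sint a b (fun x => sint c d (F x)) =
  sint a b (fun x => sint c d (A x)) - sint a b (fun x => sint c d (B x)).
  rewrite -sintB; try by move=> x _; apply: continuous_sint.
  apply: eq_sint => x _; rewrite -sintB; last 2 first.
  - by move=> y _; apply: (sec A).
  - by move=> y _; apply: (sec B).
  by apply: eq_sint => y _.
have -> : sint c d (fun y => sint a b (F ^~ y)) =
  sint c d (fun y => sint a b (A ^~ y)) - sint c d (fun y => sint a b (B ^~ y)).
  rewrite -sintB; [|by move=> x _; apply: (@continuous_sint _ (fun y => A ^~ y))|by move=> x _; apply: (@continuous_sint _ (fun y => B ^~ y))].
  apply: eq_sint => y _; rewrite -sintB; last 2 first.
  - by move=> x _; apply: (sec (fun y => A ^~ y)).
  - by move=> x _; apply: (sec (fun y => B ^~ y)).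
  by apply: eq_sint => x _.
have A0 x y : 0 <= A x y by exact: normr_ge0.
have B0 x y : 0 <= B x y by rewrite /B subr_ge0 ler_norm.
by rewrite (swap_ge0 ab cd cA A0) (swap_ge0 ab cd cB B0).
Qed.

End Measurability.

Lemma continuous_fst_comp (T U V : topologicalType) (f : T -> U * V) :
  continuous f -> continuous (fun x => (f x).1).
Proof.
move=> cf x; apply: (@continuous_comp _ _ _ f fst); first exact: cf.
exact: cvg_fst.
Qed.

Lemma continuous_snd_comp (T U V : topologicalType) (f : T -> U * V) :
  continuous f -> continuous (fun x => (f x).2).
Proof.
move=> cf x; apply: (@continuous_comp _ _ _ f snd); first exact: cf.
exact: cvg_snd.
Qed.

Lemma continuous_pair_comp (T U V : topologicalType) (f : T -> U) (g : T -> V) :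
  continuous f -> continuous g -> continuous (fun x => (f x, g x)).
Proof. by move=> cf cg x; apply: continuous_pair; [exact: cf|exact: cg]. Qed.

Lemma continuous_compT (T U V : topologicalType) (f : T -> U) (g : U -> V) :
  continuous f -> continuous g -> continuous (fun x => g (f x)).
Proof. by move=> cf cg x; apply: (@continuous_comp _ _ _ f g); [exact: cf|exact: cg]. Qed.

Lemma continuous_idT (T : topologicalType) : continuous (fun x : T => x).
Proof. by move=> x; exact: cvg_id. Qed.

Lemma continuous_cstT (T U : topologicalType) (k : U) : continuous (fun x : T => k).
Proof. by move=> x; exact: cvg_cst. Qed.

Ltac cont := repeat first
  [ apply: continuous_idT | apply: continuous_pair_comp
  | apply: continuous_fst_comp | apply: continuous_snd_comp | apply: continuous_cstT ].

Lemma sint_FTC0 (R : realType) (a b : R) (f F : R -> R) : a <= b -> continuous f ->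
  F a = 0 -> F b = 0 -> (forall t, is_derive t (1 : R) F (f t)) -> sint a b f = 0.
Proof.
move=> ab cf Fa Fb d; rewrite -[RHS]subr0 -{1}Fb -Fa.
by apply: (@sint_FTC R a b f F ab) => t _; exact: cf.
Qed.

(** * Iterated integrals over a box *)

Section BoxIntegral.
Variable R : realType.
Local Notation heis := (heis R).
Variable M : R.
Hypothesis M0 : 0 <= M.
Implicit Types (f g : heis -> R).

(** An iterated integral instead of one against a product measure: for continuous integrands
    linearity, differentiation under the integral and integration by parts are then one-variable
    facts. [integral_heis] links it to [heis_mu]. *)
Definition I3 f : R :=
  sint (- M) M (fun x => sint (- M) M (fun y => sint (- M) M (fun z => f (x, y, z)))).

Let MM : - M <= M. Proof. by rewrite ge0_cp. Qed.

Section Param.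
Variable V : normedModType R.
Implicit Types F : V -> heis -> R.

Let J1 F (q : V * R * R) : R := sint (- M) M (fun z => F q.1.1 (q.1.2, q.2, z)).
Let J2 F (q : V * R) : R := sint (- M) M (fun y => J1 F (q, y)).

Let cJ0 F : continuous (fun p : V * heis => F p.1 p.2) ->
  continuous (fun p : V * R * R * R => F p.1.1.1 (p.1.1.2, p.1.2, p.2)).
Proof.
move=> cF; apply: (@continuous_compT _ _ _ (fun p : V * R * R * R =>
  (p.1.1.1, (p.1.1.2, p.1.2, p.2))) _ _ cF).
by cont.
Qed.

Let cJ1 F : continuous (fun p : V * heis => F p.1 p.2) -> continuous (J1 F).
Proof. by move=> cF; apply: continuous_sint => //; exact: cJ0. Qed.

Let cJ1' F : continuous (fun p : V * heis => F p.1 p.2) ->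
  continuous (fun p : V * R * R => J1 F (p.1, p.2)).
Proof.
by move=> cF; apply: continuous_compT (cJ1 cF); cont.
Qed.

Let cJ2 F : continuous (fun p : V * heis => F p.1 p.2) -> continuous (J2 F).
Proof. by move=> cF; apply: continuous_sint => //; exact: cJ1'. Qed.

Let cJ2' F : continuous (fun p : V * heis => F p.1 p.2) ->
  continuous (fun p : V * R => J2 F (p.1, p.2)).
Proof. by move=> cF; apply: continuous_compT (cJ2 cF); cont. Qed.

Lemma continuous_I3 F : continuous (fun p : V * heis => F p.1 p.2) ->
  continuous (fun q => I3 (F q)).
Proof.
move=> cF; apply: (@continuous_sint R V (fun q x => J2 F (q, x))) => //.
exact: cJ2'.
Qed.

Lemma is_derive_I3 F dF q v : continuous (fun p : V * heis => F p.1 p.2) ->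
  continuous (fun p : V * heis => dF p.1 p.2) ->
  (forall p h, is_derive p v (F ^~ h) (dF p h)) ->
  is_derive q v (fun q => I3 (F q)) (I3 (dF q)).
Proof.
move=> cF cdF d.
have D1 (x y : R) p : is_derive p v (fun p => J1 F (p, x, y)) (J1 dF (p, x, y)).
  apply: (@sint_param_derive R V setT (- M) M (fun p z => F p (x, y, z)) (fun p z => dF p (x, y, z))) => //.
  - exact: openT.
  - by move=> ? ? _ _; apply: (@continuous_compT _ _ _ (fun p : V * R => (p.1, (x, y, p.2))) _ _ cF); cont.
  - by move=> ? ? _ _; apply: (@continuous_compT _ _ _ (fun p : V * R => (p.1, (x, y, p.2))) _ _ cdF); cont.
have D2 (x : R) p : is_derive p v (fun p => J2 F (p, x)) (J2 dF (p, x)).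
  apply: (@sint_param_derive R V setT (- M) M (fun p y => J1 F (p, x, y)) (fun p y => J1 dF (p, x, y))) => //.
  - exact: openT.
  - by move=> ? ? _ _; apply: (@continuous_compT _ _ _ (fun p : V * R => (p.1, x, p.2)) _ _ (cJ1 cF)); cont.
  - by move=> ? ? _ _; apply: (@continuous_compT _ _ _ (fun p : V * R => (p.1, x, p.2)) _ _ (cJ1 cdF)); cont.
apply: (@sint_param_derive R V setT (- M) M (fun p x => J2 F (p, x)) (fun p x => J2 dF (p, x))) => //.
- exact: openT.
- by move=> ? ? _ _; exact: cJ2'.
- by move=> ? ? _ _; exact: cJ2'.
Qed.

End Param.

Let sec3 f (x y : R) : continuous f -> continuous (fun z => f (x, y, z)).
Proof. by move=> cf; apply: (@continuous_compT _ _ _ (fun z : R => (x, y, z)) f) => //; cont. Qed.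

Let sec2 f (x : R) : continuous f -> continuous (fun y => sint (- M) M (fun z => f (x, y, z))).
Proof.
move=> cf; apply: (@continuous_sint R R (fun y z => f (x, y, z))) => //.
by apply: (@continuous_compT _ _ _ (fun p : R * R => (x, p.1, p.2)) f) => //; cont.
Qed.

Let sec1 f : continuous f ->
  continuous (fun x => sint (- M) M (fun y => sint (- M) M (fun z => f (x, y, z)))).
Proof.
move=> cf; apply: (@continuous_sint R R (fun x y => sint (- M) M (fun z => f (x, y, z)))) => //.
apply: (@continuous_sint R (R * R)%type (fun p z => f (p.1, p.2, z))) => //.
by apply: (@continuous_compT _ _ _ (fun p : R * R * R => (p.1.1, p.1.2, p.2)) f) => //; cont.
Qed.

Lemma I3D f g : continuous f -> continuous g ->
  I3 (fun q => f q + g q) = I3 f + I3 g.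
Proof.
move=> cf cg; rewrite /I3 -sintD; try by move=> ? _; exact: sec1.
apply: eq_sint => x _; rewrite -sintD; try by move=> ? _; exact: sec2.
by apply: eq_sint => y _; rewrite -sintD//; move=> ? _; exact: sec3.
Qed.

Lemma I3Z k f : continuous f -> I3 (fun q => k * f q) = k * I3 f.
Proof.
move=> cf; rewrite /I3 -sintZ; last by move=> ? _; exact: sec1.
apply: eq_sint => x _; rewrite -sintZ; last by move=> ? _; exact: sec2.
by apply: eq_sint => y _; rewrite -sintZ//; move=> ? _; exact: sec3.
Qed.

Lemma I3B f g : continuous f -> continuous g ->
  I3 (fun q => f q - g q) = I3 f - I3 g.
Proof.
move=> cf cg; rewrite /I3 -sintB; try by move=> ? _; exact: sec1.
apply: eq_sint => x _; rewrite -sintB; try by move=> ? _; exact: sec2.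
by apply: eq_sint => y _; rewrite -sintB//; move=> ? _; exact: sec3.
Qed.

Lemma eq_I3 f g : f =1 g -> I3 f = I3 g.
Proof. by move=> /funext ->. Qed.

Lemma I3_ge0 f : continuous f -> (forall q, 0 <= f q) -> 0 <= I3 f.
Proof.
by move=> cf f0; apply: Rintegral_ge0 => x _; apply: Rintegral_ge0 => y _; exact: Rintegral_ge0.
Qed.

Lemma sint_I3 (F : R -> heis -> R) a b : a <= b ->
  continuous (fun p : R * heis => F p.1 p.2) ->
  sint a b (fun t => I3 (F t)) = I3 (fun q => sint a b (fun t => F t q)).
Proof.
move=> ab cF; rewrite /I3.
have C1 : continuous (fun p : R * R =>
    sint (- M) M (fun y => sint (- M) M (fun z => F p.1 (p.2, y, z)))).
  apply: (@continuous_sint R (R * R)%type (fun p y => sint (- M) M (fun z => F p.1 (p.2, y, z)))) => //.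
  apply: (@continuous_sint R (R * R * R)%type (fun p z => F p.1.1 (p.1.2, p.2, z))) => //.
  by apply: (@continuous_compT _ _ _ (fun p : R * R * R * R => (p.1.1.1, (p.1.1.2, p.1.2, p.2))) _ _ cF); cont.
have C2 x : continuous (fun p : R * R => sint (- M) M (fun z => F p.1 (x, p.2, z))).
  apply: (@continuous_sint R (R * R)%type (fun p z => F p.1 (x, p.2, z))) => //.
  by apply: (@continuous_compT _ _ _ (fun p : R * R * R => (p.1.1, (x, p.1.2, p.2))) _ _ cF); cont.
have C3 x y : continuous (fun p : R * R => F p.1 (x, y, p.2)).
  by apply: (@continuous_compT _ _ _ (fun p : R * R => (p.1, (x, y, p.2))) _ _ cF); cont.
transitivity (sint (- M) M (fun x => sint a b (fun t =>
    sint (- M) M (fun y => sint (- M) M (fun z => F t (x, y, z)))))).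
  exact: (sint_swap ab MM C1).
apply: eq_sint => x _.
transitivity (sint (- M) M (fun y => sint a b (fun t => sint (- M) M (fun z => F t (x, y, z))))).
  exact: (sint_swap ab MM (C2 x)).
apply: eq_sint => y _.
exact: (sint_swap ab MM (C3 x y)).
Qed.

(** The inequalities are not strict: vanishing on the faces removes the boundary terms of
    integrations by parts. *)
Definition box_supp f := forall q, M <= `|cx q| \/ M <= `|cy q| \/ M <= `|cz q| -> f q = 0.

Let bnd : M <= `|- M| /\ M <= `|M|.
Proof. by rewrite normrN ger0_norm. Qed.

(** The fundamental theorem applies directly because z is the innermost variable; for y and x the
    derivative is first pulled out of the inner integrals. *)
Lemma I3_dz f df : continuous df -> box_supp f ->
  (forall q, is_derive q (e_z R) f (df q)) -> I3 df = 0.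
Proof.
move=> cdf f0 d; rewrite /I3.
have z0 : sint (- M) M (fun=> 0) = 0 by rewrite sint_cst// mul0r.
rewrite -[RHS]z0; apply: eq_sint => x _; rewrite -[RHS]z0; apply: eq_sint => y _.
apply: (@sint_FTC0 R _ _ _ (fun z => f (x, y, z)) MM).
- exact: sec3.
- by apply: f0; right; right; case: bnd.
- by apply: f0; right; right; case: bnd.
move=> z.
have := @is_derive_line R _ f (x, y, 0) (e_z R) z (df (x, y, z)).
have E (s : R) : s *: e_z R + (x, y, 0) = (x, y, s).
  by congr (_, _, _); rewrite /= /GRing.scale /= ?mulr0 ?mulr1 ?add0r ?addr0.
by under eq_fun do rewrite E; rewrite E; exact.
Qed.

Lemma I3_dy f df : continuous f -> continuous df -> box_supp f ->
  (forall q, is_derive q (e_y R) f (df q)) -> I3 df = 0.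
Proof.
move=> cf cdf f0 d; rewrite /I3.
have z0 : sint (- M) M (fun=> 0) = 0 by rewrite sint_cst// mul0r.
rewrite -[RHS]z0; apply: eq_sint => x _.
apply: (@sint_FTC0 R _ _ _ (fun y => sint (- M) M (fun z => f (x, y, z))) MM).
- exact: sec2.
- by rewrite -[RHS]z0; apply: eq_sint => z _; apply: f0; right; left; case: bnd.
- by rewrite -[RHS]z0; apply: eq_sint => z _; apply: f0; right; left; case: bnd.
move=> y.
apply: (@sint_param_derive R R setT (- M) M (fun y z => f (x, y, z)) (fun y z => df (x, y, z))) => //.
- exact: openT.
- by move=> ? ? _ _; apply: (@continuous_compT _ _ _ (fun p : R * R => (x, p.1, p.2)) f) => //; cont.
- by move=> ? ? _ _; apply: (@continuous_compT _ _ _ (fun p : R * R => (x, p.1, p.2)) df) => //; cont.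
move=> s z _ _.
have := @is_derive_line R _ f (x, 0, z) (e_y R) s (df (x, s, z)).
have E (r : R) : r *: e_y R + (x, 0, z) = (x, r, z).
  by congr (_, _, _); rewrite /= /GRing.scale /= ?mulr0 ?mulr1 ?add0r ?addr0.
by under eq_fun do rewrite E; rewrite E; exact.
Qed.

Lemma I3_dx f df : continuous f -> continuous df -> box_supp f ->
  (forall q, is_derive q (e_x R) f (df q)) -> I3 df = 0.
Proof.
move=> cf cdf f0 d; rewrite /I3.
have z0 : sint (- M) M (fun=> 0) = 0 by rewrite sint_cst// mul0r.
have zz x : M <= `|x| -> sint (- M) M (fun y => sint (- M) M (fun z => f (x, y, z))) = 0.
  move=> hx; rewrite -[RHS]z0; apply: eq_sint => y _; rewrite -[RHS]z0; apply: eq_sint => z _.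
  by apply: f0; left.
apply: (@sint_FTC0 R _ _ _ (fun x => sint (- M) M (fun y => sint (- M) M (fun z => f (x, y, z)))) MM).
- exact: sec1.
- by apply: zz; case: bnd.
- by apply: zz; case: bnd.
move=> x.
have D (y : R) s : is_derive s (1 : R) (fun s => sint (- M) M (fun z => f (s, y, z))) (sint (- M) M (fun z => df (s, y, z))).
  apply: (@sint_param_derive R R setT (- M) M (fun s z => f (s, y, z)) (fun s z => df (s, y, z))) => //.
  - exact: openT.
  - by move=> ? ? _ _; apply: (@continuous_compT _ _ _ (fun p : R * R => (p.1, y, p.2)) f) => //; cont.
  - by move=> ? ? _ _; apply: (@continuous_compT _ _ _ (fun p : R * R => (p.1, y, p.2)) df) => //; cont.
  move=> r z _ _.
  have := @is_derive_line R _ f (0, y, z) (e_x R) r (df (r, y, z)).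
  have E (w : R) : w *: e_x R + (0, y, z) = (w, y, z).
    by congr (_, _, _); rewrite /= /GRing.scale /= ?mulr0 ?mulr1 ?add0r ?addr0.
  by under eq_fun do rewrite E; rewrite E; exact.
have C g : continuous g -> continuous (fun p : R * R => sint (- M) M (fun z => g (p.1, p.2, z))).
  move=> cg; apply: (@continuous_sint R (R * R)%type (fun p z => g (p.1, p.2, z))) => //.
  by apply: (@continuous_compT _ _ _ (fun p : R * R * R => (p.1.1, p.1.2, p.2)) g) => //; cont.
apply: (@sint_param_derive R R setT (- M) M (fun x y => sint (- M) M (fun z => f (x, y, z)))
  (fun x y => sint (- M) M (fun z => df (x, y, z)))) => //.
- exact: openT.
- by move=> p y _ _; exact: (C f cf (p, y)).
- by move=> p y _ _; exact: (C df cdf (p, y)).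
Qed.

End BoxIntegral.

(** * Tonelli for the measure [heis_mu] *)

Section HeisMeasure.
Variable R : realType.
Local Notation leb := (@lebesgue_measure R).
Local Notation RR := (measurableTypeR R).

(** A name for the planar measure, to which the measure structure and its sigma-finiteness are
    attached so that Tonelli applies to the triple product. *)
Definition leb2 : set (RR * RR) -> \bar R := (leb \x leb)%E.

HB.instance Definition _ := Measure.copy leb2
  ((leb \x leb)%E : {measure set (RR * RR)%type -> \bar R}).

Lemma leb2_sigma_finite : sigma_finite setT leb2.
Proof.
pose I (n : nat) : set RR := `[- n%:R, n%:R]%classic.
exists (fun n => I n `*` I n).
  apply/esym/seteqP; split=> // -[x y] _ /=.
  pose b := Num.max `|x| `|y|.
  exists (Num.bound b) => //; have hb := archi_boundP (_ : 0 <= b).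
  have {hb} h : b < (Num.bound b)%:R by apply: hb; rewrite le_max normr_ge0.
  move: h; rewrite /b gt_max => /andP[hx hy].
  by split; rewrite /I /= in_itv /= -ler_norml ltW.
move=> n; split; first by apply: measurableX; exact: measurable_itv.
rewrite /leb2 product_measure1E; [|exact: measurable_itv|exact: measurable_itv].
have h : (leb (I n) < +oo)%E by rewrite lebesgue_measure_itv /=; case: ifP; rewrite ltry.
by rewrite lte_mul_pinfty// ge0_fin_numE.
Qed.

HB.instance Definition _ := Measure_isSigmaFinite.Build _ _ _ leb2 leb2_sigma_finite.

Lemma integral_heis_mu2 (f : RR * RR * RR -> \bar R) :
  measurable_fun setT f -> (forall q, (0 <= f q)%E) ->
  (\int[@heis_mu R]_q f q = \int[leb2]_p \int[leb]_z f (p, z))%E.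
Proof. by move=> mf f0; exact: (@fubini_tonelli1 _ _ (RR * RR)%type RR R leb2 leb f mf f0). Qed.

Lemma integral_leb2 (f : RR * RR -> \bar R) :
  measurable_fun setT f -> (forall q, (0 <= f q)%E) ->
  (\int[leb2]_q f q = \int[leb]_x \int[leb]_y f (x, y))%E.
Proof. by move=> mf f0; exact: (@fubini_tonelli1 _ _ RR RR R leb leb f mf f0). Qed.

Lemma measurable_fun_iint (f : RR * RR * RR -> \bar R) :
  measurable_fun setT f -> (forall q, (0 <= f q)%E) ->
  measurable_fun setT (fun p => \int[leb]_z f (p, z))%E.
Proof.
by move=> mf f0; exact: (@measurable_fun_fubini_tonelli_F _ _ (RR * RR)%type RR R leb f mf f0).
Qed.

Lemma integral_heis_mu3 (f : RR * RR * RR -> \bar R) :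
  measurable_fun setT f -> (forall q, (0 <= f q)%E) ->
  (\int[@heis_mu R]_q f q = \int[leb]_x \int[leb]_y \int[leb]_z f (x, y, z))%E.
Proof.
move=> mf f0; rewrite integral_heis_mu2// integral_leb2//.
  exact: measurable_fun_iint.
by move=> p; apply: integral_ge0 => z _; exact: f0.
Qed.

Lemma integral_heis M (f : heis R -> R) : 0 <= M -> continuous f -> (forall q, 0 <= f q) ->
  box_supp M f -> (\int[@heis_mu R]_q (f q)%:E = (I3 M f)%:E)%E.
Proof.
move=> M0 cf f_ge0 f0.
have MM : - M <= M by rewrite ge0_cp.
have out (x : R) : x \notin `[- M, M] -> M <= `|x|.
  by rewrite in_itv /= -ler_norml -ltNge => /ltW.
have z0 : sint (- M) M (fun=> 0 : R) = 0 by rewrite sint_cst// mul0r.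
transitivity (\int[leb]_x \int[leb]_y \int[leb]_z (f (x, y, z))%:E)%E.
  apply: (@integral_heis_mu3 (fun q => (f q)%:E)); last by move=> q; rewrite lee_fin.
  by apply/measurable_EFinP; exact: continuous_measurable3.
rewrite /I3 -integralT_sint; last 2 first.
- move=> x _; apply: (@continuous_sint R R (fun x y => sint (- M) M (fun z => f (x, y, z)))) => //.
  apply: (@continuous_sint R (R * R)%type (fun p z => f (p.1, p.2, z))) => //.
  by apply: (@continuous_compT _ _ _ (fun p : R * R * R => (p.1.1, p.1.2, p.2)) f) => //; cont.
- move=> x /out h; rewrite -[RHS]z0; apply: eq_sint => y _; rewrite -[RHS]z0.
  by apply: eq_sint => z _; apply: f0; left.
apply: eq_integral => x _; rewrite -integralT_sint; last 2 first.
- move=> y _; apply: (@continuous_sint R R (fun y z => f (x, y, z))) => //.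
  by apply: (@continuous_compT _ _ _ (fun p : R * R => (x, p.1, p.2)) f) => //; cont.
- move=> y /out h; rewrite -[RHS]z0; apply: eq_sint => z _.
  by apply: f0; right; left.
apply: eq_integral => y _; rewrite -integralT_sint//.
- by move=> z _; apply: (@continuous_compT _ _ _ (fun z : R => (x, y, z)) f) => //; cont.
- by move=> z /out h; apply: f0; right; right.
Qed.

End HeisMeasure.

(** * Directional derivatives of smooth functions on the whole space *)

Section TestFunctions.
Variable R : realType.
Local Notation heis := (heis R).
Local Notation U := (@heis_off_axis R).
Local Notation ex := (e_x R).
Local Notation ey := (e_y R).
Local Notation ez := (e_z R).
Implicit Types (f g h : heis -> R) (q v w : heis).

Lemma smoothT_derivable f q v : smooth setT f -> is_derive q v f ('D_v f q).
Proof.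
move=> sf; have := is_diff_derive v (smooth_is_diff openT sf (I : setT q)).
by move=> d; apply: derivableP; case: d.
Qed.

Lemma smoothT_deriveE f q v : smooth setT f ->
  'D_v f q = cx v * 'D_ex f q + cy v * 'D_ey f q + cz v * 'D_ez f q.
Proof.
by move=> sf; have [_ ->] := is_diff_derive v (smooth_is_diff openT sf (I : setT q)).
Qed.

Lemma smoothT_continuous f : smooth setT f -> continuous f.
Proof. by move=> sf q; exact: (smooth_continuous sf). Qed.

Lemma deriveM_smooth f g q v : smooth setT f -> smooth setT g ->
  'D_v (fun q => f q * g q) q = f q * 'D_v g q + g q * 'D_v f q.
Proof.
move=> sf sg.
by have [_ ->] := is_deriveM (smoothT_derivable q v sf) (smoothT_derivable q v sg).
Qed.

Lemma deriveD_smooth f g q v : smooth setT f -> smooth setT g ->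
  'D_v (fun q => f q + g q) q = 'D_v f q + 'D_v g q.
Proof.
move=> sf sg.
by have [_ ->] := is_deriveD (smoothT_derivable q v sf) (smoothT_derivable q v sg).
Qed.

(* The x-derivative of f(q + h v) - f(q) is h times the mean over [0, 1] of
   the x-derivative of D_v f, so D_v commutes with D_x. *)
Lemma derive_comm f v w q : smooth setT f -> smooth setT ('D_v f) -> smooth setT ('D_w f) ->
  smooth setT ('D_w ('D_v f)) -> 'D_v ('D_w f) q = 'D_w ('D_v f) q.
Proof.
move=> sf sv sw swv.
pose G (h : R) := sint 0 1 (fun t => 'D_w ('D_v f) ((t * h) *: v + q)).
have cline (g : heis -> R) : continuous g -> continuous (fun p : heis * R * R => g ((p.2 * p.1.2) *: v + p.1.1)).
  move=> cg; apply: continuous_compT cg => p.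
  apply: cvgD.
    apply: (@cvgZ _ _ _ _ _ (fun p : heis * R * R => p.2 * p.1.2) (fun=> v)); last exact: cvg_cst.
    apply: cvgM; first exact: cvg_snd.
    by apply: (@continuous_compT _ _ _ (fun p : heis * R * R => p.1) snd); [move=> ?; exact: cvg_fst|move=> ?; exact: cvg_snd].
  by apply: (@continuous_compT _ _ _ (fun p : heis * R * R => p.1) fst); [move=> ?; exact: cvg_fst|move=> ?; exact: cvg_fst].
have cl2 (g : heis -> R) (h : R) : continuous g -> continuous (fun p : heis * R => g ((p.2 * h) *: v + p.1)).
  move=> cg; apply: (@continuous_compT _ _ _ (fun p : heis * R => (p.1, h, p.2)) _ _ (cline g cg)).
  by cont.
have E (h : R) p : f (h *: v + p) - f p = sint 0 1 (fun t => h * 'D_v f ((t * h) *: v + p)).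
  have c1 : continuous (fun t : R => h * 'D_v f ((t * h) *: v + p)).
    move=> t; apply: cvgM; first exact: cvg_cst.
    by apply: (@continuous_compT _ _ _ (fun t : R => (p, t)) _ _ (cl2 _ h (smoothT_continuous sv))); cont.
  have d t : is_derive t (1 : R) (fun t : R => f ((t * h) *: v + p)) (h * 'D_v f ((t * h) *: v + p)).
    have d1 : is_derive (t * h) (1 : R) (fun r : R => f (r *: v + p)) ('D_v f ((t * h) *: v + p)).
      by apply: is_derive_line; exact: smoothT_derivable.
    have d2 : is_derive t (1 : R) (fun t : R => t * h) h.
      apply: is_derive_eq (is_deriveM (is_derive_id t (1 : R)) (is_derive_cst h t (1 : R))) _.
      by rewrite /GRing.scale /= mulr0 add0r mulr1.
    rewrite mulrC.
    exact: (@is_derive1_comp R (fun r : R => f (r *: v + p)) (fun t : R => t * h) t _ _ d1 d2).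
  have := @sint_FTC R 0 1 _ _ ler01 (fun t _ => c1 t) (fun t _ => d t).
  by rewrite mul1r mul0r scale0r add0r => ->.
have key (h : R) : 'D_w f (h *: v + q) - 'D_w f q = h * G h.
  have dL : is_derive q w (fun p => f (h *: v + p) - f p) ('D_w f (h *: v + q) - 'D_w f q).
    apply: is_deriveB; last exact: smoothT_derivable.
    apply: (@is_derive_affine R (fun p => h *: v + p) f q w w); last exact: smoothT_derivable.
    by move=> a; rewrite addrCA.
  have dR : is_derive q w (fun p => f (h *: v + p) - f p)
      (sint 0 1 (fun t => h * 'D_w ('D_v f) ((t * h) *: v + q))).
    rewrite (_ : (fun p => _) = (fun p => sint 0 1 (fun t => h * 'D_v f ((t * h) *: v + p)))); last first.
      by apply/funext => p; exact: E.
    apply: (@sint_param_derive R _ setT 0 1 (fun p t => h * 'D_v f ((t * h) *: v + p))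
      (fun p t => h * 'D_w ('D_v f) ((t * h) *: v + p)) q w openT ler01).
    - move=> p t _ _; apply: cvgM; first exact: cvg_cst.
      exact: (cl2 _ h (smoothT_continuous sv)).
    - move=> p t _ _; apply: cvgM; first exact: cvg_cst.
      exact: (cl2 _ h (smoothT_continuous swv)).
    - move=> p t _ _.
      apply: is_derive_eq (is_deriveM (is_derive_cst h p w) (@is_derive_affine R (fun p => (t * h) *: v + p) ('D_v f) p w w _ _ (smoothT_derivable _ _ sv))) _.
        by move=> a; rewrite addrCA.
      by rewrite /GRing.scale /= mulr0 addr0.
    - by [].
  have -> : 'D_w f (h *: v + q) - 'D_w f q = sint 0 1 (fun t => h * 'D_w ('D_v f) ((t * h) *: v + q)).
    by case: dL => _ <-; case: dR => _ <-.
  rewrite sintZ// => t _.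
  by apply: (@continuous_compT _ _ _ (fun t : R => (q, t)) _ _ (cl2 _ h (smoothT_continuous swv))); cont.
have G0 : G 0 = 'D_w ('D_v f) q.
  rewrite /G (@eq_sint _ _ _ _ (fun=> 'D_w ('D_v f) q)).
    by rewrite sint_cst ?ler01// subr0 mulr1.
  by move=> t _; rewrite mulr0 scale0r add0r.
have cG : continuous G.
  have H : continuous (fun p : R * R => 'D_w ('D_v f) ((p.2 * p.1) *: v + q)).
    by apply: (@continuous_compT _ _ _ (fun p : R * R => (q, p.1, p.2)) _ _ (cline _ (smoothT_continuous swv))); cont.
  exact: (@continuous_sint R R (fun h t : R => 'D_w ('D_v f) ((t * h) *: v + q)) 0 1 ler01 H).
have D : is_derive (0 : R) (1 : R) (fun r : R => 'D_w f (r *: v + q)) ('D_w ('D_v f) q).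
  apply/is_derive1_caratheodory; exists G; split; [move=> z|exact: cG|exact: G0].
  by rewrite scale0r add0r subr0 key mulrC.
have D' : is_derive (0 : R) (1 : R) (fun r : R => 'D_w f (r *: v + q)) ('D_v ('D_w f) q).
  have H : is_derive (0 *: v + q) v ('D_w f) ('D_v ('D_w f) q).
    by rewrite scale0r add0r; exact: smoothT_derivable.
  exact: (is_derive_line H).
have [_ e1] := D; have [_ e2] := D'.
exact: (etrans (esym e2) e1).
Qed.

End TestFunctions.

(** * Functions supported in a shell and expressions of zero integral *)

Section NullForms.
Variable R : realType.
Local Notation heis := (heis R).
Local Notation U := (@heis_off_axis R).
Local Notation ex := (e_x R).
Local Notation ey := (e_y R).
Local Notation ez := (e_z R).
Variables delta L M : R.
Hypotheses (delta0 : 0 < delta) (L0 : 0 <= L) (LM : L < M).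
Implicit Types (f g h : heis -> R) (q v w : heis).

(** Closed, bounded, invariant under rotations about the axis, and at positive distance from it.
    Multiplication by functions singular on the axis and averaging over rotations therefore both
    preserve [shell_fun]. *)
Definition shell : set heis :=
  [set q | [/\ delta <= rad2 q, rad2 q <= L ^+ 2 & `|cz q| <= L]].

Definition shell_fun f := smooth setT f /\ forall q, ~ shell q -> f q = 0.

Lemma closed_shell : closed shell.
Proof.
rewrite (_ : shell = (@rad2 R) @^-1` [set x | delta <= x] `&`
  ((@rad2 R) @^-1` [set x | x <= L ^+ 2] `&` (fun q => `|cz q|) @^-1` [set x | x <= L])); last first.
  by apply/seteqP; split=> q [] => [? ? ?|? [? ?]].
apply: closedI; [|apply: closedI].
- by apply: closed_comp => [q _|]; [exact: continuous_rad2|exact: closed_ge].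
- by apply: closed_comp => [q _|]; [exact: continuous_rad2|exact: closed_le].
- apply: closed_comp => [q _|]; last exact: closed_le.
  by apply: cvg_norm; exact: continuous_cz.
Qed.

Lemma open_shellC : open (~` shell).
Proof. exact: closed_openC closed_shell. Qed.

Lemma shell_off_axis : shell `<=` U.
Proof. by move=> q [dq _ _]; rewrite off_axisE /=; exact: lt_le_trans dq. Qed.

Lemma sf_cont f : shell_fun f -> continuous f.
Proof. by move=> [sf _]; exact: smoothT_continuous. Qed.

Lemma sf_box f : shell_fun f -> box_supp M f.
Proof.
have h1 (x y : R) : M <= `|x| -> ~ (x ^+ 2 + y ^+ 2 <= L ^+ 2).
  move=> Mx; apply/negP; rewrite -ltNge ltr_wpDr ?sqr_ge0//.
  rewrite -(real_normK (num_real x)) ltr_pXn2r// ?nnegrE//.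
  exact: lt_le_trans LM Mx.
move=> [_ f0] q hq; apply: f0 => -[_ rq zq].
case: hq => [/h1|[/h1|]].
- by move=> /(_ (cy q)).
- by move=> /(_ (cx q)); rewrite addrC.
- by rewrite leNgt (le_lt_trans zq LM).
Qed.

Lemma sfD f g : shell_fun f -> shell_fun g -> shell_fun (fun q => f q + g q).
Proof.
move=> [sf f0] [sg g0]; split; first exact: smoothD openT sf sg.
by move=> q Kq; rewrite f0// g0// addr0.
Qed.

(** Off the axis both factors are smooth, and outside the closed shell the product is zero; these
    two open sets cover the space, whatever the values of [h] on the axis. *)
Lemma sfM_off_axis h f : smooth U h -> shell_fun f -> shell_fun (fun q => h q * f q).
Proof.
move=> sh [sf f0]; split; last by move=> q /f0 ->; rewrite mulr0.
rewrite (_ : setT = U `|` ~` shell); last first.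
  apply/seteqP; split=> // q _; case: (pselect (shell q)) => [/shell_off_axis|]; by [left|right].
apply: smooth_setU.
  apply: smoothM; [exact: open_off_axis|exact: sh|].
  exact: smooth_subset sf.
apply: (@eq_smooth R _ (fun=> 0)); first exact: open_shellC.
  by move=> q /f0 ->; rewrite mulr0.
by apply: smooth_cst; exact: open_shellC.
Qed.

Lemma sfM h f : smooth setT h -> shell_fun f -> shell_fun (fun q => h q * f q).
Proof. by move=> sh; apply: sfM_off_axis; exact: smooth_subset sh. Qed.

Lemma sfZ (k : R) f : shell_fun f -> shell_fun (fun q => k * f q).
Proof. by apply: sfM; exact: smooth_cst openT. Qed.

Lemma sf_derive f i : shell_fun f -> shell_fun ('D_(frame R i) f).
Proof.
move=> [sf f0]; split; first exact: smooth_derive.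
move=> q Kq.
have : is_derive q (frame R i) f 0.
  apply: near_eq_is_derive (is_derive_cst (0 : R) _ _).
  by apply: filterS (open_nbhs_nbhs (conj open_shellC Kq)) => p /f0.
by case.
Qed.

Lemma sf_dx f : shell_fun f -> shell_fun ('D_ex f).
Proof. exact: (@sf_derive f (ord0 : 'I_3)). Qed.
Lemma sf_dy f : shell_fun f -> shell_fun ('D_ey f).
Proof. exact: (@sf_derive f (Ordinal (isT : 1 < 3)%N)). Qed.
Lemma sf_dz f : shell_fun f -> shell_fun ('D_ez f).
Proof. exact: (@sf_derive f (Ordinal (isT : 2 < 3)%N)). Qed.

Let M0 : 0 <= M. Proof. exact: le_trans L0 (ltW LM). Qed.

Lemma I3_sf_dx f : shell_fun f -> I3 M ('D_ex f) = 0.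
Proof.
move=> tf; apply: (I3_dx M0 (sf_cont tf) (sf_cont (sf_dx tf)) (sf_box tf)).
by move=> q; apply: smoothT_derivable; case: tf.
Qed.

Lemma I3_sf_dy f : shell_fun f -> I3 M ('D_ey f) = 0.
Proof.
move=> tf; apply: (I3_dy M0 (sf_cont tf) (sf_cont (sf_dy tf)) (sf_box tf)).
by move=> q; apply: smoothT_derivable; case: tf.
Qed.

Lemma I3_sf_dz f : shell_fun f -> I3 M ('D_ez f) = 0.
Proof.
move=> tf; apply: (I3_dz M0 (sf_cont (sf_dz tf)) (sf_box tf)).
by move=> q; apply: smoothT_derivable; case: tf.
Qed.

(** In polar coordinates, r d/dr; [angular] is d/dphi. *)
Definition euler f q := cx q * 'D_ex f q + cy q * 'D_ey f q.
Definition angular f q := cx q * 'D_ey f q - cy q * 'D_ex f q.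

Let sx := smooth_cx (openT : open [set: heis]).
Let sy := smooth_cy (openT : open [set: heis]).
Let sr := smooth_rad2 (openT : open [set: heis]).

Lemma sf_euler f : shell_fun f -> shell_fun (euler f).
Proof.
by move=> tf; apply: sfD; [exact: sfM sx (sf_dx tf)|exact: sfM sy (sf_dy tf)].
Qed.

Lemma sf_angular f : shell_fun f -> shell_fun (angular f).
Proof.
move=> tf; rewrite (_ : angular f = fun q => cx q * 'D_ey f q + -1 * (cy q * 'D_ex f q)); last first.
  by apply/funext => q; rewrite /angular mulN1r.
by apply: sfD; [exact: sfM sx (sf_dy tf)|apply: sfZ; exact: sfM sy (sf_dx tf)].
Qed.

Let Dcx q v : 'D_v (@cx R) q = cx v.
Proof. by have [_ ->] := is_derive_cx q v. Qed.
Let Dcy q v : 'D_v (@cy R) q = cy v.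
Proof. by have [_ ->] := is_derive_cy q v. Qed.

Lemma deriveM_val f g q v a b : smooth setT f -> smooth setT g ->
  'D_v f q = a -> 'D_v g q = b -> 'D_v (fun q => f q * g q) q = f q * b + g q * a.
Proof. by move=> sf sg <- <-; exact: deriveM_smooth. Qed.

(** The integrand is half the planar divergence of the field (x, y) f^2. *)
Lemma euler_null f : shell_fun f -> I3 M (fun q => (euler f q + f q) * f q) = 0.
Proof.
move=> tf; have [sf _] := tf.
have tff := sfM sf tf. have sff := tff.1.
have t1 := sfM sx tff. have t2 := sfM sy tff.
have -> : I3 M (fun q => (euler f q + f q) * f q) =
   I3 M (fun q => 2^-1 * ('D_ex (fun q => cx q * (f q * f q)) q + 'D_ey (fun q => cy q * (f q * f q)) q)).
  apply: eq_I3 => q; rewrite !(deriveM_smooth _ _ sx sff) !(deriveM_smooth _ _ sy sff).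
  rewrite !(deriveM_smooth _ _ sf sf) Dcx Dcy /euler.
  have -> : cx ex = 1 by []. have -> : cy ey = 1 by [].
  move: ('D_ex f q) ('D_ey f q) (f q) (cx q) (cy q) => fx fy F x y.
  by field.
have ct := sf_cont (sfD (sf_dx t1) (sf_dy t2)).
rewrite I3Z// I3D//; [|exact: sf_cont (sf_dx t1)|exact: sf_cont (sf_dy t2)].
by rewrite (I3_sf_dx t1) (I3_sf_dy t2) addr0 mulr0.
Qed.

(** For w = f + i g and T = -i r^2 d_z this is the real part of conj((E + 1) w + w) T w, the density
    of the commutator identity between E + 1 and T. *)
Definition symp_density f g q := rad2 q *
  (2 * (f q * 'D_ez g q - g q * 'D_ez f q) + euler f q * 'D_ez g q - euler g q * 'D_ez f q).

Lemma symp_null f g : shell_fun f -> shell_fun g -> I3 M (symp_density f g) = 0.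
Proof.
move=> tf tg; have [sf _] := tf; have [sg _] := tg.
have tE := sf_euler tf; have tfz := sf_dz tf.
have t1' := sfM sg tE. have t1 := sfM sr t1'.
have t2' := sfM sg tfz. have t2 := sfM sr t2'.
have t2x := sfM sx t2. have t2y := sfM sy t2.
have t3' := sfM sf tg. have t3 := sfM sr t3'.
have Drx q : 'D_ex (@rad2 R) q = 2 * cx q.
  have [_ ->] := is_deriveD (is_deriveM (is_derive_cx q ex) (is_derive_cx q ex))
    (is_deriveM (is_derive_cy q ex) (is_derive_cy q ex)).
  by rewrite /GRing.scale /= /cx /cy /=; ring.
have Dry q : 'D_ey (@rad2 R) q = 2 * cy q.
  have [_ ->] := is_deriveD (is_deriveM (is_derive_cx q ey) (is_derive_cx q ey))
    (is_deriveM (is_derive_cy q ey) (is_derive_cy q ey)).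
  by rewrite /GRing.scale /= /cx /cy /=; ring.
have Drz q : 'D_ez (@rad2 R) q = 0.
  have [_ ->] := is_deriveD (is_deriveM (is_derive_cx q ez) (is_derive_cx q ez))
    (is_deriveM (is_derive_cy q ez) (is_derive_cy q ez)).
  by rewrite /GRing.scale /= /cx /cy /=; ring.
(* With d_z moved past d_x and d_y, the second derivatives of [f] cancel between the vertical and
   the planar divergences. *)
have commx q : 'D_ez ('D_ex f) q = 'D_ex ('D_ez f) q.
  exact: (@derive_comm R f ez ex q sf tfz.1 (sf_dx tf).1 (sf_dx tfz).1).
have commy q : 'D_ez ('D_ey f) q = 'D_ey ('D_ez f) q.
  exact: (@derive_comm R f ez ey q sf tfz.1 (sf_dy tf).1 (sf_dy tfz).1).
(* The planar divergence of (x, y) r^2 is 4 r^2, which produces -4 r^2 g d_z f; adding the vertical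
   derivative of 2 r^2 f g restores the antisymmetry in [f] and [g]. *)
have -> : I3 M (symp_density f g) = I3 M (fun q =>
    'D_ez (fun q => rad2 q * (g q * euler f q)) q +
    ((-1) * ('D_ex (fun q => cx q * (rad2 q * (g q * 'D_ez f q))) q +
     'D_ey (fun q => cy q * (rad2 q * (g q * 'D_ez f q))) q) +
    2 * 'D_ez (fun q => rad2 q * (f q * g q)) q)).
  apply: eq_I3 => q.
  have Dxx : 'D_ex (@cx R) q = 1 by exact: Dcx.
  have Dyy : 'D_ey (@cy R) q = 1 by exact: Dcy.
  have Dzx : 'D_ez (@cx R) q = 0 by exact: Dcx.
  have Dzy : 'D_ez (@cy R) q = 0 by exact: Dcy.
  have DzE : 'D_ez (euler f) q = (cx q * 'D_ex ('D_ez f) q + 'D_ex f q * 0) +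
      (cy q * 'D_ey ('D_ez f) q + 'D_ey f q * 0).
    apply: etrans (deriveD_smooth q ez (sfM sx (sf_dx tf)).1 (sfM sy (sf_dy tf)).1) _.
    by apply: f_equal2; [exact: deriveM_val sx (sf_dx tf).1 Dzx (commx q)|
      exact: deriveM_val sy (sf_dy tf).1 Dzy (commy q)].
  have eA := deriveM_val sr t1'.1 (Drz q) (deriveM_val sg tE.1 erefl DzE).
  have eB := deriveM_val sx t2.1 Dxx (deriveM_val sr t2'.1 (Drx q) (deriveM_val sg tfz.1 erefl erefl)).
  have eC := deriveM_val sy t2.1 Dyy (deriveM_val sr t2'.1 (Dry q) (deriveM_val sg tfz.1 erefl erefl)).
  have eD := deriveM_val sr t3'.1 (Drz q) (deriveM_val sf sg erefl erefl).
  apply: etrans (esym (f_equal2 +%R eA (f_equal2 +%R (f_equal2 *%R (erefl (-1)) (f_equal2 +%R eB eC))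
    (f_equal2 *%R (erefl 2) eD)))).
  rewrite /symp_density /euler /rad2.
  move: ('D_ex f q) ('D_ey f q) ('D_ez f q) ('D_ex g q) ('D_ey g q) ('D_ez g q)
    ('D_ex ('D_ez f) q) ('D_ey ('D_ez f) q) (f q) (g q) (cx q) (cy q) => fx fy fz gx gy gz fzx fzy F G x y.
  by ring.
have c1 := sf_cont (sf_dz t1). have c2x := sf_cont (sf_dx t2x).
have c2y := sf_cont (sf_dy t2y). have c3 := sf_cont (sf_dz t3).
have c2 := sf_cont (sfD (sf_dx t2x) (sf_dy t2y)).
have c2' := sf_cont (sfZ (-1) (sfD (sf_dx t2x) (sf_dy t2y))).
have c3' := sf_cont (sfZ 2 (sf_dz t3)).
have c4 := sf_cont (sfD (sfZ (-1) (sfD (sf_dx t2x) (sf_dy t2y))) (sfZ 2 (sf_dz t3))).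
rewrite (I3D M0 c1 c4) (I3D M0 c2' c3') (I3Z M0 _ c2) (I3Z M0 _ c3) (I3D M0 c2x c2y).
by rewrite (I3_sf_dz t1) (I3_sf_dx t2x) (I3_sf_dy t2y) (I3_sf_dz t3) !(addr0, mulr0).
Qed.

End NullForms.

(** * The inequality for a single angular mode *)

Lemma mode_low_density (R : realType) (m d EP ES p s pz sz r : R) :
  -1 <= m -> m <= 1 -> d ^+ 2 <= m ^+ 2 ->
  0 <= (EP + p) ^+ 2 + (ES + s) ^+ 2 + (- m * s + r / 2 * pz) ^+ 2 + (m * p + r / 2 * sz) ^+ 2
    - d ^+ 2 * (p ^+ 2 + s ^+ 2) - m * (r * (2 * (p * sz - s * pz) + EP * sz - ES * pz)).
Proof.
move=> m1 m2 dm.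
(* Here [r] is the squared radius. Put w = p + i s, a = (EP + p) + i (ES + s) and b = (r/2)(sz - i
   pz). Subtracting m times the symplectic density removes the cross term of w and b and leaves
   |a|^2 + |b|^2 - 2 m Re(conj(a) b) + (m^2 - d^2) |w|^2. For |m| <= 1 the part in a and b is a
   convex combination of |a - b|^2 and |a + b|^2. *)
rewrite [X in 0 <= X](_ : _ =
  (1 + m) / 2 * ((EP + p - r / 2 * sz) ^+ 2 + (ES + s + r / 2 * pz) ^+ 2) +
  (1 - m) / 2 * ((EP + p + r / 2 * sz) ^+ 2 + (ES + s - r / 2 * pz) ^+ 2) +
  (m ^+ 2 - d ^+ 2) * (p ^+ 2 + s ^+ 2)); last by field.
have h1 : 0 <= (1 + m) / 2 by rewrite divr_ge0// -lerBlDl sub0r.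
have h2 : 0 <= (1 - m) / 2 by rewrite divr_ge0// subr_ge0.
have h3 : 0 <= m ^+ 2 - d ^+ 2 by rewrite subr_ge0.
have sq2 (x y : R) : 0 <= x ^+ 2 + y ^+ 2 by rewrite addr_ge0 ?sqr_ge0.
by apply: addr_ge0; [apply: addr_ge0|]; apply: mulr_ge0.
Qed.

Lemma mode_high_density (R : realType) (sg n d EP ES p s pz sz r : R) :
  sg ^+ 2 = 1 -> 1 + d ^+ 2 <= 2 * n ->
  0 <= (EP + p) ^+ 2 + (ES + s) ^+ 2 + (- (sg * n) * s + r / 2 * pz) ^+ 2
    + (sg * n * p + r / 2 * sz) ^+ 2
    - d ^+ 2 * (p ^+ 2 + s ^+ 2) - (sg * (r * (2 * (p * sz - s * pz) + EP * sz - ES * pz))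
    + 2 * (n - 1) * ((EP + p) * p + (ES + s) * s)).
Proof.
move=> sg2 dn.
(* With the same w, a and b, the first two squares add up to |a - (n - 1) w - sg b|^2. What remains
   of n^2 |w|^2 has coefficient n^2 - (n - 1)^2 = 2 n - 1, whence the lower bound on n. *)
rewrite [X in 0 <= X](_ : _ =
  (EP + p - (n - 1) * p - sg * (r / 2) * sz) ^+ 2 +
  (ES + s - (n - 1) * s + sg * (r / 2) * pz) ^+ 2 +
  (2 * n - 1 - d ^+ 2) * (p ^+ 2 + s ^+ 2)).
  have sq2 (x y : R) : 0 <= x ^+ 2 + y ^+ 2 by rewrite addr_ge0 ?sqr_ge0.
  by apply: addr_ge0 => //; apply: mulr_ge0; rewrite // -addrA -opprD subr_ge0.
apply/eqP; rewrite -subr_eq0; apply/eqP.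
(* The identity is polynomial only modulo sg^2 = 1, so the defect is displayed as a multiple of sg^2
   - 1. *)
rewrite [LHS](_ : _ = (sg ^+ 2 - 1) * (n ^+ 2 * (p ^+ 2 + s ^+ 2) - (r / 2) ^+ 2 * (pz ^+ 2 + sz ^+ 2))); last by field.
by rewrite sg2 subrr mul0r.
Qed.

Section ModeInequality.
Variable R : realType.
Local Notation heis := (heis R).
Local Notation ez := (e_z R).
Variables delta L M : R.
Hypotheses (delta0 : 0 < delta) (L0 : 0 <= L) (LM : L < M).
Local Notation sf := (shell_fun delta L).
Implicit Types (f g P S : heis -> R) (q : heis).

Let sr := smooth_rad2 (openT : open [set: heis]).
Let M0 : 0 <= M. Proof. exact: le_trans L0 (ltW LM). Qed.
Let sfc f : sf f -> continuous f. Proof. exact: sf_cont. Qed.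

Lemma sfB f g : sf f -> sf g -> sf (fun q => f q - g q).
Proof.
move=> tf tg; rewrite (_ : (fun q => _) = fun q => f q + -1 * g q); last first.
  by apply/funext => q; rewrite mulN1r.
by apply: sfD => //; exact: sfZ.
Qed.

Lemma sf_sqr f : sf f -> sf (fun q => f q ^+ 2).
Proof. by move=> tf; exact: (sfM delta0 tf.1 tf). Qed.

Lemma sf_symp f g : sf f -> sf g -> sf (symp_density f g).
Proof.
move=> tf tg.
have tfz := sf_dz tf; have tgz := sf_dz tg.
have tEf := sf_euler delta0 tf; have tEg := sf_euler delta0 tg.
apply: (sfM delta0 sr); apply: sfB; last exact: (sfM delta0 tEg.1 tfz).
apply: sfD; last exact: (sfM delta0 tEf.1 tgz).
by apply: sfZ => //; apply: sfB; [exact: (sfM delta0 tf.1 tgz)|exact: (sfM delta0 tg.1 tfz)].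
Qed.

(** The energy density of w = P + i S once V + i alpha is replaced by multiplication by i m: radial
    part first, then the real and imaginary parts of i m w + (r^2/2) d_z w. *)
Definition mode_density (m : R) P S q :=
  (euler P q + P q) ^+ 2 + (euler S q + S q) ^+ 2 +
  (- m * S q + rad2 q / 2 * 'D_ez P q) ^+ 2 + (m * P q + rad2 q / 2 * 'D_ez S q) ^+ 2.

Lemma sf_mode_density m P S : sf P -> sf S -> sf (mode_density m P S).
Proof.
move=> tP tS.
have h : smooth setT (fun q : heis => rad2 q / 2).
  by apply: (smoothM openT sr); exact: smooth_cst openT.
have tPz := sf_dz tP; have tSz := sf_dz tS.
have tEP := sf_euler delta0 tP; have tES := sf_euler delta0 tS.
apply: sfD; last by apply: sf_sqr; apply: sfD; [exact: sfZ|exact: sfM].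
apply: sfD; last by apply: sf_sqr; apply: sfD; [exact: sfZ|exact: sfM].
by apply: sfD; apply: sf_sqr; apply: sfD.
Qed.

(* With zeta = -i d/dz and w = P + i S, completing the square in
   |a - (a0 + s r^2 zeta / 2) w|^2 (a = (E + 1) w, s a0 = m - s) for |m| >= 1,
   and a convex combination of |a -+ (r^2 zeta / 2) w|^2 for |m| <= 1. *)
Lemma mode_inequality (m d : R) P S : sf P -> sf S -> d ^+ 2 <= m ^+ 2 ->
  `|m| <= 1 \/ 1 + d ^+ 2 <= 2 * `|m| ->
  0 <= I3 M (fun q => mode_density m P S q - d ^+ 2 * (P q ^+ 2 + S q ^+ 2)).
Proof.
move=> tP tS dm hm.
pose Q q := mode_density m P S q - d ^+ 2 * (P q ^+ 2 + S q ^+ 2).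
have tQ : sf Q.
  apply: sfB; first exact: sf_mode_density.
  by apply: sfZ => //; apply: sfD; exact: sf_sqr.
pose N q := (euler P q + P q) * P q + (euler S q + S q) * S q.
have tNP : sf (fun q => (euler P q + P q) * P q).
  have t := sfD (sf_euler delta0 tP) tP; exact: (sfM delta0 t.1 tP).
have tNS : sf (fun q => (euler S q + S q) * S q).
  have t := sfD (sf_euler delta0 tS) tS; exact: (sfM delta0 t.1 tS).
have tN : sf N by exact: sfD.
have IN : I3 M N = 0.
  rewrite (I3D M0 (sfc tNP) (sfc tNS)).
  by rewrite (euler_null delta0 L0 LM tP) (euler_null delta0 L0 LM tS) addr0.
have tY := sf_symp tP tS; have IY := symp_null delta0 L0 LM tP tS.
have key (k c : R) : (forall q, 0 <= Q q - (k * symp_density P S q + c * N q)) -> 0 <= I3 M Q.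
  move=> h; have t2 := sfD (sfZ delta0 k tY) (sfZ delta0 c tN).
  have := @I3_ge0 R M _ (sfc (sfB tQ t2)) h.
  rewrite (I3B M0 (sfc tQ) (sfc t2)) (I3D M0 (sfc (sfZ delta0 k tY)) (sfc (sfZ delta0 c tN))).
  by rewrite (I3Z M0 _ (sfc tY)) (I3Z M0 _ (sfc tN)) IN IY !mulr0 addr0 subr0.
have [m1|m1] := leP `|m| 1.
  apply: (key m 0) => q; rewrite mul0r addr0.
  by move: m1; rewrite ler_norml => /andP[m1 m2]; exact: mode_low_density.
have hm' : 1 + d ^+ 2 <= 2 * `|m|.
  by case: hm => //; rewrite leNgt m1.
have [sg [sg2 ms]] : exists sg : R, sg ^+ 2 = 1 /\ m = sg * `|m|.
  have [h|h] := leP 0 m.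
    by exists 1; rewrite expr1n mul1r ger0_norm.
  by exists (-1); rewrite sqrrN expr1n mulN1r ltr0_norm// opprK.
apply: (key sg (2 * (`|m| - 1))) => q; rewrite /Q /mode_density {1 2}ms.
exact: mode_high_density.
Qed.

End ModeInequality.

(** * Rotations about the axis *)

Section Rotations.
Variable R : realType.
Local Notation heis := (heis R).
Local Notation ex := (e_x R).
Local Notation ey := (e_y R).
Local Notation ez := (e_z R).
Implicit Types (f g h F : heis -> R) (q v : heis) (t : R) (phi : R -> R).

Definition rotz t q : heis :=
  (cx q * cos t - cy q * sin t, cx q * sin t + cy q * cos t, cz q).

Lemma rad2_rotz t q : rad2 (rotz t q) = rad2 q.
Proof.
rewrite /rad2 /rotz /cx /cy /= -[RHS]mulr1 -(cos2Dsin2 t).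
by move: (cos t) (sin t) => c s; ring.
Qed.

Lemma rotz_linear t (a : R) v q : rotz t (a *: v + q) = a *: rotz t v + rotz t q.
Proof.
case: v => [[vx vy] vz]; case: q => [[x y] z].
rewrite /rotz /cx /cy /cz; congr (_, _, _); rewrite /= /GRing.scale /=; ring.
Qed.

Lemma rotz0 q : rotz 0 q = q.
Proof.
case: q => [[x y] z]; rewrite /rotz cos0 sin0 /cx /cy /cz /=.
by rewrite !(mulr0, mulr1) subr0 add0r.
Qed.

Lemma rotz_pi q : rotz (- pi) q = rotz pi q.
Proof. by rewrite /rotz cosN sinN cospi sinpi oppr0. Qed.

Lemma continuous_rot : continuous (fun p : heis * R => rotz p.2 p.1).
Proof.
have cs : continuous (fun p : heis * R => sin p.2).
  by apply: continuous_compT (@continuous_sin R); cont.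
have cc : continuous (fun p : heis * R => cos p.2).
  by apply: continuous_compT (@continuous_cos R); cont.
have cX : continuous (fun p : heis * R => cx p.1) by rewrite /cx; cont.
have cY : continuous (fun p : heis * R => cy p.1) by rewrite /cy; cont.
apply: continuous_pair_comp; last by rewrite /cz; cont.
apply: continuous_pair_comp => p.
  by apply: cvgB; apply: cvgM; [exact: cX|exact: cc|exact: cY|exact: cs].
by apply: cvgD; apply: cvgM; [exact: cX|exact: cs|exact: cY|exact: cc].
Qed.

Lemma continuous_rotl f : continuous f -> continuous (fun p : heis * R => f (rotz p.2 p.1)).
Proof. by move=> cf; exact: continuous_compT continuous_rot cf. Qed.

Lemma continuous_rotr f : continuous f -> continuous (fun p : R * heis => f (rotz p.1 p.2)).
Proof.
by move=> cf; apply: (@continuous_compT _ _ _ (fun p : R * heis => (p.2, p.1)) _ _ (continuous_rotl cf)); cont.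
Qed.

Lemma continuous_rot_t f q : continuous f -> continuous (fun t => f (rotz t q)).
Proof.
by move=> cf; apply: (@continuous_compT _ _ _ (fun t : R => (q, t)) _ _ (continuous_rotl cf)); cont.
Qed.

Lemma continuous_rot_q f t : continuous f -> continuous (fun q => f (rotz t q)).
Proof.
by move=> cf; apply: (@continuous_compT _ _ _ (fun q : heis => (q, t)) _ _ (continuous_rotl cf)); cont.
Qed.

Lemma is_derive_rot_t f q t : smooth setT f ->
  is_derive t (1 : R) (fun t => f (rotz t q)) (angular f (rotz t q)).
Proof.
move=> sf.
have d1 : is_derive t (1 : R) (fun t => cx q * cos t - cy q * sin t) (- cy (rotz t q)).
  apply: is_derive_eq (is_deriveB (is_deriveM (is_derive_cst (cx q) t (1 : R)) (is_derive_cos t))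
    (is_deriveM (is_derive_cst (cy q) t (1 : R)) (is_derive_sin t))) _.
  by rewrite /GRing.scale /= !mulr0 !addr0 /rotz /cy /=; ring.
have d2 : is_derive t (1 : R) (fun t => cx q * sin t + cy q * cos t) (cx (rotz t q)).
  apply: is_derive_eq (is_deriveD (is_deriveM (is_derive_cst (cx q) t (1 : R)) (is_derive_sin t))
    (is_deriveM (is_derive_cst (cy q) t (1 : R)) (is_derive_cos t))) _.
  by rewrite /GRing.scale /= !mulr0 !addr0 /rotz /cx /=; ring.
apply: is_derive_eq (@is_diff_curve R f (fun t => cx q * cos t - cy q * sin t)
  (fun t => cx q * sin t + cy q * cos t) (fun=> cz q) t _ _ _ _
  (smooth_is_diff openT sf (I : setT (rotz t q))) d1 d2 (is_derive_cst (cz q) t (1 : R))) _.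
rewrite /angular; move: ('D_ex f _) ('D_ey f _) ('D_ez f _) => a b c.
by rewrite {1}/cx {2}/cy {1}/cz /= mul0r addr0 mulNr addrC.
Qed.

Lemma is_derive_rot_q f q v t : smooth setT f ->
  is_derive q v (fun q => f (rotz t q)) ('D_(rotz t v) f (rotz t q)).
Proof.
move=> sf; apply: (@is_derive_affine R (rotz t) f q v (rotz t v)).
  by move=> a; exact: rotz_linear.
exact: smoothT_derivable.
Qed.

Lemma derive_rot_ex f q t : smooth setT f ->
  'D_(rotz t ex) f q = cos t * 'D_ex f q + sin t * 'D_ey f q.
Proof.
move=> sf; rewrite (smoothT_deriveE _ _ sf) /rotz /cx /cy /cz /=.
by rewrite !(mul0r, mul1r) subr0 !addr0.
Qed.

Lemma derive_rot_ey f q t : smooth setT f ->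
  'D_(rotz t ey) f q = - sin t * 'D_ex f q + cos t * 'D_ey f q.
Proof.
move=> sf; rewrite (smoothT_deriveE _ _ sf) /rotz /cx /cy /cz /=.
by rewrite !(mul0r, mul1r) sub0r add0r !addr0.
Qed.

Lemma derive_rot_ez f q t : smooth setT f -> 'D_(rotz t ez) f q = 'D_ez f q.
Proof.
move=> sf; rewrite (smoothT_deriveE _ _ sf) /rotz /cx /cy /cz /=.
by move: (cos t) (sin t) ('D_ex f q) ('D_ey f q) ('D_ez f q) => c s a b d; ring.
Qed.

(** V is invariant under rotations: the right-hand side is V applied at q to the rotated function,
    in the form required for integration by parts in x and y. *)
Lemma angular_rot f q t : smooth setT f ->
  angular f (rotz t q) = cx q * 'D_(rotz t ey) f (rotz t q) - cy q * 'D_(rotz t ex) f (rotz t q).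
Proof.
move=> sf; rewrite /angular (derive_rot_ex (rotz t q) t sf) (derive_rot_ey (rotz t q) t sf).
rewrite {1}/rotz {2}/rotz /cx /cy /=.
by move: (cos t) (sin t) ('D_ex f _) ('D_ey f _) => c s a b; ring.
Qed.

Section Average.
Variable delta L M : R.
Hypotheses (delta0 : 0 < delta) (L0 : 0 <= L) (LM : L < M).
Local Notation sf := (shell_fun delta L).

Let M0 : 0 <= M. Proof. exact: le_trans L0 (ltW LM). Qed.

Lemma shell_rotz t q : ~ shell delta L q -> ~ shell delta L (rotz t q).
Proof. by move=> nq; rewrite /shell /= rad2_rotz. Qed.

(** In place of a change of variables: the t-derivative is the integral of x d_y - y d_x applied to
    the rotated function, a divergence, so the integral is constant in t. The shell is invariant
    under rotations, hence all the rotated functions vanish on the faces of the same box. *)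
Lemma I3_rotz t F : sf F -> I3 M (fun q => F (rotz t q)) = I3 M F.
Proof.
move=> tF; have [sF F0] := tF.
have cD v s : continuous (fun q => 'D_v F (rotz s q)).
  apply: (@continuous_rot_q ('D_v F) s).
  have -> : 'D_v F = fun q => cx v * 'D_ex F q + cy v * 'D_ey F q + cz v * 'D_ez F q.
    by apply/funext => p; exact: smoothT_deriveE.
  by move=> q; apply: cvgD; [apply: cvgD|]; (apply: cvgM; first exact: cvg_cst);
    [exact: (sf_cont (sf_dx tF))|exact: (sf_cont (sf_dy tF))|exact: (sf_cont (sf_dz tF))].
have bF s (h : heis -> R) : box_supp M (fun q => h q * F (rotz s q)).
  move=> q hq; rewrite F0 ?mulr0//; apply: shell_rotz => Kq.
  have t1 : sf (fun q => F q) by [].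
  case: Kq => _ r1 z1; case: hq => [h1|[h1|h1]].
  - move: r1; apply/negP; rewrite -ltNge /rad2 ltr_wpDr ?sqr_ge0// -(real_normK (num_real (cx q))).
    by rewrite ltr_pXn2r// ?nnegrE//; exact: lt_le_trans LM h1.
  - move: r1; apply/negP; rewrite -ltNge /rad2 ltr_wpDl ?sqr_ge0// -(real_normK (num_real (cy q))).
    by rewrite ltr_pXn2r// ?nnegrE//; exact: lt_le_trans LM h1.
  - by move: z1; apply/negP; rewrite -ltNge; exact: lt_le_trans LM h1.
have cF := sf_cont tF.
have Z s : I3 M (fun q => angular F (rotz s q)) = 0.
  have c1 : continuous (fun q => cx q * 'D_(rotz s ey) F (rotz s q)).
    by move=> q; apply: cvgM; [exact: continuous_cx|exact: cD].
  have c2 : continuous (fun q => cy q * 'D_(rotz s ex) F (rotz s q)).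
    by move=> q; apply: cvgM; [exact: continuous_cy|exact: cD].
  have -> : I3 M (fun q => angular F (rotz s q)) =
     I3 M (fun q => cx q * 'D_(rotz s ey) F (rotz s q) - cy q * 'D_(rotz s ex) F (rotz s q)).
    by apply: eq_I3 => q; exact: angular_rot.
  have cR : continuous (fun q => F (rotz s q)) by exact: continuous_rot_q.
  have f1 : continuous (fun q => cx q * F (rotz s q)).
    by move=> q; apply: cvgM; [exact: continuous_cx|exact: cR].
  have f2 : continuous (fun q => cy q * F (rotz s q)).
    by move=> q; apply: cvgM; [exact: continuous_cy|exact: cR].
  have e1 : I3 M (fun q => cx q * 'D_(rotz s ey) F (rotz s q)) = 0.
    apply: (I3_dy M0 f1 c1 (bF s (@cx R))) => q.
    apply: is_derive_eq (is_deriveM (is_derive_cx q ey) (is_derive_rot_q q ey s sF)) _.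
    by rewrite /GRing.scale /= {2}/cx /= mulr0 addr0.
  have e2 : I3 M (fun q => cy q * 'D_(rotz s ex) F (rotz s q)) = 0.
    apply: (I3_dx M0 f2 c2 (bF s (@cy R))) => q.
    apply: is_derive_eq (is_deriveM (is_derive_cy q ex) (is_derive_rot_q q ex s sF)) _.
    by rewrite /GRing.scale /= {2}/cy /= mulr0 addr0.
  apply: etrans (I3B M0 c1 c2) _.
  exact: (etrans (f_equal2 (fun a b : R => a - b) e1 e2) (subr0 0)).
have D s : is_derive s (1 : R) (fun s => I3 M (fun q => F (rotz s q))) 0.
  rewrite -(Z s).
  apply: (@is_derive_I3 R M M0 R (fun s q => F (rotz s q)) (fun s q => angular F (rotz s q)) s 1).
  - exact: continuous_rotr.
  - by apply: continuous_rotr; exact: sf_cont (sf_angular delta0 tF).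
  - by move=> p q; exact: is_derive_rot_t.
rewrite (is_derive_0_is_cst t 0 D).
by apply: eq_I3 => q; rewrite rotz0.
Qed.

End Average.
End Rotations.

(** * Averages over rotations with a weight *)

Section AngularModes.
Variable R : realType.
Local Notation heis := (heis R).
Local Notation ex := (e_x R).
Local Notation ey := (e_y R).
Local Notation ez := (e_z R).
Implicit Types (f g h F : heis -> R) (q v : heis) (t : R) (phi : R -> R).

(** For cosine and sine weights these are unnormalized Fourier coefficients along the orbit of q,
    regarded as functions of q in Cartesian coordinates. *)
Definition avg phi f q : R := sint (- pi) pi (fun t => phi t * f (rotz t q)).

Let pp : - pi <= pi :> R. Proof. by rewrite ge0_cp// pi_ge0. Qed.

Lemma continuous_mul (T : topologicalType) (a b : T -> R) :
  continuous a -> continuous b -> continuous (fun x => a x * b x).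
Proof. by move=> ca cb x; apply: cvgM; [exact: ca|exact: cb]. Qed.

Let cavg phi f : continuous phi -> continuous f ->
  continuous (fun p : heis * R => phi p.2 * f (rotz p.2 p.1)).
Proof.
move=> cphi cf; apply: continuous_mul; last exact: continuous_rotl.
by apply: (@continuous_compT _ _ _ (fun p : heis * R => p.2) phi) => //; cont.
Qed.

Let cavgt phi f q : continuous phi -> continuous f ->
  cont_seg (- pi) pi (fun t => phi t * f (rotz t q)).
Proof.
by move=> cphi cf t _; apply: continuous_mul => //; exact: continuous_rot_t.
Qed.

Lemma continuous_avg phi f : continuous phi -> continuous f -> continuous (avg phi f).
Proof.
move=> cphi cf.
exact: (@continuous_sint R _ (fun q t => phi t * f (rotz t q)) _ _ pp (cavg cphi cf)).
Qed.

Lemma avgD phi f g q : continuous phi -> continuous f -> continuous g ->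
  avg phi (fun q => f q + g q) q = avg phi f q + avg phi g q.
Proof.
move=> cphi cf cg; rewrite /avg -(sintD (cavgt (q:=q) cphi cf) (cavgt (q:=q) cphi cg)).
by apply: eq_sint => t _; rewrite mulrDr.
Qed.

Lemma avg_radial phi h f q : (forall t, h (rotz t q) = h q) ->
  continuous phi -> continuous f ->
  avg phi (fun q => h q * f q) q = h q * avg phi f q.
Proof.
move=> hr cphi cf; rewrite /avg -(sintZ (h q) (cavgt (q:=q) cphi cf)).
by apply: eq_sint => t _; rewrite hr mulrCA.
Qed.

Lemma avgZ phi (k : R) f q : continuous phi -> continuous f ->
  avg phi (fun q => k * f q) q = k * avg phi f q.
Proof. by move=> *; apply: (@avg_radial phi (fun=> k)). Qed.

Lemma is_derive_avg phi f q v : continuous phi -> smooth setT f ->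
  is_derive q v (avg phi f) (sint (- pi) pi (fun t => phi t * 'D_(rotz t v) f (rotz t q))).
Proof.
move=> cphi sf; have cf := smoothT_continuous sf.
apply: (@sint_param_derive R _ setT _ _ (fun q t => phi t * f (rotz t q))
  (fun q t => phi t * 'D_(rotz t v) f (rotz t q)) q v openT pp).
- by move=> p t _ _; exact: (cavg cphi cf).
- move=> p t _ _; apply: continuous_mul.
    by apply: (@continuous_compT _ _ _ (fun p : heis * R => p.2) phi) => //; cont.
  have -> : (fun p : heis * R => 'D_(rotz p.2 v) f (rotz p.2 p.1)) = fun p : heis * R =>
      cx (rotz p.2 v) * 'D_ex f (rotz p.2 p.1) + cy (rotz p.2 v) * 'D_ey f (rotz p.2 p.1)
      + cz (rotz p.2 v) * 'D_ez f (rotz p.2 p.1).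
    by apply/funext => p'; exact: smoothT_deriveE.
  have c1 g : continuous g -> continuous (fun p : heis * R => g (rotz p.2 v)).
    by move=> cg; apply: (@continuous_compT _ _ _ (fun p : heis * R => (v, p.2)) _ _ (continuous_rotl cg)); cont.
  have cdx := continuous_rotl (smoothT_continuous (smooth_dx sf)).
  have cdy := continuous_rotl (smoothT_continuous (smooth_dy sf)).
  have cdz := continuous_rotl (smoothT_continuous (smooth_dz sf)).
  have k1 := continuous_mul (c1 _ (@continuous_cx R)) cdx.
  have k2 := continuous_mul (c1 _ (@continuous_cy R)) cdy.
  have k3 := continuous_mul (c1 _ (@continuous_cz R)) cdz.
  move=> p'; apply: cvgD; last exact: k3.
  by apply: cvgD; [exact: k1|exact: k2].
- move=> p t _ _.
  apply: is_derive_eq (is_deriveM (is_derive_cst (phi t) p v) (is_derive_rot_q p v t sf)) _.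
  by rewrite /GRing.scale /= mulr0 addr0.
- by [].
Qed.

Let ccos : continuous (@cos R). Proof. exact: continuous_cos. Qed.
Let csin : continuous (@sin R). Proof. exact: continuous_sin. Qed.
Let cNsin : continuous (fun t : R => - sin t).
Proof. by move=> t; apply: cvgN; exact: csin. Qed.

Lemma avg_dx phi f q : continuous phi -> smooth setT f ->
  'D_ex (avg phi f) q = avg (fun t => phi t * cos t) ('D_ex f) q
                      + avg (fun t => phi t * sin t) ('D_ey f) q.
Proof.
move=> cphi sf; have [_ ->] := is_derive_avg q ex cphi sf.
have c1 := smoothT_continuous (smooth_dx sf); have c2 := smoothT_continuous (smooth_dy sf).
rewrite /avg -(sintD (cavgt (q:=q) (continuous_mul cphi ccos) c1) (cavgt (q:=q) (continuous_mul cphi csin) c2)).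
by apply: eq_sint => t _; rewrite (derive_rot_ex (rotz t q) t sf);
  move: ('D_ex f _) ('D_ey f _) => a b; ring.
Qed.

Lemma avg_dy phi f q : continuous phi -> smooth setT f ->
  'D_ey (avg phi f) q = avg (fun t => phi t * (- sin t)) ('D_ex f) q
                      + avg (fun t => phi t * cos t) ('D_ey f) q.
Proof.
move=> cphi sf; have [_ ->] := is_derive_avg q ey cphi sf.
have c1 := smoothT_continuous (smooth_dx sf); have c2 := smoothT_continuous (smooth_dy sf).
rewrite /avg -(sintD (cavgt (q:=q) (continuous_mul cphi cNsin) c1) (cavgt (q:=q) (continuous_mul cphi ccos) c2)).
by apply: eq_sint => t _; rewrite (derive_rot_ey (rotz t q) t sf);
  move: ('D_ex f _) ('D_ey f _) => a b; ring.
Qed.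

Lemma avg_dz phi f q : continuous phi -> smooth setT f ->
  'D_ez (avg phi f) q = avg phi ('D_ez f) q.
Proof.
move=> cphi sf; have [_ ->] := is_derive_avg q ez cphi sf.
by apply: eq_sint => t _; rewrite (derive_rot_ez (rotz t q) t sf).
Qed.

(** Differentiation in x or y rotates the direction and so multiplies the weight by cos t or sin t:
    the weight has to range over all continuous functions, and sums are needed. *)
Inductive avg_family : (heis -> R) -> Prop :=
| AF_avg phi f : continuous phi -> smooth setT f -> avg_family (avg phi f)
| AF_add f g : avg_family f -> avg_family g -> avg_family (fun q => f q + g q).

Lemma smooth_avg phi f : continuous phi -> smooth setT f -> smooth setT (avg phi f).
Proof.
move=> cphi0 sf0; apply: (@smooth_family R setT avg_family openT); last exact: AF_avg.
move=> {cphi0 sf0 phi f} F; elim=> {F} [phi f cphi sf|f g _ [cf df] _ [cg dg]].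
  split; first by move=> q _; exact: (continuous_avg cphi (smoothT_continuous sf)).
  have dd q v : is_derive q v (avg phi f) ('D_v (avg phi f) q).
    by apply: derivableP; case: (is_derive_avg q v cphi sf).
  case=> -[|[|[|//]]] k.
  - exists (fun q => avg (fun t => phi t * cos t) ('D_ex f) q
                      + avg (fun t => phi t * sin t) ('D_ey f) q).
      apply: AF_add; apply: AF_avg; [exact: continuous_mul|exact: smooth_dx|exact: continuous_mul|exact: smooth_dy].
    by move=> q _; rewrite -avg_dx//; exact: dd.
  - exists (fun q => avg (fun t => phi t * (- sin t)) ('D_ex f) q
                      + avg (fun t => phi t * cos t) ('D_ey f) q).
      apply: AF_add; apply: AF_avg; [exact: continuous_mul|exact: smooth_dx|exact: continuous_mul|exact: smooth_dy].
    by move=> q _; rewrite -avg_dy//; exact: dd.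
  - exists (avg phi ('D_ez f)); first by apply: AF_avg => //; exact: smooth_dz.
    by move=> q _; rewrite -avg_dz//; exact: dd.
split=> [q Uq|i]; first by apply: cvgD; [exact: cf|exact: cg].
have [f' Sf' df'] := df i; have [g' Sg' dg'] := dg i.
exists (fun q => f' q + g' q); first exact: AF_add.
by move=> q Uq; apply: is_deriveD; [exact: df'|exact: dg'].
Qed.

(** E commutes with rotations: the factors cos t and sin t created by [avg_dx] and [avg_dy]
    recombine with x and y into the coordinates of the rotated point. *)
Lemma euler_avg phi f q : continuous phi -> smooth setT f ->
  euler (avg phi f) q = avg phi (euler f) q.
Proof.
move=> cphi sf; rewrite /euler avg_dx// avg_dy//.
have c1 := smoothT_continuous (smooth_dx sf); have c2 := smoothT_continuous (smooth_dy sf).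
have s1 := cavgt (q:=q) (continuous_mul cphi ccos) c1.
have s2 := cavgt (q:=q) (continuous_mul cphi csin) c2.
have s3 := cavgt (q:=q) (continuous_mul cphi cNsin) c1.
have s4 := cavgt (q:=q) (continuous_mul cphi ccos) c2.
have cD (a b : R -> R) : cont_seg (- pi) pi a -> cont_seg (- pi) pi b -> cont_seg (- pi) pi (fun t => a t + b t).
  by move=> ca cb t ht; apply: cvgD; [exact: ca|exact: cb].
have cZ (k : R) (a : R -> R) : cont_seg (- pi) pi a -> cont_seg (- pi) pi (fun t => k * a t).
  by move=> ca t ht; apply: cvgM; [exact: cvg_cst|exact: ca].
rewrite /avg -(sintD s1 s2) -(sintD s3 s4) -(sintZ _ (cD _ _ s1 s2)) -(sintZ _ (cD _ _ s3 s4)).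
rewrite -(sintD (cZ _ _ (cD _ _ s1 s2)) (cZ _ _ (cD _ _ s3 s4))).
apply: eq_sint => t _; move: ('D_ex f _) ('D_ey f _) => a b.
have -> : cx (rotz t q) = cx q * cos t - cy q * sin t by [].
have -> : cy (rotz t q) = cx q * sin t + cy q * cos t by [].
by move: (cos t) (sin t) (cx q) (cy q) => c s x y; ring.
Qed.

Lemma angular_avg phi f q : continuous phi -> smooth setT f ->
  angular (avg phi f) q = avg phi (angular f) q.
Proof.
move=> cphi sf; rewrite /angular avg_dx// avg_dy//.
have c1 := smoothT_continuous (smooth_dx sf); have c2 := smoothT_continuous (smooth_dy sf).
have s1 := cavgt (q:=q) (continuous_mul cphi ccos) c1.
have s2 := cavgt (q:=q) (continuous_mul cphi csin) c2.
have s3 := cavgt (q:=q) (continuous_mul cphi cNsin) c1.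
have s4 := cavgt (q:=q) (continuous_mul cphi ccos) c2.
have cD (a b : R -> R) : cont_seg (- pi) pi a -> cont_seg (- pi) pi b -> cont_seg (- pi) pi (fun t => a t + b t).
  by move=> ca cb t ht; apply: cvgD; [exact: ca|exact: cb].
have cZ (k : R) (a : R -> R) : cont_seg (- pi) pi a -> cont_seg (- pi) pi (fun t => k * a t).
  by move=> ca t ht; apply: cvgM; [exact: cvg_cst|exact: ca].
rewrite /avg -(sintD s1 s2) -(sintD s3 s4) -(sintZ _ (cD _ _ s1 s2)) -(sintZ _ (cD _ _ s3 s4)).
rewrite -(sintB (cZ _ _ (cD _ _ s3 s4)) (cZ _ _ (cD _ _ s1 s2))).
apply: eq_sint => t _; move: ('D_ex f _) ('D_ey f _) => a b.
have -> : cx (rotz t q) = cx q * cos t - cy q * sin t by [].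
have -> : cy (rotz t q) = cx q * sin t + cy q * cos t by [].
by move: (cos t) (sin t) (cx q) (cy q) => c s x y; ring.
Qed.

Definition kcos (k t : R) : R := cos (k * t).
Definition ksin (k t : R) : R := sin (k * t).

Lemma is_derive_kcos k t : is_derive t (1 : R) (kcos k) (- k * ksin k t).
Proof.
have dk : is_derive t (1 : R) (fun t : R => k * t) k.
  apply: is_derive_eq (is_deriveM (is_derive_cst k t (1 : R)) (is_derive_id t (1 : R))) _.
  by rewrite /GRing.scale /= mulr0 addr0 mulr1.
apply: is_derive_eq (@is_derive1_comp R cos (fun t : R => k * t) t _ _ (is_derive_cos (k * t)) dk) _.
by rewrite /ksin mulNr mulNr mulrC.
Qed.

Lemma is_derive_ksin k t : is_derive t (1 : R) (ksin k) (k * kcos k t).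
Proof.
have dk : is_derive t (1 : R) (fun t : R => k * t) k.
  apply: is_derive_eq (is_deriveM (is_derive_cst k t (1 : R)) (is_derive_id t (1 : R))) _.
  by rewrite /GRing.scale /= mulr0 addr0 mulr1.
apply: is_derive_eq (@is_derive1_comp R sin (fun t : R => k * t) t _ _ (is_derive_sin (k * t)) dk) _.
by rewrite mulrC.
Qed.

Lemma continuous_kcos k : continuous (kcos k).
Proof. by move=> t; have [/derivable1_diffP/differentiable_continuous] := is_derive_kcos k t. Qed.

Lemma continuous_ksin k : continuous (ksin k).
Proof. by move=> t; have [/derivable1_diffP/differentiable_continuous] := is_derive_ksin k t. Qed.

(** Integration by parts along the orbit, where V is d/dt. The boundary terms cancel because the
    rotations by -pi and pi coincide and the weight has equal values at both ends. *)
Let by_parts phi (c : R) psi f q : continuous phi -> continuous psi -> smooth setT f ->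
  (forall t, is_derive t (1 : R) phi (c * psi t)) -> phi (- pi) = phi pi ->
  avg phi (angular f) q = - c * avg psi f q.
Proof.
move=> cphi cpsi sf dphi bphi.
have cf := smoothT_continuous sf.
have ca : continuous (angular f).
  have c1 := continuous_mul (@continuous_cx R) (smoothT_continuous (smooth_dy sf)).
  have c2 := continuous_mul (@continuous_cy R) (smoothT_continuous (smooth_dx sf)).
  by move=> p; apply: cvgB; [exact: c1|exact: c2].
have s1 := cavgt (q:=q) cphi ca. have s2 := cavgt (q:=q) cpsi cf.
have s3 : cont_seg (- pi) pi (fun t => c * (psi t * f (rotz t q))).
  by move=> t ht; apply: cvgM; [exact: cvg_cst|exact: s2].
have s4 : cont_seg (- pi) pi (fun t => phi t * angular f (rotz t q) + c * (psi t * f (rotz t q))).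
  by move=> t ht; apply: cvgD; [exact: s1|exact: s3].
have d t : t \in `[- pi, pi] -> is_derive t (1 : R) (fun t => phi t * f (rotz t q))
    (phi t * angular f (rotz t q) + c * (psi t * f (rotz t q))).
  move=> _; apply: is_derive_eq (is_deriveM (dphi t) (is_derive_rot_t q t sf)) _.
  by rewrite /GRing.scale /=; congr (_ + _); rewrite mulrC mulrA.
have H : sint (- pi) pi (fun t => phi t * angular f (rotz t q) + c * (psi t * f (rotz t q))) = 0.
  apply: etrans (@sint_FTC R _ _ _ _ pp s4 d) _.
  by rewrite bphi rotz_pi subrr.
move: H; rewrite (sintD s1 s3) (sintZ c s2) => /eqP; rewrite addr_eq0 => /eqP.
by rewrite mulNr.
Qed.

Lemma avg_kcos_angular k f q : smooth setT f ->
  avg (kcos k) (angular f) q = k * avg (ksin k) f q.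
Proof.
move=> sf.
rewrite (by_parts q (@continuous_kcos k) (@continuous_ksin k) sf (is_derive_kcos k)) ?opprK//.
by rewrite /kcos mulrN cosN.
Qed.

(** The condition sin (k pi) = 0 expresses the integrality of [k]; it makes the odd weight take
    equal values at -pi and pi. *)
Lemma avg_ksin_angular k f q : sin (k * pi) = 0 -> smooth setT f ->
  avg (ksin k) (angular f) q = - k * avg (kcos k) f q.
Proof.
move=> k0 sf.
rewrite (by_parts q (@continuous_ksin k) (@continuous_kcos k) sf (is_derive_ksin k))//.
by rewrite /ksin mulrN sinN k0 oppr0.
Qed.

End AngularModes.

(** * Correlations with rotated functions and their cosine coefficients *)

Section Correlation.
Variable R : realType.
Local Notation heis := (heis R).
Local Notation ez := (e_z R).
Variables delta L M : R.
Hypotheses (delta0 : 0 < delta) (L0 : 0 <= L) (LM : L < M).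
Local Notation sf := (shell_fun delta L).
Implicit Types (f g p s : heis -> R) (q : heis).

Let M0 : 0 <= M. Proof. exact: le_trans L0 (ltW LM). Qed.
Let pp : - pi <= pi :> R. Proof. by rewrite ge0_cp// pi_ge0. Qed.
Let sr := smooth_rad2 (openT : open [set: heis]).

(** The autocorrelation under the circle action; for shell functions [I3_mode_sq] identifies its
    cosine coefficients with energies of modes. *)
Definition corr f (t : R) : R := I3 M (fun q => f (rotz t q) * f q).

Let ccorr f : continuous f -> continuous (fun x : R * heis => f (rotz x.1 x.2) * f x.2).
Proof.
move=> cf; apply: continuous_mul; first exact: continuous_rotr.
by apply: (@continuous_compT _ _ _ (fun x : R * heis => x.2) f) => //; cont.
Qed.

Lemma continuous_corr f : continuous f -> continuous (corr f).
Proof.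
move=> cf; exact: (@continuous_I3 R M M0 R (fun t q => f (rotz t q) * f q) (ccorr cf)).
Qed.

Lemma corr0 f : corr f 0 = I3 M (fun q => f q ^+ 2).
Proof. by apply: eq_I3 => q; rewrite rotz0. Qed.

Lemma sf_avg phi f : continuous phi -> sf f -> sf (avg phi f).
Proof.
move=> cphi [sf0 f0]; split; first exact: smooth_avg.
move=> q nq; rewrite /avg (@eq_sint _ _ _ _ (fun=> 0)).
  by rewrite sint_cst// mul0r.
by move=> t _; rewrite f0 ?mulr0//; exact: shell_rotz.
Qed.

Section Mode.
Variable k : R.
Hypothesis k0 : sin (k * pi) = 0.
Local Notation Mc := (avg (kcos k)).
Local Notation Ms := (avg (ksin k)).
Let cc := @continuous_kcos R k.
Let cs := @continuous_ksin R k.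

(** Along an orbit the two averages solve the linear system given by [dN] and [dN2], so the pair
    turns with angular speed k; [A] and [B] are its first integrals, evaluated at the angles 0 and
    t. *)
Lemma avg_kcos_rot f q t : smooth setT f ->
  Mc f (rotz t q) = kcos k t * Mc f q + ksin k t * Ms f q.
Proof.
move=> s0.
have dN u : is_derive u (1 : R) (fun u => Mc f (rotz u q)) (k * Ms f (rotz u q)).
  apply: is_derive_eq (is_derive_rot_t q u (smooth_avg cc s0)) _.
  by rewrite angular_avg// avg_kcos_angular.
have dN2 u : is_derive u (1 : R) (fun u => Ms f (rotz u q)) (- k * Mc f (rotz u q)).
  apply: is_derive_eq (is_derive_rot_t q u (smooth_avg cs s0)) _.
  by rewrite angular_avg// avg_ksin_angular.
pose A u := kcos k u * Mc f (rotz u q) - ksin k u * Ms f (rotz u q).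
pose B u := ksin k u * Mc f (rotz u q) + kcos k u * Ms f (rotz u q).
have dA u : is_derive u (1 : R) A 0.
  apply: is_derive_eq (is_deriveB (is_deriveM (is_derive_kcos k u) (dN u))
    (is_deriveM (is_derive_ksin k u) (dN2 u))) _.
  by rewrite /GRing.scale /=; move: (kcos k u) (ksin k u) (Mc f _) (Ms f _) => c s x y; ring.
have dB u : is_derive u (1 : R) B 0.
  apply: is_derive_eq (is_deriveD (is_deriveM (is_derive_ksin k u) (dN u))
    (is_deriveM (is_derive_kcos k u) (dN2 u))) _.
  by rewrite /GRing.scale /=; move: (kcos k u) (ksin k u) (Mc f _) (Ms f _) => c s x y; ring.
have k00 : kcos k 0 = 1 by rewrite /kcos mulr0 cos0.
have s00 : ksin k 0 = 0 by rewrite /ksin mulr0 sin0.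
have eA : Mc f q = A t.
  by rewrite -(is_derive_0_is_cst 0 t dA) /A k00 s00 mul1r mul0r subr0 rotz0.
have eB : Ms f q = B t.
  by rewrite -(is_derive_0_is_cst 0 t dB) /B k00 s00 mul1r mul0r add0r rotz0.
rewrite eA eB /A /B.
have := cos2Dsin2 (k * t); rewrite -/(kcos k t) -/(ksin k t).
move: (kcos k t) (ksin k t) (Mc f _) (Ms f _) => c s x y h.
by rewrite -[LHS]mul1r -h; ring.
Qed.

Definition mode_sq f q := Mc f q ^+ 2 + Ms f q ^+ 2.

Lemma sf_mode_sq f : sf f -> sf (mode_sq f).
Proof. by move=> tf; apply: sfD; apply: sf_sqr => //; exact: sf_avg. Qed.

(** By [avg_kcos_rot] the mode square at q is the integral over the orbit of f times its cosine
    average. Rotation invariance replaces the orbit integral by a factor 2 pi, and exchanging the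
    integrals brings out the correlation. *)
Lemma I3_mode_sq f : sf f ->
  I3 M (mode_sq f) = 2 * pi * sint (- pi) pi (fun t => kcos k t * corr f t).
Proof.
move=> tf; have [s0 _] := tf; have cf := sf_cont tf.
have tMc := sf_avg cc tf; have tMs := sf_avg cs tf.
pose F q := f q * Mc f q.
have tF : sf F by exact: (sfM delta0 s0 tMc).
have cF := sf_cont tF.
have e1 q : mode_sq f q = sint (- pi) pi (fun t => F (rotz t q)).
  have c1 : cont_seg (- pi) pi (fun t => kcos k t * f (rotz t q)).
    by move=> t _; apply: continuous_mul => //; exact: continuous_rot_t.
  have c2 : cont_seg (- pi) pi (fun t => ksin k t * f (rotz t q)).
    by move=> t _; apply: continuous_mul => //; exact: continuous_rot_t.
  have c1' : cont_seg (- pi) pi (fun t => Mc f q * (kcos k t * f (rotz t q))).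
    by move=> t ht; apply: cvgM; [exact: cvg_cst|exact: c1].
  have c2' : cont_seg (- pi) pi (fun t => Ms f q * (ksin k t * f (rotz t q))).
    by move=> t ht; apply: cvgM; [exact: cvg_cst|exact: c2].
  transitivity (sint (- pi) pi (fun t => Mc f q * (kcos k t * f (rotz t q)) + Ms f q * (ksin k t * f (rotz t q)))).
    by rewrite (sintD c1' c2') (sintZ _ c1) (sintZ _ c2).
  apply: eq_sint => t _; rewrite /F (avg_kcos_rot _ _ s0).
  by move: (Mc f q) (Ms f q) (kcos k t) (ksin k t) (f _) => a b c s x; ring.
have e2 : I3 M (mode_sq f) = 2 * pi * I3 M F.
  transitivity (sint (- pi) pi (fun t => I3 M (fun q => F (rotz t q)))).
    rewrite (sint_I3 M0 pp (continuous_rotr cF)).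
    by apply: eq_I3 => q; exact: e1.
  transitivity (sint (- pi) pi (fun=> I3 M F)).
    by apply: eq_sint => t _; exact: (I3_rotz delta0 L0 LM t tF).
  by rewrite sint_cst// opprK mulrC -mulr2n -[pi *+ 2]mulr_natl.
rewrite e2; congr (_ * _).
have c3 : continuous (fun x : R * heis => kcos k x.1 * (f (rotz x.1 x.2) * f x.2)).
  apply: continuous_mul; last exact: ccorr.
  by apply: (@continuous_compT _ _ _ (fun x : R * heis => x.1) (kcos k)) => //; cont.
transitivity (I3 M (fun q => sint (- pi) pi (fun t => kcos k t * (f (rotz t q) * f q)))).
  apply: eq_I3 => q; rewrite /F.
  have c1 : cont_seg (- pi) pi (fun t => kcos k t * f (rotz t q)).
    by move=> t _; apply: continuous_mul => //; exact: continuous_rot_t.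
  rewrite -(sintZ _ c1); apply: eq_sint => t _.
  by move: (kcos k t) (f _) (f q) => a b c; ring.
rewrite -(sint_I3 M0 pp c3); apply: eq_sint => t _.
have ct : continuous (fun q => f (rotz t q) * f q).
  by apply: continuous_mul => //; exact: continuous_rot_q.
exact: (I3Z M0 (kcos k t) ct).
Qed.

End Mode.
End Correlation.

(** * Nonnegative cosine coefficients force a nonnegative value at 0 *)

Section Concentration.
Variable R : realType.
Implicit Types (G h : R -> R) (t : R).

Let pp : - pi <= pi :> R. Proof. by rewrite ge0_cp// pi_ge0. Qed.

Lemma sint_split (a b c : R) G : a <= c -> c <= b -> continuous G ->
  sint a b G = sint a c G + sint c b G.
Proof.
move=> ac cb cG.
have iG u v : (@lebesgue_measure R).-integrable `[u, v] (EFin \o G).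
  by apply: cont_seg_int => t _; exact: cG.
rewrite -[LHS](subrK (sint a c G)) addrC; congr (_ + _).
rewrite /sint (Rintegral_itvB (iG a b)) ?bnd_simp//.
rewrite Rintegral_itv_obnd_cbnd//.
by apply: integrableS (iG c b) => //; exact: subset_itv_oc_cc.
Qed.

(* Testing against the kernels (1 + cos t)^n, which have nonnegative Fourier
   coefficients and concentrate at t = 0. *)
Definition posdef G h := continuous h /\
  forall n : nat, 0 <= sint (- pi) pi (fun t => kcos n%:R t * (h t * G t)).

Lemma kcosS (n : nat) t : kcos n.+1%:R t * cos t = 2^-1 * (kcos n.+2%:R t + kcos n%:R t).
Proof.
rewrite /kcos.
have -> : n.+2%:R * t = n.+1%:R * t + t by rewrite -[n.+2%:R]natr1 mulrDl mul1r.
have -> : n%:R * t = n.+1%:R * t - t by rewrite -[n.+1%:R]natr1 mulrDl mul1r addrK.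
by rewrite cosD cosB; field.
Qed.

Lemma posdefM G h : continuous G -> posdef G h -> posdef G (fun t => (1 + cos t) * h t).
Proof.
move=> cG [ch Ph].
have cc : continuous (fun t => 1 + cos t).
  by move=> t; apply: cvgD; [exact: cvg_cst|exact: continuous_cos].
split; first exact: continuous_mul.
have cn (k : R) : cont_seg (- pi) pi (fun t => kcos k t * (h t * G t)).
  by move=> t _; apply: continuous_mul; [exact: continuous_kcos|exact: continuous_mul].
have cZ (k c : R) : cont_seg (- pi) pi (fun t => c * (kcos k t * (h t * G t))).
  by move=> t ht; apply: cvgM; [exact: cvg_cst|exact: cn].
have key (k k1 k2 : R) : (forall t, kcos k t * cos t = 2^-1 * (kcos k1 t + kcos k2 t)) ->
   sint (- pi) pi (fun t => kcos k t * ((1 + cos t) * h t * G t)) =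
   sint (- pi) pi (fun t => kcos k t * (h t * G t)) +
   (2^-1 * sint (- pi) pi (fun t => kcos k1 t * (h t * G t)) +
    2^-1 * sint (- pi) pi (fun t => kcos k2 t * (h t * G t))).
  move=> E; rewrite -(sintZ _ (cn k1)) -(sintZ _ (cn k2)) -(sintD (cZ k1 _) (cZ k2 _)).
  have cS : cont_seg (- pi) pi (fun t => 2^-1 * (kcos k1 t * (h t * G t)) + 2^-1 * (kcos k2 t * (h t * G t))).
    by move=> t ht; apply: cvgD; exact: cZ.
  rewrite -(sintD (cn k) cS); apply: eq_sint => t _.
  have := E t; move: (kcos k t) (kcos k1 t) (kcos k2 t) (cos t) (h t) (G t) => a a1 a2 c x y e.
  have -> : a * ((1 + c) * x * y) = a * (x * y) + (a * c) * (x * y) by ring.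
  by rewrite e; ring.
case=> [|n].
  (* For n = 0 the lower neighbouring frequency would be -1, which is not a natural number; evenness
     of the cosine replaces it by 1. *)
  rewrite (key _ 1 1); last first.
    by move=> t; rewrite /kcos mul0r cos0 !mul1r; field.
  by have := Ph 1%N; rewrite mulr1n => h1; rewrite !addr_ge0 ?mulr_ge0 ?invr_ge0.
rewrite (key _ n.+2%:R n%:R); last by move=> t; exact: kcosS.
by rewrite !addr_ge0 ?mulr_ge0 ?invr_ge0.
Qed.

Lemma posdef_kernel G (n : nat) : continuous G ->
  (forall n : nat, 0 <= sint (- pi) pi (fun t => kcos n%:R t * G t)) ->
  0 <= sint (- pi) pi (fun t => (1 + cos t) ^+ n * G t).
Proof.
move=> cG PG.
have : posdef G (fun t => (1 + cos t) ^+ n).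
  elim: n => [|n IH].
    split=> [t|n]; first exact: cvg_cst.
    have := PG n; congr (_ <= _); apply: eq_sint => t _.
    by rewrite expr0 mul1r.
  rewrite (_ : (fun t => _) = fun t => (1 + cos t) * (1 + cos t) ^+ n); last first.
    by apply/funext => t; rewrite exprS.
  exact: posdefM.
case=> _ /(_ 0%N); congr (_ <= _); apply: eq_sint => t _.
by rewrite /kcos mul0r cos0 mul1r.
Qed.

Lemma nonneg_at0 G : continuous G ->
  (forall n : nat, 0 <= sint (- pi) pi (fun t => kcos n%:R t * G t)) -> 0 <= G 0.
Proof.
move=> cG PG; rewrite leNgt; apply/negP => G0.
pose g0 : R := - G 0 / 2; have g00 : 0 < g0 by rewrite divr_gt0// oppr_gt0.
have [e [e0 epi eG]] : exists e : R, [/\ 0 < e, e <= pi & forall t, `|t| <= e -> G t <= - g0].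
  have /cvgrPdist_le /(_ g0 g00) := cG 0.
  move=> /nbhs_ballP[e /= e0 he].
  exists (Num.min (e / 2) pi); split.
  - by rewrite lt_min divr_gt0//= pi_gt0.
  - by rewrite ge_min lexx orbT.
  - move=> t; rewrite le_min => /andP[te _].
    have /he : ball 0 e t.
      rewrite -ball_normE /= sub0r normrN (le_lt_trans te)//.
      by rewrite ltr_pdivrMr// ltr_pMr// ltr1n.
    have h2 : G 0 = - g0 - g0 by rewrite /g0; field.
    rewrite /= ler_norml => /andP[h1 _]; move: h1; rewrite h2 lerBrDr.
    by rewrite addrC -lerBrDr => /le_trans; apply; rewrite opprK addrNK.
have [c cab Gc] := EVT_max pp (continuous_subspaceT cG).
pose B : R := `|G c|.
have B0 : 0 <= B by exact: normr_ge0.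
have GB t : t \in `[- pi, pi] -> G t <= B.
  by move=> /Gc /le_trans; apply; exact: ler_norm.
have e2 : e / 2 < e by rewrite ltr_pdivrMr// ltr_pMr// ltr1n.
have e20 : 0 < e / 2 by rewrite divr_gt0.
have e2pi : e / 2 <= pi by rewrite (le_trans (ltW e2)).
have cosn t : cos t = cos `|t|.
  by have [|] := leP 0 t => [/ger0_norm|/ltr0_norm] ->; rewrite ?cosN.
have cosle u t : 0 <= u -> u <= `|t| -> `|t| <= pi -> cos t <= cos u.
  move=> u0 ut tpi; rewrite cosn; move: ut; rewrite le_eqVlt => /predU1P[->//|ut].
  by rewrite ltW// ltr_cos// in_itv /= ?u0 ?normr_ge0//= (le_trans (ltW ut)).
(* [al] is the least value of 1 + cos t for |t| <= e/2, and [be] the greatest for e <= |t| <= pi; as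
   be < al, their powers separate geometrically. *)
pose al : R := 1 + cos (e / 2). pose be : R := 1 + cos e.
have be0 : 0 <= be by rewrite -lerBlDl sub0r cos_geN1.
have beal : be < al.
  by rewrite ltrD2l ltr_cos// in_itv /= ?(ltW e0) ?(ltW e20).
have al0 : 0 < al by exact: le_lt_trans be0 beal.
have k0 t : 0 <= 1 + cos t by rewrite -lerBlDl sub0r cos_geN1.
(* The integral far from 0 is at most 2 pi B be^n, the integral near 0 at most - g0 e al^n; for this
   n the second one prevails. *)
have [n hn] : exists n, 2 * pi * B * be ^+ n < g0 * e * al ^+ n.
  have zlt : `|be / al| < 1.
    by rewrite ger0_norm ?divr_ge0 ?(ltW al0)// ltr_pdivrMr// mul1r.
  have D0 : 0 < 2 * pi * B + 1.
    by apply: ltr_wpDl => //; apply: mulr_ge0 => //; apply: mulr_ge0 (pi_ge0 R).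
  have t0 : 0 < g0 * e / (2 * pi * B + 1).
    by apply: divr_gt0; [exact: mulr_gt0|exact: D0].
  have /cvgrPdist_lt /(_ _ t0) [n _ /(_ n (leqnn n))] := cvg_expr zlt.
  rewrite /= sub0r normrN ger0_norm ?exprn_ge0 ?divr_ge0 ?(ltW al0)//.
  rewrite ltr_pdivlMr// => h; exists n.
  have aln : 0 < al ^+ n by rewrite exprn_gt0.
  have E : (be / al) ^+ n * al ^+ n = be ^+ n by rewrite -exprMn divfK ?gt_eqF.
  rewrite -E mulrA ltr_pM2r//.
  apply: le_lt_trans h; rewrite mulrC ler_wpM2l ?exprn_ge0 ?divr_ge0 ?(ltW al0)//.
  by rewrite lerDl.
have := posdef_kernel n cG PG; apply/negP; rewrite -ltNge.
pose H t := (1 + cos t) ^+ n * G t.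
have cH : continuous H.
  have c1 : continuous (fun t => (1 + cos t) ^+ n).
    elim: (n) => [|m IH]; first by move=> t; exact: cvg_cst.
    rewrite (_ : (fun t => _) = fun t => (1 + cos t) * (1 + cos t) ^+ m); last first.
      by apply/funext => t; rewrite exprS.
    apply: continuous_mul => // t.
    by apply: cvgD; [exact: cvg_cst|exact: continuous_cos].
  exact: continuous_mul.
have le1 : - pi <= - (e / 2) by rewrite lerN2.
have le2 : - (e / 2) <= pi by rewrite (le_trans _ (pi_ge0 R))// oppr_le0 ltW.
have le3 : - (e / 2) <= e / 2 by rewrite ge0_cp// ltW.
have Bb : 0 <= B * be ^+ n by apply: mulr_ge0 => //; exact: exprn_ge0.
(* For |t| between e/2 and e the function [G] is still negative, so this zone can be counted with
   the far one; it is the gap that keeps [be] below [al]. *)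
have outer t : e / 2 <= `|t| -> `|t| <= pi -> H t <= B * be ^+ n.
  move=> et tpi; rewrite /H.
  have [te|/ltW te] := leP `|t| e.
    apply: le_trans Bb; rewrite mulr_ge0_le0 ?exprn_ge0//.
    by rewrite (le_trans (eG _ te))// oppr_le0 ltW.
  apply: (@le_trans _ _ ((1 + cos t) ^+ n * B)).
    by rewrite ler_wpM2l ?exprn_ge0// GB// in_itv /= -ler_norml.
  rewrite mulrC ler_wpM2l//; apply: lerXn2r; rewrite ?nnegrE// lerD2l.
  exact: cosle (ltW e0) te tpi.
have inner t : `|t| <= e / 2 -> H t <= - g0 * al ^+ n.
  move=> te; rewrite /H mulrC.
  apply: (@le_trans _ _ (- g0 * (1 + cos t) ^+ n)).
    by rewrite ler_wpM2r ?exprn_ge0// eG// (le_trans te)// ltW.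
  rewrite ler_wnM2l ?oppr_le0 ?(ltW g00)//; apply: lerXn2r; rewrite ?nnegrE ?(ltW al0)// lerD2l.
  rewrite -{1}(ger0_norm (ltW e20)) -cosn (cosn t).
  move: te; rewrite le_eqVlt => /predU1P[->//|te].
  by rewrite ltW// ltr_cos// in_itv /= ?normr_ge0 ?(ltW e20)//= (le_trans (ltW te)).
have upper u v k : u <= v -> (forall t, t \in `[u, v] -> H t <= k) -> sint u v H <= k * (v - u).
  move=> uv hk; rewrite -sint_cst//; apply: le_sint => //.
  - by move=> t _; exact: cH.
  - by move=> t _; exact: cvg_cst.
rewrite -/H (sint_split le1 le2 cH) (sint_split le3 e2pi cH).
have i1 : sint (- pi) (- (e / 2)) H <= B * be ^+ n * (- (e / 2) - - pi).
  apply: upper => // t; rewrite in_itv /= => /andP[t1 t2].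
  have tn : t <= 0 by rewrite (le_trans t2)// oppr_le0 ltW.
  by apply: outer; rewrite (ler0_norm tn); [rewrite lerNr|rewrite lerNl].
have i2 : sint (- (e / 2)) (e / 2) H <= - g0 * al ^+ n * (e / 2 - - (e / 2)).
  by apply: upper => // t; rewrite in_itv /= -ler_norml => /inner.
have i3 : sint (e / 2) pi H <= B * be ^+ n * (pi - e / 2).
  apply: upper => // t; rewrite in_itv /= => /andP[t1 t2].
  have tn : 0 <= t by rewrite (le_trans _ t1)// ltW.
  by apply: outer; rewrite (ger0_norm tn).
apply: le_lt_trans (lerD i1 (lerD i2 i3)) _.
apply: (@le_lt_trans _ _ (2 * pi * B * be ^+ n - g0 * e * al ^+ n)); last by rewrite subr_lt0.
rewrite -subr_ge0.
rewrite [X in 0 <= X](_ : _ = B * be ^+ n * e); last by field.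
by rewrite mulr_ge0// ltW.
Qed.

End Concentration.

(** * The inequality for w, summed over the modes *)

Section HardyCore.
Variable R : realType.
Local Notation heis := (heis R).
Local Notation ex := (e_x R).
Local Notation ey := (e_y R).
Local Notation ez := (e_z R).
Variables delta L M : R.
Hypotheses (delta0 : 0 < delta) (L0 : 0 <= L) (LM : L < M).
Local Notation sf := (shell_fun delta L).
Implicit Types (f g p s : heis -> R) (q v : heis) (phi : R -> R).

Let M0 : 0 <= M. Proof. exact: le_trans L0 (ltW LM). Qed.
Let sr := smooth_rad2 (openT : open [set: heis]).

Lemma continuous_add (T : topologicalType) (a b : T -> R) :
  continuous a -> continuous b -> continuous (fun x => a x + b x).
Proof. by move=> ca cb x; apply: cvgD; [exact: ca|exact: cb]. Qed.

Lemma derive_lin f g c q v : smooth setT f -> smooth setT g ->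
  'D_v (fun q => f q + c * g q) q = 'D_v f q + c * 'D_v g q.
Proof.
move=> s1 s2; have sc := smooth_cst c (openT : open [set: heis]).
rewrite (deriveD_smooth q v s1 (smoothM openT sc s2)) (deriveM_smooth q v sc s2).
by rewrite (_ : 'D_v (fun=> c) q = 0) ?mulr0 ?addr0//; have [_ ->] := is_derive_cst c q v.
Qed.

Definition dilation f q := euler f q + f q.
(** [twist alpha f g] and [twist (- alpha) g f] are the real and imaginary parts of (V + i alpha +
    (r^2/2) d_z)(f + i g). *)
Definition twist alpha f g q := angular f q + - alpha * g q + rad2 q / 2 * 'D_ez f q.

Lemma sf_dilation f : sf f -> sf (dilation f).
Proof. by move=> tf; apply: sfD => //; exact: sf_euler. Qed.

Lemma sf_twist alpha f g : sf f -> sf g -> sf (twist alpha f g).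
Proof.
move=> tf tg.
have h : smooth setT (fun q : heis => rad2 q / 2).
  by apply: (smoothM openT sr); exact: smooth_cst openT.
apply: sfD; last exact: (sfM delta0 h (sf_dz tf)).
by apply: sfD; [exact: sf_angular|exact: sfZ].
Qed.

Let sx := smooth_cx (openT : open [set: heis]).
Let sy := smooth_cy (openT : open [set: heis]).

Lemma continuous_euler f : smooth setT f -> continuous (euler f).
Proof.
move=> s0; apply: smoothT_continuous; apply: (smoothD openT).
  exact: (smoothM openT sx (smooth_dx s0)).
exact: (smoothM openT sy (smooth_dy s0)).
Qed.

Lemma continuous_angular f : smooth setT f -> continuous (angular f).
Proof.
move=> s0 q; apply: cvgB; apply: smoothT_continuous.
  exact: (smoothM openT sx (smooth_dy s0)).
exact: (smoothM openT sy (smooth_dx s0)).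
Qed.

Lemma avg_dilation phi f q : continuous phi -> smooth setT f ->
  avg phi (dilation f) q = dilation (avg phi f) q.
Proof.
move=> cphi s0; rewrite /dilation euler_avg// avgD//; first exact: continuous_euler.
exact: smoothT_continuous.
Qed.

Lemma avg_twist alpha phi f g q : continuous phi -> smooth setT f -> smooth setT g ->
  avg phi (twist alpha f g) q =
  avg phi (angular f) q + - alpha * avg phi g q + rad2 q / 2 * avg phi ('D_ez f) q.
Proof.
move=> cphi s0 s1.
have c1 := continuous_angular s0; have c2 := smoothT_continuous s1.
have c3 := smoothT_continuous (smooth_dz s0).
have c4 : continuous (fun q => - alpha * g q).
  by apply: continuous_mul => // ?; exact: cvg_cst.
have c5 : continuous (fun q => angular f q + - alpha * g q).
  by move=> x; apply: cvgD; [exact: c1|exact: c4].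
have c6 : continuous (fun q => rad2 q / 2 * 'D_ez f q).
  apply: continuous_mul => //; apply: continuous_mul; first exact: continuous_rad2.
  by move=> ?; exact: cvg_cst.
rewrite /twist (avgD q cphi c5 c6) (avgD q cphi c1 c4) (avgZ _ _ cphi c2).
congr (_ + _); apply: (@avg_radial R phi (fun q => rad2 q / 2)) => // t.
by rewrite rad2_rotz.
Qed.

Section Mode.
Variables (k alpha : R) (p s : heis -> R).
Hypotheses (k0 : sin (k * pi) = 0) (tp : sf p) (ts : sf s).
Let sp : smooth setT p. Proof. by case: tp. Qed.
Let ss : smooth setT s. Proof. by case: ts. Qed.
Let Mc := avg (kcos k).
Let Ms := avg (ksin k).
Let cc := @continuous_kcos R k.
Let cs := @continuous_ksin R k.

(* The modes k and -k (e = 1 and e = -1) are treated together: only the sum of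
   their energies is a Fourier cosine coefficient of a correlation. *)
Lemma mode_density_avg (e : R) q : e ^+ 2 = 1 ->
  mode_density (e * k + alpha) (fun q => Mc p q + e * Ms s q) (fun q => Mc s q + - e * Ms p q) q =
  (Mc (dilation p) q + e * Ms (dilation s) q) ^+ 2 + (Mc (dilation s) q - e * Ms (dilation p) q) ^+ 2
  + (Mc (twist alpha p s) q + e * Ms (twist (- alpha) s p) q) ^+ 2
  + (Mc (twist (- alpha) s p) q - e * Ms (twist alpha p s) q) ^+ 2.
Proof.
move=> e2; rewrite /mode_density.
have eL f g c : smooth setT f -> smooth setT g ->
    euler (fun q => f q + c * g q) q = euler f q + c * euler g q.
  move=> s0 s1; rewrite /euler !derive_lin//.
  by move: ('D_ex f q) ('D_ey f q) ('D_ex g q) ('D_ey g q) => *; ring.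
rewrite /Mc /Ms.
have scp := smooth_avg cc sp; have scs := smooth_avg cc ss.
have ssp := smooth_avg cs sp; have sss := smooth_avg cs ss.
rewrite (eL _ _ _ scp sss) (eL _ _ _ scs ssp).
rewrite (derive_lin _ _ _ scp sss) (derive_lin _ _ _ scs ssp).
rewrite (avg_dilation q cc sp) (avg_dilation q cs sp) (avg_dilation q cc ss) (avg_dilation q cs ss).
rewrite !(avg_twist _ _ cc)// !(avg_twist _ _ cs)//.
rewrite !avg_kcos_angular// !avg_ksin_angular// !avg_dz// /dilation.
move: (euler _ q) (euler _ q) (euler _ q) (euler _ q) => a1 a2 a3 a4.
move: (avg _ _ _) (avg _ _ _) (avg _ _ _) (avg _ _ _) (avg _ _ _) (avg _ _ _) (avg _ _ _) (avg _ _ _) => b1 b2 b3 b4 b5 b6 b7 b8.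
have sq (x y : R) : x = y -> x ^+ 2 = y ^+ 2 by move=> ->.
have /orP[/eqP ->|/eqP ->] : (e == 1) || (e == -1) by rewrite -sqrf_eq1 e2.
  by congr (_ + _ + _ + _); apply: sq; ring.
by congr (_ + _ + _ + _); apply: sq; ring.
Qed.

Variable d : R.
Hypothesis d_le : forall e, e ^+ 2 = 1 -> d ^+ 2 <= (e * k + alpha) ^+ 2 /\
  (`|e * k + alpha| <= 1 \/ 1 + d ^+ 2 <= 2 * `|e * k + alpha|).

(** The excess energy with an arbitrary functional in place of the squared norm. It is used with the
    mode square at a point, its integral, the correlation at t and cosine coefficients, which all
    obey the same linear bookkeeping. *)
Definition hardy_sum (F : (heis -> R) -> R) :=
  F (dilation p) + F (dilation s) + F (twist alpha p s) + F (twist (- alpha) s p)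
  + - d ^+ 2 * (F p + F s).

Let ta1 := sf_dilation tp.
Let ta2 := sf_dilation ts.
Let tb1 := sf_twist alpha tp ts.
Let tb2 := sf_twist (- alpha) ts tp.

Let hardy_sum_ext F F' : (forall f, sf f -> F f = F' f) -> hardy_sum F = hardy_sum F'.
Proof.
by move=> FF'; rewrite /hardy_sum (FF' _ ta1) (FF' _ ta2) (FF' _ tb1) (FF' _ tb2) (FF' _ tp) (FF' _ ts).
Qed.

Let hardy_sumZ c F : hardy_sum (fun f => c * F f) = c * hardy_sum F.
Proof.
rewrite /hardy_sum.
by move: (F p) (F s) (F (dilation p)) (F (dilation s)) (F (twist _ p s)) (F (twist _ s p)) => *; ring.
Qed.

Let I3_six (F : (heis -> R) -> heis -> R) : (forall f, sf f -> continuous (F f)) ->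
  I3 M (fun q => hardy_sum (F ^~ q)) = hardy_sum (fun f => I3 M (F f)).
Proof.
move=> cF.
have c1 := cF _ ta1; have c2 := cF _ ta2; have c3 := cF _ tb1; have c4 := cF _ tb2.
have c56 := continuous_add (cF _ tp) (cF _ ts).
have c12 := continuous_add c1 c2; have c123 := continuous_add c12 c3.
rewrite /hardy_sum (I3D M0 (continuous_add c123 c4)); last first.
  by apply: continuous_mul => // ?; exact: cvg_cst.
by rewrite (I3D M0 c123 c4) (I3D M0 c12 c3) (I3D M0 c1 c2) (I3Z M0 _ c56) (I3D M0 (cF _ tp) (cF _ ts)).
Qed.

Let sint_six (F : (heis -> R) -> R -> R) : (forall f, sf f -> continuous (F f)) ->
  sint (- pi) pi (fun t => hardy_sum (F ^~ t)) = hardy_sum (fun f => sint (- pi) pi (F f)).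
Proof.
move=> cF.
have c1 := cF _ ta1; have c2 := cF _ ta2; have c3 := cF _ tb1; have c4 := cF _ tb2.
have c56 := continuous_add (cF _ tp) (cF _ ts).
have c12 := continuous_add c1 c2; have c123 := continuous_add c12 c3.
have cg (f : R -> R) : continuous f -> cont_seg (- pi) pi f by move=> cf t _; exact: cf.
have c7 : continuous (fun t => - d ^+ 2 * (F p t + F s t)).
  by apply: continuous_mul => // ?; exact: cvg_cst.
rewrite /hardy_sum (sintD (cg _ (continuous_add c123 c4)) (cg _ c7)) (sintD (cg _ c123) (cg _ c4)).
rewrite (sintD (cg _ c12) (cg _ c3)) (sintD (cg _ c1) (cg _ c2)).
by rewrite (sintZ _ (cg _ c56)) (sintD (cg _ (cF _ tp)) (cg _ (cF _ ts))).
Qed.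

Lemma mode_pair_ge0 : 0 <= sint (- pi) pi (fun t => kcos k t * hardy_sum (corr M ^~ t)).
Proof.
have h : 0 <= 2 * I3 M (fun q => hardy_sum (mode_sq k ^~ q)).
  (* P e + i S e is the integral of e^(-i e k t) times p + i s along the orbit, that is the mode of
     frequency e k for e = 1 and e = -1. *)
  pose P e q := Mc p q + e * Ms s q; pose S e q := Mc s q + - e * Ms p q.
  have tP e : sf (P e) by apply: sfD; [|apply: (sfZ delta0)]; exact: sf_avg.
  have tS e : sf (S e) by apply: sfD; [|apply: (sfZ delta0)]; exact: sf_avg.
  pose D e q := mode_density (e * k + alpha) (P e) (S e) q - d ^+ 2 * (P e q ^+ 2 + S e q ^+ 2).
  have D0 e : e ^+ 2 = 1 -> 0 <= I3 M (D e).
    by move=> /d_le[h1 h2]; exact: (mode_inequality delta0 L0 LM (tP e) (tS e) h1 h2).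
  have cD e : continuous (D e).
    apply: (@sf_cont R delta L); apply: sfB => //; first exact: sf_mode_density.
    by apply: (sfZ delta0); apply: sfD; exact: sf_sqr.
  have csix : continuous (fun q => hardy_sum (mode_sq k ^~ q)).
    have cm f : sf f -> continuous (mode_sq k f) by move=> tf; apply: (@sf_cont R delta L); exact: sf_mode_sq.
    apply: continuous_add; last first.
      apply: continuous_mul; first by move=> ?; exact: cvg_cst.
      exact: (continuous_add (cm _ tp) (cm _ ts)).
    exact: (continuous_add (continuous_add (continuous_add (cm _ ta1) (cm _ ta2)) (cm _ tb1)) (cm _ tb2)).
  rewrite -(I3Z M0 _ csix) (@eq_I3 _ _ _ (fun q => D 1 q + D (-1) q)).
    by rewrite (I3D M0 (cD 1) (cD (-1))) addr_ge0// D0// ?sqrrN expr1n.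
  move=> q; rewrite /D /P /S !mode_density_avg ?sqrrN ?expr1n// /hardy_sum /mode_sq -/Mc -/Ms.
  move: (Mc (dilation p) q) (Mc (dilation s) q) (Ms (dilation p) q) (Ms (dilation s) q).
  move: (Mc (twist _ p s) q) (Mc (twist _ s p) q) (Ms (twist _ p s) q) (Ms (twist _ s p) q).
  by move: (Mc p q) (Mc s q) (Ms p q) (Ms s q) => *; ring.
have h2 : 0 <= hardy_sum (fun f => I3 M (mode_sq k f)).
  rewrite -(I3_six (F := mode_sq k)); first by move: h; rewrite pmulr_rge0.
  by move=> f tf; apply: (@sf_cont R delta L); exact: sf_mode_sq.
pose J f := sint (- pi) pi (fun t => kcos k t * corr M f t).
have E : hardy_sum (fun f => I3 M (mode_sq k f)) = 2 * pi * hardy_sum J.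
  apply: etrans (hardy_sumZ _ _); apply: hardy_sum_ext.
  exact: (@I3_mode_sq R delta L M delta0 L0 LM k k0).
have p0 : 0 < 2 * pi :> R by rewrite mulr_gt0// pi_gt0.
have h3 : 0 <= hardy_sum J.
  by move: h2; rewrite E; move: (hardy_sum J) => a; rewrite (pmulr_rge0 _ p0).
apply: (le_trans h3); rewrite le_eqVlt; apply/orP; left; apply/eqP; apply: esym.
transitivity (sint (- pi) pi (fun t => hardy_sum (fun f => kcos k t * corr M f t))).
  by apply: eq_sint => t _; apply: esym; exact: hardy_sumZ.
apply: (sint_six (F := fun f t => kcos k t * corr M f t)) => f tf.
by apply: continuous_mul => //; apply: (continuous_corr L0 LM); exact: (sf_cont tf).
Qed.
End Mode.

Lemma shell_hardy (alpha d : R) p s : sf p -> sf s ->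
  (forall k : int, d ^+ 2 <= (k%:~R + alpha) ^+ 2 /\
    (`|k%:~R + alpha| <= 1 \/ 1 + d ^+ 2 <= 2 * `|k%:~R + alpha|)) ->
  0 <= I3 M (fun q => dilation p q ^+ 2 + dilation s q ^+ 2 + twist alpha p s q ^+ 2
    + twist (- alpha) s p q ^+ 2 + - d ^+ 2 * (p q ^+ 2 + s q ^+ 2)).
Proof.
move=> tp ts hd.
have ta1 := sf_dilation tp; have ta2 := sf_dilation ts.
have tb1 := sf_twist alpha tp ts; have tb2 := sf_twist (- alpha) ts tp.
pose G t := corr M (dilation p) t + corr M (dilation s) t + corr M (twist alpha p s) t
  + corr M (twist (- alpha) s p) t + - d ^+ 2 * (corr M p t + corr M s t).
have cc f : sf f -> continuous (corr M f) by move=> tf; apply: (continuous_corr L0 LM); exact: (sf_cont tf).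
have cG : continuous G.
  apply: continuous_add; last first.
    apply: continuous_mul; first by move=> ?; exact: cvg_cst.
    exact: (continuous_add (cc _ tp) (cc _ ts)).
  exact: (continuous_add (continuous_add (continuous_add (cc _ ta1) (cc _ ta2)) (cc _ tb1)) (cc _ tb2)).
(* [G] is the excess with correlations in place of squared norms: its value at 0 is the excess
   itself, and its n-th cosine coefficient involves exactly the modes n and -n. *)
have : 0 <= G 0.
  apply: nonneg_at0 => // n; apply: mode_pair_ge0 => //.
    elim: n => [|n IH]; first by rewrite mul0r sin0.
    by rewrite -natr1 mulrDl mul1r sinDpi IH oppr0.
  move=> e; move/eqP; rewrite sqrf_eq1 => /orP[/eqP ->|/eqP ->].
    by have := hd n; rewrite mul1r.
  by have := hd (- n%:Z); rewrite mulN1r mulrNz.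
rewrite /G !corr0; congr (_ <= _).
have cS f : sf f -> continuous (fun q => f q ^+ 2).
  by move=> tf; apply: (@sf_cont R delta L); exact: sf_sqr.
have c12 := continuous_add (cS _ ta1) (cS _ ta2); have c123 := continuous_add c12 (cS _ tb1).
have c56 := continuous_add (cS _ tp) (cS _ ts).
have c7 : continuous (fun q => - d ^+ 2 * (p q ^+ 2 + s q ^+ 2)).
  by apply: continuous_mul => // ?; exact: cvg_cst.
rewrite (I3D M0 (continuous_add c123 (cS _ tb2)) c7) (I3D M0 c123 (cS _ tb2)) (I3D M0 c12 (cS _ tb1)).
by rewrite (I3D M0 (cS _ ta1) (cS _ ta2)) (I3Z M0 _ c56) (I3D M0 (cS _ tp) (cS _ ts)).
Qed.
End HardyCore.

(** * From w back to test functions *)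

Section HardyTest.
Variable R : realType.
Local Notation heis := (heis R).
Local Notation U := (@heis_off_axis R).
Local Notation ex := (e_x R).
Local Notation ey := (e_y R).
Local Notation ez := (e_z R).
Local Notation rad := (@Defs.rad R).
Implicit Types (f g P S : heis -> R) (q v : heis).

Lemma dist_int_ge0 (a : R) : 0 <= dist_int a.
Proof. by apply: lb_le_inf; [exists `|a - 0%:~R|, 0|move=> _ [k _ <-]]. Qed.

Lemma dist_int_le (a : R) (k : int) : dist_int a <= `|a - k%:~R|.
Proof.
by apply: ge_inf; [exists 0 => _ [j _ <-]|exists k].
Qed.

Lemma dist_int_le1 (a : R) : dist_int a <= 1.
Proof.
apply: le_trans (dist_int_le a (Num.floor a)) _.
rewrite ger0_norm ?subr_ge0 ?floor_le// lerBlDl ltW//.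
by have := floorD1_gt a; rewrite intrD.
Qed.

(** The distance is at most 1, so for |k + a| > 1 one has 1 + d^2 <= 2 <= 2 |k + a|: every frequency
    falls under one of the two cases of [mode_inequality]. *)
Lemma dist_int_modes (a : R) (k : int) :
  dist_int a ^+ 2 <= (k%:~R + a) ^+ 2 /\
  (`|k%:~R + a| <= 1 \/ 1 + dist_int a ^+ 2 <= 2 * `|k%:~R + a|).
Proof.
have d0 := dist_int_ge0 a; have d1 := dist_int_le1 a.
split.
  have := dist_int_le a (- k); rewrite mulrNz opprK addrC => h.
  by rewrite -(real_normK (num_real (k%:~R + a))) lerXn2r// ?nnegrE.
have [|/ltW h] := leP `|k%:~R + a| 1; [by left|right].
apply: (@le_trans _ _ 2); last by rewrite ler_peMr.
have : dist_int a ^+ 2 <= 1 ^+ 2 by rewrite lerXn2r ?nnegrE.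
by rewrite expr1n -(lerD2l 1).
Qed.

Definition inv_sqrt_family (phi : R -> R) := exists c n, phi = fun x => c * (Num.sqrt x)^-1 ^+ n.

Lemma inv_sqrt_family_closed : derive_closed [set x : R | 0 < x] inv_sqrt_family.
Proof.
move=> _ [c [n ->]]; exists (fun x => (- (c * n%:R) / 2) * (Num.sqrt x)^-1 ^+ n.+2).
  by exists (- (c * n%:R) / 2), n.+2.
move=> x /= x0.
have s0 : Num.sqrt x != 0 by rewrite sqrtr_eq0 -ltNge.
have ds := is_derive1_sqrt x0.
have di := is_derive_inv s0.
have dp : is_derive ((Num.sqrt x)^-1) (1 : R) (fun y : R => c * y ^+ n) (c * (n%:R * (Num.sqrt x)^-1 ^+ n.-1)).
  apply: is_derive_eq (is_deriveM (is_derive_cst c _ _) (is_derive_pow n _)) _.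
  by rewrite /GRing.scale /= mulr0 addr0.
have dip := is_derive1_comp dp di.
apply: is_derive_eq (is_derive1_comp dip ds) _.
case: n dp dip => [|n] dp dip; first by rewrite !(mul0r, mulr0) oppr0 !mul0r.
have zn := expf_neq0 n s0; rewrite /= !exprVn !exprS expr0.
move: (Num.sqrt x) s0 zn => y y0; move: (y ^+ n) => z z0.
by field; rewrite y0 z0.
Qed.

Definition invrad q := (Num.sqrt (rad2 q))^-1.

Lemma smooth_invrad : smooth U invrad.
Proof.
have oU := @open_off_axis R.
apply: (smooth_comp (phi := fun x => (Num.sqrt x)^-1) oU inv_sqrt_family_closed _ (smooth_rad2 oU)).
  by exists 1, 1%N; apply/funext => x; rewrite mul1r.
by move=> q; exact: rad2_gt0.
Qed.

Lemma sqr_invrad q : invrad q ^+ 2 = (rad2 q)^-1.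
Proof. by rewrite /invrad exprVn sqr_sqrtr// addr_ge0 ?sqr_ge0. Qed.

Lemma is_derive_invrad q v : U q ->
  is_derive q v invrad (- invrad q ^+ 3 * (cx q * cx v + cy q * cy v)).
Proof.
move=> Uq; have r0 := rad2_gt0 Uq.
have s0 : Num.sqrt (rad2 q) != 0 by rewrite sqrtr_eq0 -ltNge.
have d1 := is_derive1_comp (is_derive_inv s0) (is_derive1_sqrt r0).
have d2 := is_deriveD (is_deriveM (is_derive_cx q v) (is_derive_cx q v))
  (is_deriveM (is_derive_cy q v) (is_derive_cy q v)).
apply: is_derive_eq (is_derive_comp1 d2 d1) _.
rewrite /GRing.scale /= /invrad; move: (Num.sqrt _) s0 => y y0.
by field.
Qed.

Lemma derive_invradM P q v : smooth setT P -> U q ->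
  'D_v (fun q => invrad q * P q) q =
  invrad q * 'D_v P q - invrad q ^+ 3 * (cx q * cx v + cy q * cy v) * P q.
Proof.
move=> sP Uq.
have [_ ->] := is_deriveM (is_derive_invrad v Uq) (smoothT_derivable q v sP).
by rewrite /GRing.scale /=; move: (invrad q) ('D_v P q) (P q) => a b c; ring.
Qed.

(** The function 1/r is homogeneous of degree -1, hence annihilated by E + 1; this turns the shifted
    operator on w = u / r into E on u. *)
Lemma dilation_invradM P q : smooth setT P -> U q ->
  dilation (fun q => invrad q * P q) q = invrad q * euler P q.
Proof.
move=> sP Uq; rewrite /dilation /euler !derive_invradM//.
have h : invrad q ^+ 2 * (cx q ^+ 2 + cy q ^+ 2) = 1.
  by rewrite sqr_invrad -/(rad2 q) mulVf ?gt_eqF ?rad2_gt0.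
rewrite /cx /cy /=; move: h; rewrite /cx /cy.
move: (invrad q) ('D_ex P q) ('D_ey P q) (P q) (q.1.1) (q.1.2) => a b c d x y h.
have -> : a * d = a * d * (a ^+ 2 * (x ^+ 2 + y ^+ 2)) by rewrite h mulr1.
by ring.
Qed.

Lemma twist_invradM alpha P S q : smooth setT P -> smooth setT S -> U q ->
  twist alpha (fun q => invrad q * P q) (fun q => invrad q * S q) q =
  invrad q * (angular P q - alpha * S q + rad2 q / 2 * 'D_ez P q).
Proof.
move=> sP sS Uq; rewrite /twist /angular !derive_invradM//.
rewrite /cx /cy /=; move: (invrad q) ('D_ex P q) ('D_ey P q) ('D_ez P q) (P q) (S q) (q.1.1) (q.1.2) (rad2 q) => *.
by ring.
Qed.

(** The continuous functions 1/r^2, r^2 and z are bounded on [K]. *)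
Lemma compact_shell (K : set heis) : compact K -> K `<=` U ->
  exists delta L : R, [/\ 0 < delta, 0 <= L & K `<=` shell delta L].
Proof.
move=> cK KU.
have bd f : (forall q, K q -> {for q, continuous f}) -> exists2 B : R, 0 < B & forall q, K q -> `|f q| <= B.
  move=> cf; have cfK : compact (f @` K).
    apply: continuous_compact cK; apply: continuous_in_subspaceT => q.
    by rewrite inE; exact: cf.
  have [B [_ hB]] := compact_bounded cfK.
  exists (`|B| + 1) => [|q Kq]; first by rewrite ltr_wpDl.
  by apply: hB; [rewrite ltr_pwDr// ler_norm|exists q].
have [B1 B10 h1] : exists2 B : R, 0 < B & forall q, K q -> `|(rad2 q)^-1| <= B.
  apply: bd => q /KU Uq; apply: cvgV; last exact: continuous_rad2.
  by rewrite gt_eqF// rad2_gt0.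
have [B2 B20 h2] := bd (@rad2 R) (fun q _ => @continuous_rad2 R q).
have [B3 B30 h3] := bd (@cz R) (fun q _ => @continuous_cz R q).
have l1 : 1 <= B2 + 1 + B3 by rewrite addrAC lerDr addr_ge0// ltW.
(* The summand 1 makes this L at least 1, so that r^2 <= B2 <= L <= L^2. *)
exists B1^-1, (B2 + 1 + B3); split.
- by rewrite invr_gt0.
- exact: le_trans l1.
- move=> q Kq; have r0 := rad2_gt0 (KU _ Kq); split.
  + have := h1 _ Kq; rewrite ger0_norm ?invr_ge0 ?(ltW r0)// => h.
    by rewrite -[leRHS]invrK lef_pV2// posrE invr_gt0.
  + apply: le_trans (ler_norm _) (le_trans (h2 _ Kq) _).
    apply: (@le_trans _ _ (B2 + 1 + B3)).
      by rewrite -addrA lerDl addr_ge0// ltW.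
    by rewrite expr2 ler_peMr// (le_trans _ l1).
  + by apply: le_trans (h3 _ Kq) _; rewrite lerDr addr_ge0// ltW.
Qed.

Lemma test_fun_shell (u : heis -> R[i]) : test_fun U u ->
  exists delta L : R, [/\ 0 < delta, 0 <= L,
    shell_fun delta L (ReF u) & shell_fun delta L (ImF u)].
Proof.
move=> [sR sI [K [cK KU u0]]].
have oU := @open_off_axis R.
have oK : open (~` K).
  by apply: closed_openC; apply: compact_closed => //; exact: norm_hausdorff.
(* A test function is smooth off the axis and zero off [K]; the two open sets cover the space, which
   gives smoothness across the axis. *)
have sT f : smooth U f -> (forall q, ~ K q -> f q = 0) -> smooth setT f.
  move=> sf f0; rewrite (_ : setT = U `|` ~` K); last first.
    apply/seteqP; split=> // q _; have [/KU|] := pselect (K q); by [left|right].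
  apply: smooth_setU => //; apply: (eq_smooth (f := fun=> 0)) => //.
    by move=> q /f0 ->.
  exact: smooth_cst.
have [delta [L [d0 L0 KS]]] := compact_shell cK KU.
by exists delta, L; split=> //; split=> [|q nq]; try (apply: sT => // q' nq); rewrite /ReF /ImF u0// => /KS.
Qed.

Lemma normc_sqr (z : R[i]) : ComplexField.Normc.normc z ^+ 2 = complex.Re z ^+ 2 + complex.Im z ^+ 2.
Proof. by case: z => a b; rewrite /= sqr_sqrtr// addr_ge0 ?sqr_ge0. Qed.

Lemma sqr_norm_mag (A : form1 R) (u : heis -> R[i]) q :
  ComplexField.Normc.normc (magX A u q) ^+ 2 + ComplexField.Normc.normc (magY A u q) ^+ 2 =
  (opX (ReF u) q - coefx A q * ImF u q) ^+ 2 + (opX (ImF u) q + coefx A q * ReF u q) ^+ 2 +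
  ((opY (ReF u) q - coefy A q * ImF u q) ^+ 2 + (opY (ImF u) q + coefy A q * ReF u q) ^+ 2).
Proof.
rewrite !normc_sqr /magX /magY /cplx /ReF /ImF; case: (u q) => a b /=.
move: (opX _ q) (opX _ q) (opY _ q) (opY _ q) (coefx A q) (coefy A q) => *.
by congr (_ ^+ 2 + _ ^+ 2 + (_ ^+ 2 + _ ^+ 2)); ring.
Qed.

(** Passage from the frame X, Y to radial and angular components by r (u^2 + v^2) = (x u + y v)^2 +
    (x v - y u)^2, where [r] is the squared radius. The literals 0 and 1 are the planar coordinates
    of X and Y, in which dphi is evaluated. *)
Let horizontal_square (al x y r a b c s : R) : r = x ^+ 2 + y ^+ 2 -> r != 0 ->
  (a - y / 2 * c - al * ((x * 0 - y * 1) / r) * s) ^+ 2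
  + (b + x / 2 * c - al * ((x * 1 - y * 0) / r) * s) ^+ 2 =
  r^-1 * ((x * a + y * b) ^+ 2 + (x * b - y * a - al * s + r / 2 * c) ^+ 2).
Proof.
move=> rE r0; apply: (mulfI r0); rewrite mulVKf//.
have -> : forall u v : R, r * (u ^+ 2 + v ^+ 2) = (x * u + y * v) ^+ 2 + (x * v - y * u) ^+ 2.
  by move=> u v; rewrite rE; ring.
have e : (x ^+ 2 + y ^+ 2) / r = 1 by rewrite -rE divff.
congr (_ ^+ 2 + _ ^+ 2); first by ring.
transitivity (x * b - y * a - al * ((x ^+ 2 + y ^+ 2) / r) * s + (x ^+ 2 + y ^+ 2) / 2 * c).
  by ring.
by rewrite e mulr1 -rE.
Qed.

Definition mag_density alpha P S q :=
  dilation P q ^+ 2 + dilation S q ^+ 2 + twist alpha P S q ^+ 2 + twist (- alpha) S P q ^+ 2.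

Lemma mag_densityE alpha (u : heis -> R[i]) q :
  smooth setT (ReF u) -> smooth setT (ImF u) -> U q ->
  ComplexField.Normc.normc (magX (A_alpha alpha) u q) ^+ 2
    + ComplexField.Normc.normc (magY (A_alpha alpha) u q) ^+ 2 =
  mag_density alpha (fun q => invrad q * ReF u q) (fun q => invrad q * ImF u q) q.
Proof.
move=> sP sS Uq; rewrite sqr_norm_mag /mag_density !dilation_invradM// !twist_invradM//.
rewrite !exprMn sqr_invrad /coefx /coefy /A_alpha /dphi /opX /opY /euler /angular rad2E.
have r0 : rad2 q != 0 by rewrite gt_eqF// rad2_gt0.
have rE : rad2 q = cx q ^+ 2 + cy q ^+ 2 by [].
have h1 := horizontal_square alpha ('D_ex (ReF u) q) ('D_ey (ReF u) q) ('D_ez (ReF u) q) (ImF u q) rE r0.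
have h2 := horizontal_square (- alpha) ('D_ex (ImF u) q) ('D_ey (ImF u) q) ('D_ez (ImF u) q) (ReF u q) rE r0.
move: h1 h2; rewrite [cx (vecX q)]/= [cy (vecX q)]/= [cx (vecY q)]/= [cy (vecY q)]/=.
move: ('D_ex (ReF u) q) ('D_ey (ReF u) q) ('D_ez (ReF u) q) (ReF u q) => a1 a2 a3 a4.
move: ('D_ex (ImF u) q) ('D_ey (ImF u) q) ('D_ez (ImF u) q) (ImF u q) => b1 b2 b3 b4.
rewrite [cx (vecX q)]/= [cy (vecX q)]/= [cx (vecY q)]/= [cy (vecY q)]/=.
rewrite !mulNr !opprK => h1 h2.
by rewrite addrACA h1 h2 !mulrDr [LHS]addrACA !addrA.
Qed.

Section Shell.
Variables (delta L M : R) (u : heis -> R[i]).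
Hypotheses (d0 : 0 < delta) (L0 : 0 <= L) (LM : L < M).
Hypotheses (tP : shell_fun delta L (ReF u)) (tS : shell_fun delta L (ImF u)).
Let p q := invrad q * ReF u q.
Let s q := invrad q * ImF u q.

Let sP : smooth setT (ReF u). Proof. by case: tP. Qed.
Let sS : smooth setT (ImF u). Proof. by case: tS. Qed.
Let tp : shell_fun delta L p. Proof. exact: (sfM_off_axis d0 smooth_invrad tP). Qed.
Let ts : shell_fun delta L s. Proof. exact: (sfM_off_axis d0 smooth_invrad tS). Qed.
Let M0 : 0 <= M. Proof. exact: le_trans L0 (ltW LM). Qed.

Lemma sf_mag_density alpha : shell_fun delta L (mag_density alpha p s).
Proof.
apply: sfD; last by apply: (sf_sqr d0); apply: sf_twist.
apply: sfD; last by apply: (sf_sqr d0); apply: sf_twist.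
by apply: sfD; apply: (sf_sqr d0); apply: sf_dilation.
Qed.

Lemma sf_weight (d : R) : shell_fun delta L (fun q => d ^+ 2 * (p q ^+ 2 + s q ^+ 2)).
Proof. by apply: (sfZ d0); apply: sfD; apply: (sf_sqr d0). Qed.

Lemma Qform_shell alpha : Qform (A_alpha alpha) u = (I3 M (mag_density alpha p s))%:E.
Proof.
have t1 := sf_mag_density alpha.
rewrite -(integral_heis M0 (sf_cont t1)); last exact: (sf_box L0 LM t1).
  apply: eq_integral => q _; congr (_%:E).
  (* On the axis both densities vanish, since the function and its derivatives are zero outside the
     shell. *)
  have [Uq|nUq] := pselect (U q); first exact: mag_densityE.
  have nq : ~ shell delta L q by move=> /(shell_off_axis d0).
  rewrite t1.2// sqr_norm_mag /opX /opY.
  rewrite (sf_dx tP).2// (sf_dy tP).2// (sf_dz tP).2//.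
  rewrite (sf_dx tS).2// (sf_dy tS).2// (sf_dz tS).2//.
  by rewrite tP.2// tS.2// !mulr0 !addr0 !subr0 expr0n /= !addr0.
by move=> q; rewrite /mag_density !addr_ge0 ?sqr_ge0.
Qed.

Lemma weight_shell alpha :
  (\int[@heis_mu R]_(q in U) (hardy_weight alpha q * ComplexField.Normc.normc (u q) ^+ 2)%:E
  = (I3 M (fun q => dist_int alpha ^+ 2 * (p q ^+ 2 + s q ^+ 2)))%:E)%E.
Proof.
have t3 := sf_weight (dist_int alpha).
rewrite integral_mkcond -(integral_heis M0 (sf_cont t3)); last exact: (sf_box L0 LM t3).
  apply: eq_integral => q _; rewrite /patch; case: ifPn => [|/negP]; rewrite inE => Uq.
    rewrite /hardy_weight normc_sqr rad2E /p /s !exprMn sqr_invrad -/(ReF u q) -/(ImF u q).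
    by congr (_%:E); rewrite -mulrDr mulrA.
  have nq : ~ shell delta L q by move=> /(shell_off_axis d0).
  by rewrite t3.2.
by move=> q; rewrite mulr_ge0 ?addr_ge0 ?sqr_ge0.
Qed.

Lemma I3_mag_minus_weight alpha d :
  I3 M (mag_density alpha p s) - I3 M (fun q => d ^+ 2 * (p q ^+ 2 + s q ^+ 2)) =
  I3 M (fun q => mag_density alpha p s q - d ^+ 2 * (p q ^+ 2 + s q ^+ 2)).
Proof. by rewrite (I3B M0 (sf_cont (sf_mag_density alpha)) (sf_cont (sf_weight d))). Qed.

Lemma I3_mag_ge alpha : 0 <= I3 M (mag_density alpha p s) -
  I3 M (fun q => dist_int alpha ^+ 2 * (p q ^+ 2 + s q ^+ 2)).
Proof.
have := shell_hardy d0 L0 LM tp ts (dist_int_modes alpha).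
by congr (_ <= _); rewrite I3_mag_minus_weight; apply: eq_I3 => q; rewrite mulNr.
Qed.

End Shell.

Lemma sublaplacian_hardy alpha : sublaplacian_ge U (A_alpha alpha) (hardy_weight alpha).
Proof.
move=> u tu; have [delta [L [d0 L0 tP tS]]] := test_fun_shell tu.
(* Any box strictly larger than the shell will do; strictness keeps the support off its faces. *)
have LM : L < L + 1 by rewrite ltrDl.
rewrite (Qform_shell d0 L0 LM tP tS) (weight_shell d0 L0 LM tP tS) lee_fin -subr_ge0.
exact: (I3_mag_ge d0 L0 LM tP tS).
Qed.
End HardyTest.

(** * A smooth cutoff on the line *)

Section Cutoff.
Variable R : realType.
Implicit Types (t x : R) (m n : nat) (phi : R -> R).

Lemma expn_le_expR n (y : R) : 0 <= y -> y ^+ n <= n`!%:R * expR y.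
Proof.
case: n => [|n] y0.
  by rewrite expr0 fact0 mul1r (le_trans _ (expR_ge1Dx y))// lerDl.
have := expR_ge1Dxn n y0; move=> h.
rewrite mulrC -ler_pdivrMr ?ltr0n ?fact_gt0//.
by rewrite (le_trans _ h)// lerDr.
Qed.

(** The powers of 1/t in front of e^(-1/t) are included because the derivative raises them: the
    linear span of these functions is stable under differentiation. *)
Definition flat m t : R := if 0 < t then t^-1 ^+ m * expR (- t^-1) else 0.

Lemma flat_ge0 m t : 0 <= flat m t.
Proof.
by rewrite /flat; case: ifPn => // t0; rewrite mulr_ge0 ?expR_ge0 ?exprn_ge0 ?invr_ge0 ?(ltW t0).
Qed.

Lemma flat_le0 m t : t <= 0 -> flat m t = 0.
Proof. by rewrite /flat leNgt => /negPf ->. Qed.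

Lemma flat_bound m t : flat m t <= m`!%:R.
Proof.
rewrite /flat; case: ifPn => // t0.
by rewrite expRN ler_pdivrMr ?expR_gt0// expn_le_expR// invr_ge0 ltW.
Qed.

(** Two powers of t are paid for by raising the index by 2, where [flat_bound] applies; a quadratic
    bound at 0 gives the derivative 0 there. *)
Lemma flat_sqr_bound m t : flat m t <= m.+2`!%:R * t ^+ 2.
Proof.
have [t0|t0] := ltP 0 t; last by rewrite flat_le0// mulr_ge0 ?sqr_ge0.
have := flat_bound m.+2 t; rewrite /flat t0 => h.
rewrite -ler_pdivrMr ?exprn_gt0//; apply: le_trans h.
by rewrite -exprVn mulrAC -exprD addn2.
Qed.

Lemma is_derive_sqr_bound phi (C : R) : phi 0 = 0 -> (forall t, `|phi t| <= C * t ^+ 2) ->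
  is_derive (0 : R) (1 : R) phi 0.
Proof.
move=> p0 hC.
have H : h^-1 *: (phi (h *: (1 : R) + 0) - phi 0) @[h --> (0 : R)^'] --> (0 : R).
  have hb : C * `|h| @[h --> (0 : R)^'] --> (0 : R).
    rewrite -[X in _ --> X](mulr0 C); apply: cvgM; first exact: cvg_cst.
    by rewrite -[X in _ --> X](@normr0 _ R); apply: cvg_norm; exact: nbhs_dnbhs.
  apply: norm_cvg0; apply: (squeeze_cvgr _ (cvg_cst 0) hb).
  near=> h; rewrite normr_ge0 /=.
  have h0 : h != 0 by near: h; exact: nbhs_dnbhs_neq.
  rewrite p0 subr0 addr0 /GRing.scale /= mulr1 normrM normfV mulrC.
  rewrite ler_pdivrMr ?normr_gt0// (le_trans (hC h))//.
  by rewrite -mulrA -expr2 real_normK// num_real.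
by split; [apply/cvg_ex; exists 0|exact: cvg_lim].
Unshelve. all: by end_near. Qed.

Lemma is_derive_flat m t :
  is_derive t (1 : R) (flat m) (flat m.+2 t - m%:R * flat m.+1 t).
Proof.
have [t0|t0|<-] := ltgtP 0 t.
- apply: (@near_eq_is_derive _ _ _ (fun t => t^-1 ^+ m * expR (- t^-1))).
    by near=> u; rewrite /flat ifT//; near: u; exact: lt_nbhsr.
  have tn : t != 0 by rewrite gt_eqF.
  have di := is_derive_inv tn.
  have d1 := is_derive1_comp (is_derive_pow m (t^-1)) di.
  have d2 := @is_derive_comp1 R R (fun t => - t^-1) expR t 1 _ _ (is_deriveN di) (is_derive_expR _).
  apply: is_derive_eq (is_deriveM d1 d2) _.
  rewrite /GRing.scale /flat t0 /=.
  have e : t ^- 2 = t^-1 ^+ 2 by rewrite exprVn.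
  rewrite e; move: (expR (- t^-1)) (t^-1) => z y.
  case: (m) => [|k]; first by rewrite !mul0r !expr0; ring.
  by rewrite /= !exprS; ring.
- apply: (@near_eq_is_derive _ _ _ (fun=> 0)).
    by near=> u; rewrite flat_le0// ltW//; near: u; exact: lt_nbhsl.
  by rewrite !flat_le0 ?ltW// mulr0 subr0; exact: is_derive_cst.
- rewrite !flat_le0// mulr0 subr0; apply: (@is_derive_sqr_bound _ m.+2`!%:R) => [|u].
    by rewrite flat_le0.
  by rewrite ger0_norm ?flat_ge0// flat_sqr_bound.
Unshelve. all: by end_near. Qed.

Inductive flat_family : (R -> R) -> Prop :=
| FF_flat m : flat_family (flat m)
| FF_lin phi psi (c : R) : flat_family phi -> flat_family psi ->
    flat_family (fun t => phi t - c * psi t).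

Lemma flat_family_closed : derive_closed setT flat_family.
Proof.
move=> phi; elim=> {phi} [m|phi psi c _ [phi' F1 d1] _ [psi' F2 d2]].
  exists (fun t => flat m.+2 t - m%:R * flat m.+1 t); first by apply: FF_lin; exact: FF_flat.
  by move=> t _; exact: is_derive_flat.
exists (fun t => phi' t - c * psi' t); first exact: FF_lin.
move=> t _; have := is_deriveB (d1 t I) (is_deriveM (is_derive_cst c t (1 : R)) (d2 t I)).
by move/is_derive_eq; apply; rewrite /GRing.scale /= mulr0 addr0.
Qed.

(** The bump e^(-1/(1 - x^2)) on |x| < 1. It has no plateau; a positive lower bound for |x| <= 1/2
    replaces one. *)
Definition cutoff x := flat 0 (1 - x ^+ 2).

Lemma cutoff_ge0 x : 0 <= cutoff x. Proof. exact: flat_ge0. Qed.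

Lemma cutoff_le1 x : cutoff x <= 1. Proof. exact: flat_bound. Qed.

Lemma cutoff_out x : 1 <= `|x| -> cutoff x = 0.
Proof.
by move=> x1; apply: flat_le0; rewrite subr_le0 -(real_normK (num_real x)) exprn_ege1.
Qed.

Definition dcutoff x := flat 2 (1 - x ^+ 2) * (- 2 * x).

Lemma dcutoff_out x : 1 <= `|x| -> dcutoff x = 0.
Proof.
move=> x1; rewrite /dcutoff flat_le0 ?mul0r//.
by rewrite subr_le0 -(real_normK (num_real x)) exprn_ege1.
Qed.

(** The function [flat 2] is at most 2! and |2 x| at most 2 on the support, so the derivative is at
    most 4 in absolute value. *)
Lemma dcutoff_sqr_le x : dcutoff x ^+ 2 <= 16.
Proof.
have [x1|/ltW x1] := leP 1 `|x|; first by rewrite dcutoff_out// expr0n.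
rewrite /dcutoff exprMn [(- 2 * x) ^+ 2]exprMn.
have h1 : flat 2 (1 - x ^+ 2) ^+ 2 <= 2 ^+ 2.
  by rewrite lerXn2r ?nnegrE ?flat_ge0// (le_trans (flat_bound _ _)).
have h2 : x ^+ 2 <= 1 by rewrite -(real_normK (num_real x)) exprn_ile1.
have -> : 16 = 2 ^+ 2 * ((- 2) ^+ 2 * 1) :> R by ring.
apply: ler_pM h1 _; rewrite ?sqr_ge0//.
  by apply: mulr_ge0; exact: sqr_ge0.
by apply: ler_wpM2l h2; rewrite sqr_ge0.
Qed.

Lemma is_derive_cutoff x : is_derive x (1 : R) cutoff (dcutoff x).
Proof.
have dx := is_deriveB (is_derive_cst (1 : R) x (1 : R)) (is_derive_pow 2 x).
have := @is_derive_comp1 R R (fun x => 1 - x ^+ 2) (flat 0) x 1 _ _ dx (is_derive_flat 0 _).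
move/is_derive_eq; apply; rewrite /dcutoff mul0r subr0.
by move: (flat _ _) => y /=; rewrite expr1; ring.
Qed.

(** The value of [cutoff] at 1/2, since 3/4 = 1 - (1/2)^2. *)
Definition cutoff_min : R := flat 0 (3 / 4).

Lemma cutoff_min_gt0 : 0 < cutoff_min.
Proof. by rewrite /cutoff_min /flat divr_gt0// expr0 mul1r expR_gt0. Qed.

Lemma cutoff_ge_min x : `|x| <= 2^-1 -> cutoff_min <= cutoff x.
Proof.
move=> x1; have h : 3 / 4 <= 1 - x ^+ 2.
  have : `|x| ^+ 2 <= 2^-1 ^+ 2 by rewrite lerXn2r ?nnegrE ?invr_ge0.
  by rewrite real_normK ?num_real// lerBrDr -lerBrDl => /le_trans; apply; rewrite le_eqVlt; apply/orP; left; apply/eqP; field.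
have p : 0 < 3 / 4 :> R by rewrite divr_gt0.
have q := lt_le_trans p h.
rewrite /cutoff /cutoff_min /flat p q !expr0 !mul1r ler_expR lerN2 lef_pV2// posrE.
Qed.
End Cutoff.

(** * The functions e^(i k phi) *)

Section Phase.
Variable R : realType.
Local Notation heis := (heis R).
Local Notation U := (@heis_off_axis R).
Implicit Types (q v : heis).

(** C + i S plays the role of e^(i k phi), described by its modulus 1 and logarithmic derivative i k
    dphi because phi itself is not globally defined. Such pairs are built from (x + i y)/r by
    complex multiplication and conjugation. *)
Definition phase (k : R) (C S : heis -> R) := [/\ smooth U C, smooth U S,
  forall q, U q -> C q ^+ 2 + S q ^+ 2 = 1,
  forall q v, U q -> is_derive q v C (- k * S q * dphi q v) &
  forall q v, U q -> is_derive q v S (k * C q * dphi q v)].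

Let oU := @open_off_axis R.

Lemma phase1 : phase 1 (fun q => cx q * invrad q) (fun q => cy q * invrad q).
Proof.
have h q : U q -> invrad q ^+ 2 * (cx q ^+ 2 + cy q ^+ 2) = 1.
  by move=> Uq; rewrite sqr_invrad -/(rad2 q) mulVf ?gt_eqF ?rad2_gt0.
have e q v : dphi q v = (cx q * cy v - cy q * cx v) * invrad q ^+ 2.
  by rewrite /dphi rad2E sqr_invrad.
split.
- exact: (smoothM oU (smooth_cx oU) (@smooth_invrad R)).
- exact: (smoothM oU (smooth_cy oU) (@smooth_invrad R)).
- by move=> q /h <-; rewrite !exprMn -mulrDl mulrC.
- move=> q v Uq; apply: is_derive_eq (is_deriveM (is_derive_cx q v) (is_derive_invrad v Uq)) _.
  rewrite e /GRing.scale /= ?mulN1r ?mul1r -[invrad q * cx v]mulr1 -(h q Uq).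
  by move: (cx q) (cy q) (cx v) (cy v) (invrad q) => *; ring.
- move=> q v Uq; apply: is_derive_eq (is_deriveM (is_derive_cy q v) (is_derive_invrad v Uq)) _.
  rewrite e /GRing.scale /= ?mulN1r ?mul1r -[invrad q * cy v]mulr1 -(h q Uq).
  by move: (cx q) (cy q) (cx v) (cy v) (invrad q) => *; ring.
Qed.

Lemma phaseD k l C S C' S' : phase k C S -> phase l C' S' ->
  phase (k + l) (fun q => C q * C' q + -1 * (S q * S' q)) (fun q => S q * C' q + C q * S' q).
Proof.
move=> [sC sS h dC dS] [sC' sS' h' dC' dS']; split.
- apply: (smoothD oU (smoothM oU sC sC')).
  by apply: (smoothM oU _ (smoothM oU sS sS')); exact: smooth_cst.
- exact: (smoothD oU (smoothM oU sS sC') (smoothM oU sC sS')).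
- move=> q Uq; transitivity ((C q ^+ 2 + S q ^+ 2) * (C' q ^+ 2 + S' q ^+ 2)); last by rewrite h// h'// mulr1.
  by move: (C q) (S q) (C' q) (S' q) => *; ring.
- move=> q v Uq.
  have := is_deriveD (is_deriveM (dC _ v Uq) (dC' _ v Uq))
    (is_deriveM (is_derive_cst (-1 : R) q v) (is_deriveM (dS _ v Uq) (dS' _ v Uq))).
  move/is_derive_eq; apply; rewrite /GRing.scale /=.
  by move: (C q) (S q) (C' q) (S' q) (dphi q v) => *; ring.
- move=> q v Uq.
  have := is_deriveD (is_deriveM (dS _ v Uq) (dC' _ v Uq)) (is_deriveM (dC _ v Uq) (dS' _ v Uq)).
  move/is_derive_eq; apply; rewrite /GRing.scale /=.
  by move: (C q) (S q) (C' q) (S' q) (dphi q v) => *; ring.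
Qed.

Lemma phaseN k C S : phase k C S -> phase (- k) C (fun q => -1 * S q).
Proof.
move=> [sC sS h dC dS]; split=> //.
- by apply: (smoothM oU _ sS); exact: smooth_cst.
- by move=> q Uq; rewrite mulN1r sqrrN h.
- move=> q v Uq; apply: is_derive_eq (dC q v Uq) _.
  by move: (S q) (dphi q v) => *; ring.
- move=> q v Uq.
  have := is_deriveM (is_derive_cst (-1 : R) q v) (dS _ v Uq).
  move/is_derive_eq; apply; rewrite /GRing.scale /=.
  by move: (C q) (S q) (dphi q v) => *; ring.
Qed.

Lemma phase_int (k : int) : exists C S, phase k%:~R C S.
Proof.
have nat_phase (n : nat) : exists C S, phase n%:R C S.
  elim: n => [|n [C [S h]]].
    exists (fun=> 1), (fun=> 0); split.
    - exact: smooth_cst.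
    - exact: smooth_cst.
    - by move=> q _; rewrite expr0n expr1n addr0.
    - by move=> q v _; apply: is_derive_eq (is_derive_cst (1 : R) q v) _; rewrite mulr0 mul0r.
    - by move=> q v _; apply: is_derive_eq (is_derive_cst (0 : R) q v) _; rewrite !mul0r.
  by rewrite -natr1; do 2!eexists; exact: (phaseD h phase1).
case: k => n; first exact: nat_phase.
have [C [S h]] := nat_phase n.+1.
by rewrite NegzE mulrNz; do 2!eexists; exact: (phaseN h).
Qed.

End Phase.

(** * The radial and vertical cutoff of the trial functions *)

Section Trial.
Variable R : realType.
Local Notation heis := (heis R).
Local Notation U := (@heis_off_axis R).
Local Notation ex := (e_x R).
Local Notation ey := (e_y R).
Local Notation ez := (e_z R).
Implicit Types (q v : heis).

Let oU := @open_off_axis R.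

(** Differentiating the logarithm leads to inverse powers, which are adjoined to obtain a stable
    family. *)
Definition log_family (phi : R -> R) := phi = @ln R \/ inv_family phi.

Lemma log_family_closed : derive_closed [set x : R | 0 < x] log_family.
Proof.
move=> phi [->|/inv_family_closed [phi' P' d']]; last first.
  by exists phi' => [|x x0]; [right|apply: d'; rewrite /= gt_eqF].
exists (fun x => x^-1); last by move=> x; exact: is_derive1_ln.
by right; exists 1, 1%N; apply/funext => x; rewrite mul1r.
Qed.

Lemma smooth_cutoff (O : set heis) (f : heis -> R) : open O -> smooth O f ->
  smooth O (fun q => cutoff (f q)).
Proof.
move=> oO sf.
have s1 : smooth O (fun q => 1 + -1 * (f q * f q)).
  apply: (smoothD oO); first exact: smooth_cst.
  by apply: (smoothM oO); [exact: smooth_cst|exact: smoothM].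
have := smooth_comp oO (@flat_family_closed R) (FF_flat R 0) s1 (fun _ _ => I).
by apply: eq_smooth => // q _; rewrite mulN1r -expr2.
Qed.

Variables nu ht : R.
Hypotheses (nu0 : 0 < nu) (ht0 : 0 < ht).

Let nun : nu != 0. Proof. by rewrite gt_eqF. Qed.
Let htn : ht != 0. Proof. by rewrite gt_eqF. Qed.

Definition logr q := ln (rad2 q) / nu.
Definition height q := cz q / ht.
(** On the axis [ln] takes its default value 0, at which the cutoff is positive, so the vanishing
    there has to be imposed. *)
Definition trial q := if 0 < rad2 q then cutoff (logr q) * cutoff (height q) else 0.

Lemma trialE q : U q -> trial q = cutoff (logr q) * cutoff (height q).
Proof. by move=> /rad2_gt0 r0; rewrite /trial r0. Qed.

Lemma smooth_logr : smooth U logr.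
Proof.
apply: (smoothM oU); last exact: smooth_cst.
apply: (smooth_comp oU log_family_closed _ (smooth_rad2 oU)); first by left.
by move=> q; exact: rad2_gt0.
Qed.

Lemma smooth_trial : smooth U trial.
Proof.
apply: (@eq_smooth _ _ (fun q => cutoff (logr q) * cutoff (height q))) => //.
  by move=> q Uq; rewrite trialE.
apply: (smoothM oU); apply: (smooth_cutoff oU); first exact: smooth_logr.
by apply: (smoothM oU); [exact: smooth_cz|exact: smooth_cst].
Qed.

Lemma is_derive_trial q v : U q -> is_derive q v trial
  (dcutoff (logr q) * (2 * (cx q * cx v + cy q * cy v) / (nu * rad2 q)) * cutoff (height q)
   + cutoff (logr q) * (dcutoff (height q) * (cz v / ht))).
Proof.
move=> Uq; have r0 := rad2_gt0 Uq.
apply: (@near_eq_is_derive _ _ _ (fun q => cutoff (logr q) * cutoff (height q))).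
  by apply: filterS (open_nbhs_nbhs (conj oU Uq)) => p Up; rewrite trialE.
have dr := is_deriveD (is_deriveM (is_derive_cx q v) (is_derive_cx q v))
  (is_deriveM (is_derive_cy q v) (is_derive_cy q v)).
have dl := is_derive_comp1 dr (is_derive1_ln r0).
have d1 := is_derive_comp1 (is_deriveM dl (is_derive_cst nu^-1 q v)) (is_derive_cutoff (logr q)).
have d2 := is_derive_comp1 (is_deriveM (is_derive_cz q v) (is_derive_cst ht^-1 q v)) (is_derive_cutoff (height q)).
apply: is_derive_eq (is_deriveM d1 d2) _.
rewrite /GRing.scale /=.
have r1 : rad2 q != 0 by rewrite gt_eqF.
move: (cutoff _) (cutoff _) (dcutoff _) (dcutoff _) => a b c d.
move: (cx q) (cy q) (cz q) (cx v) (cy v) (cz v) (ln _) (rad2 q) r1 => x y z vx vy vz l r r1.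
by field; rewrite r1 nun htn.
Qed.

Definition trial_delta := expR (- nu).
(** The support satisfies r^2 < e^nu and |z| < ht; the summand 1 makes the size at least 1, so that
    its square also dominates e^nu. *)
Definition trial_size := 1 + expR nu + ht.

Lemma trial_size_gt0 : 0 <= trial_size.
Proof. by rewrite !addr_ge0 ?expR_ge0 ?ltW. Qed.

Lemma trial_support q : trial q != 0 ->
  [/\ expR (- nu) < rad2 q, rad2 q < expR nu & `|cz q| < ht].
Proof.
rewrite /trial; case: ifPn => [r0|_]; last by rewrite eqxx.
move=> t0; have : `|logr q| < 1 /\ `|height q| < 1.
  by split; rewrite ltNge; apply/negP => /cutoff_out e; move: t0; rewrite e ?mul0r ?mulr0 eqxx.
rewrite /logr /height !normf_div [`|nu|]gtr0_norm// [`|ht|]gtr0_norm// !ltr_pdivrMr// !mul1r.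
rewrite ltr_norml => -[/andP[h1 h2] h3]; split=> //.
  by rewrite -(lnK r0) ltr_expR.
by rewrite -(lnK r0) ltr_expR.
Qed.

Lemma trial_shell q : ~ shell trial_delta trial_size q -> trial q = 0.
Proof.
move=> nq; apply/eqP/negPn/negP => /trial_support[h1 h2 h3]; apply: nq; split.
- exact: ltW.
- apply: (le_trans (ltW h2)); apply: (@le_trans _ _ trial_size).
    by rewrite /trial_size addrAC lerDr addr_ge0// ltW.
  by rewrite expr2 ler_peMr ?trial_size_gt0// /trial_size -addrA lerDl addr_ge0 ?expR_ge0// ltW.
- by rewrite (le_trans (ltW h3))// /trial_size lerDr addr_ge0// expR_ge0.
Qed.

Lemma sf_trial : shell_fun trial_delta trial_size trial.
Proof.
split=> [|q]; last exact: trial_shell.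
rewrite (_ : setT = U `|` ~` shell trial_delta trial_size); last first.
  apply/seteqP; split=> // q _.
  have [/(shell_off_axis (expR_gt0 _))|] := pselect (shell trial_delta trial_size q); by [left|right].
apply: smooth_setU; first exact: smooth_trial.
have oS := @open_shellC R trial_delta trial_size.
apply: (@eq_smooth _ _ (fun=> 0)) => //; last exact: smooth_cst.
by move=> q /trial_shell.
Qed.

Lemma derive_trial q v : U q -> 'D_v trial q =
  (dcutoff (logr q) * (2 * (cx q * cx v + cy q * cy v) / (nu * rad2 q)) * cutoff (height q)
   + cutoff (logr q) * (dcutoff (height q) * (cz v / ht))).
Proof. by move=> Uq; have [_ ->] := is_derive_trial v Uq. Qed.

(** The factor 2/nu comes from E ln(r^2) = 2: in the logarithmic scale the cutoff is slow, and this
    is what makes the radial energy small. *)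
Lemma euler_trial q : U q -> euler trial q = dcutoff (logr q) * cutoff (height q) * (2 / nu).
Proof.
move=> Uq; rewrite /euler !derive_trial//.
have r1 : rad2 q != 0 by rewrite gt_eqF// rad2_gt0.
have -> : 2 / nu = 2 * (cx q ^+ 2 + cy q ^+ 2) / (nu * rad2 q).
  by rewrite -/(rad2 q); move: (rad2 q) r1 => r r1; field; rewrite r1 nun.
rewrite /cx /cy /cz /=.
move: (cutoff _) (cutoff _) (dcutoff _) (dcutoff _) (rad2 q) r1 => a b c d r r1.
by field; rewrite r1 nun.
Qed.

Lemma angular_trial q : U q -> angular trial q = 0.
Proof.
move=> Uq; rewrite /angular !derive_trial//.
rewrite /cx /cy /cz /= mul0r !mulr0.
by move: (cutoff _) (dcutoff _) (_^-1) => *; ring.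
Qed.

Lemma dz_trial q : U q -> 'D_ez trial q = cutoff (logr q) * dcutoff (height q) / ht.
Proof.
move=> Uq; rewrite !derive_trial//.
rewrite /cx /cy /cz /= !mulr0 addr0 mulr0 !mul0r mulr0 mul0r add0r mul1r.
by rewrite mulrA.
Qed.

End Trial.

(** * The energy density of the trial functions *)

Section TrialEnergy.
Variable R : realType.
Local Notation heis := (heis R).
Local Notation U := (@heis_off_axis R).
Local Notation ex := (e_x R).
Local Notation ey := (e_y R).
Local Notation ez := (e_z R).
Implicit Types (q v : heis).
Variables (nu ht : R) (k : R) (C S : heis -> R).
Hypotheses (nu0 : 0 < nu) (ht0 : 0 < ht) (CS : phase k C S).
Local Notation t := (trial nu ht).
Local Notation delta := (trial_delta nu).
Local Notation L := (trial_size nu ht).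

Definition trial_fun q : R[i] := Complex (C q * t q) (S q * t q).

Let d0 : 0 < delta. Proof. exact: expR_gt0. Qed.
Let L0 : 0 <= L. Proof. exact: trial_size_gt0. Qed.
Let tt : shell_fun delta L t. Proof. exact: sf_trial. Qed.
Let sC : smooth U C. Proof. by case: CS. Qed.
Let sS : smooth U S. Proof. by case: CS. Qed.

Lemma sf_trial_Re : shell_fun delta L (ReF trial_fun).
Proof. exact: (sfM_off_axis d0 sC tt). Qed.

Lemma sf_trial_Im : shell_fun delta L (ImF trial_fun).
Proof. exact: (sfM_off_axis d0 sS tt). Qed.

Lemma shell_compact (d l : R) : compact (@shell R d l).
Proof.
(* The bound is insensitive to the sign of [l]: if |x| > 1 then |x| <= x^2 <= l^2. *)
pose B : set heis := (`[- Num.max 1 (l ^+ 2), Num.max 1 (l ^+ 2)] `*` `[- Num.max 1 (l ^+ 2), Num.max 1 (l ^+ 2)])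
  `*` `[- l, l].
have cB : compact B by apply: compact_setX; [apply: compact_setX|]; exact: segment_compact.
apply: (subclosed_compact (@closed_shell R d l) cB) => q [_ r z].
have h (x y : R) : x ^+ 2 + y ^+ 2 <= l ^+ 2 -> `|x| <= Num.max 1 (l ^+ 2).
  move=> xy; rewrite le_max; have [//|/ltW x1] := leP `|x| 1.
  rewrite orbC orbF; apply: le_trans xy; rewrite -[x ^+ 2](real_normK (num_real x)).
  by rewrite (@le_trans _ _ (`|x| ^+ 2)) ?lerDl ?sqr_ge0// expr2 ler_peMr.
rewrite /B /= !in_itv /= -!ler_norml; split; last exact: z.
split; first exact: h r.
by move: r; rewrite /rad2 addrC => /h.
Qed.

Lemma test_trial_fun : test_fun U trial_fun.
Proof.
split.
- by apply: smooth_subset sf_trial_Re.1.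
- by apply: smooth_subset sf_trial_Im.1.
- exists (shell delta L); split; first exact: shell_compact.
    exact: shell_off_axis.
  by move=> q nq; rewrite /trial_fun (tt.2 q nq) !mulr0.
Qed.

Lemma normc_sqr_trial q : U q -> ComplexField.Normc.normc (trial_fun q) ^+ 2 = t q ^+ 2.
Proof.
move=> Uq; rewrite normc_sqr /= !exprMn -mulrDl.
by have [_ _ -> //] := CS; rewrite mul1r.
Qed.

(** Once the phase is factored out, the twisted derivative of the real, radially symmetric t is i (k
    + alpha) t + (r^2/2) d_z t. Its imaginary and real parts do not interact, so the cross term
    without sign is absent. *)
Lemma mag_trial alpha q : U q ->
  mag_density alpha (fun q => invrad q * ReF trial_fun q) (fun q => invrad q * ImF trial_fun q) q =
  (euler t q ^+ 2 + (k + alpha) ^+ 2 * t q ^+ 2) / rad2 q + rad2 q / 4 * 'D_ez t q ^+ 2.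
Proof.
move=> Uq; have [_ _ h dC dS] := CS.
have sP := sf_trial_Re.1; have sI := sf_trial_Im.1.
have r1 : rad2 q != 0 by rewrite gt_eqF// rad2_gt0.
have tq v : is_derive q v t ('D_v t q) by apply: derivableP; case: (is_derive_trial nu0 ht0 v Uq).
have DP v : 'D_v (ReF trial_fun) q = C q * 'D_v t q + t q * (- k * S q * dphi q v).
  by have [_ ->] := is_deriveM (dC q v Uq) (tq v).
have DI v : 'D_v (ImF trial_fun) q = S q * 'D_v t q + t q * (k * C q * dphi q v).
  by have [_ ->] := is_deriveM (dS q v Uq) (tq v).
have ez0 : dphi q ez = 0 by rewrite /dphi /cx /cy /= !mulr0 subrr mul0r.
have ee : cx q * dphi q ex + cy q * dphi q ey = 0.
  by rewrite /dphi /cx /cy /=; move: (_^-1) => *; ring.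
have ea : cx q * dphi q ey - cy q * dphi q ex = 1.
  rewrite -(divff r1) /dphi rad2E; move: (rad2 q)^-1 => r; rewrite /rad2 /cx /cy /=.
  by ring.
have a0 := angular_trial nu0 ht0 Uq.
have eR : euler (ReF trial_fun) q = C q * euler t q.
  rewrite /euler !DP -[RHS]addr0 -[X in _ = _ + X](mulr0 (t q * (- k * S q))) -ee.
  by move: ('D_ex t q) ('D_ey t q) (dphi q ex) (dphi q ey) => *; ring.
have eI : euler (ImF trial_fun) q = S q * euler t q.
  rewrite /euler !DI -[RHS]addr0 -[X in _ = _ + X](mulr0 (t q * (k * C q))) -ee.
  by move: ('D_ex t q) ('D_ey t q) (dphi q ex) (dphi q ey) => *; ring.
have aR : angular (ReF trial_fun) q = - k * S q * t q.
  transitivity (C q * angular t q + t q * (- k * S q) * (cx q * dphi q ey - cy q * dphi q ex)).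
    by rewrite /angular !DP; move: ('D_ex t q) ('D_ey t q) (dphi q ex) (dphi q ey) => *; ring.
  by rewrite a0 ea mulr0 add0r mulr1 mulrC.
have aI : angular (ImF trial_fun) q = k * C q * t q.
  transitivity (S q * angular t q + t q * (k * C q) * (cx q * dphi q ey - cy q * dphi q ex)).
    by rewrite /angular !DI; move: ('D_ex t q) ('D_ey t q) (dphi q ex) (dphi q ey) => *; ring.
  by rewrite a0 ea mulr0 add0r mulr1 mulrC.
have zR : 'D_ez (ReF trial_fun) q = C q * 'D_ez t q.
  by rewrite DP ez0; move: ('D_ez t q) => z; rewrite !mulr0 addr0.
have zI : 'D_ez (ImF trial_fun) q = S q * 'D_ez t q.
  by rewrite DI ez0; move: ('D_ez t q) => z; rewrite !mulr0 addr0.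
have := twist_invradM (- alpha) sI sP Uq; have := twist_invradM alpha sP sI Uq.
have := dilation_invradM sI Uq; have := dilation_invradM sP Uq.
rewrite eR eI aR aI zR zI => E1 E2 E3 E4.
rewrite /mag_density E1 E2 E3 E4 {E1 E2 E3 E4}.
have -> : ReF trial_fun q = C q * t q by [].
have -> : ImF trial_fun q = S q * t q by [].
have := sqr_invrad q; move: (invrad q) => i i2.
move: h i2 => /(_ _ Uq); move: (C q) (S q) (t q) (euler t q) ('D_ez t q) (rad2 q) r1 => c s x e z r r1 h i2.
transitivity (i ^+ 2 * (c ^+ 2 + s ^+ 2) * (e ^+ 2 + (k + alpha) ^+ 2 * x ^+ 2 + (r / 2 * z) ^+ 2)).
  by ring.
by rewrite h i2; field.
Qed.

End TrialEnergy.

(** * Testing an improved inequality on the trial functions *)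

Section TrialWeight.
Variable R : realType.
Local Notation heis := (heis R).
Local Notation U := (@heis_off_axis R).
Local Notation ez := (e_z R).
Local Notation RR := (measurableTypeR R).
Implicit Types (q v : heis).

Lemma measurable_off_axis : measurable (U : set (RR * RR * RR)).
Proof.
have m := @continuous_measurable3 R (@rad2 R) (@continuous_rad2 R).
rewrite off_axisE -[X in measurable X]setTI.
have mo : measurable [set x : R | 0 < x].
  rewrite (_ : mkset _ = `]0, +oo[%classic); first exact: measurable_itv.
  by rewrite set_itvoy.
exact: (m measurableT _ mo).
Qed.

Variables (nu ht : R).
Hypotheses (nu0 : 0 < nu) (ht0 : 0 < ht).
Local Notation t := (trial nu ht).
Local Notation delta := (trial_delta nu).
Local Notation L := (trial_size nu ht).
Let d0 : 0 < delta. Proof. exact: expR_gt0. Qed.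
Let L0 : 0 <= L. Proof. exact: trial_size_gt0. Qed.
Let tt : shell_fun delta L t. Proof. exact: sf_trial. Qed.

(** The excess density that remains when |k + alpha| = d has cancelled the term in t^2 / r^2. *)
Definition trial_energy q := euler t q ^+ 2 / rad2 q + rad2 q / 4 * 'D_ez t q ^+ 2.

Variables (alpha : R) (w : heis -> R) (k : int).
Hypotheses (mw : measurable_fun U w) (w0 : forall q, U q -> 0 <= w q).
Hypothesis hw : sublaplacian_ge U (A_alpha alpha) (fun q => hardy_weight alpha q + w q).
Hypothesis kd : (k%:~R + alpha) ^+ 2 = dist_int alpha ^+ 2.

(** The assumed inequality is applied to the trial function. Its Hardy part is the integral of a
    shell function, hence a finite number, and can be subtracted from both sides. *)
Lemma trial_weight :
  (\int[@heis_mu R]_(q in U) (w q * t q ^+ 2)%:E <= \int[@heis_mu R]_q (trial_energy q)%:E)%E.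
Proof.
have [C [S CS]] := phase_int R k.
pose u := trial_fun nu ht C S; pose M := L + 1.
have LM : L < M by rewrite ltrDl.
have M0 : 0 <= M by rewrite (le_trans L0)// ltW.
have tP : shell_fun delta L (ReF u) := sf_trial_Re nu0 ht0 CS.
have tS : shell_fun delta L (ImF u) := sf_trial_Im nu0 ht0 CS.
have := hw (test_trial_fun nu0 ht0 CS); rewrite -/u (Qform_shell d0 L0 LM tP tS).
pose p q := invrad q * ReF u q; pose s q := invrad q * ImF u q.
pose W q := dist_int alpha ^+ 2 * (p q ^+ 2 + s q ^+ 2).
have u2 q : U q -> p q ^+ 2 + s q ^+ 2 = (rad2 q)^-1 * t q ^+ 2.
  move=> Uq; have [_ _ h _ _] := CS.
  by rewrite /p /s !exprMn sqr_invrad -mulrDr -mulrDl h// mul1r.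
have EE q : trial_energy q = mag_density alpha p s q - W q.
  have [Uq|nUq] := pselect (U q).
    rewrite /p /s (mag_trial nu0 ht0 CS alpha Uq) /W u2// kd /trial_energy.
    by move: (euler t q) ('D_ez t q) (t q) (rad2 q)^-1 => *; ring.
  have nq : ~ shell delta L q by move=> /(shell_off_axis d0).
  have e1 : mag_density alpha p s q = 0 := (sf_mag_density d0 tP tS alpha).2 q nq.
  have e2 : W q = 0 := (sf_weight d0 tP tS _).2 q nq.
  rewrite e1 e2 subr0.
  by rewrite /trial_energy (sf_euler d0 tt).2// (sf_dz tt).2// expr0n /= mul0r mulr0 addr0.
have tE : shell_fun delta L trial_energy.
  rewrite (_ : trial_energy = fun q => mag_density alpha p s q - W q); last exact/funext.
  by apply: (sfB d0); [exact: sf_mag_density|exact: sf_weight].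
have E0 q : 0 <= trial_energy q.
  have r0 : 0 <= rad2 q by rewrite addr_ge0 ?sqr_ge0.
  by apply: addr_ge0; [apply: divr_ge0 => //; exact: sqr_ge0|apply: mulr_ge0; [exact: divr_ge0|exact: sqr_ge0]].
rewrite (integral_heis M0 (sf_cont tE) E0 (sf_box L0 LM tE)).
have -> : I3 M trial_energy = I3 M (mag_density alpha p s) - I3 M W.
  by rewrite (I3_mag_minus_weight d0 L0 LM tP tS); exact: eq_I3.
have WE := weight_shell d0 L0 LM tP tS alpha.
rewrite -/W in WE.
have -> : (\int[@heis_mu R]_(q in U) ((hardy_weight alpha q + w q) * ComplexField.Normc.normc (u q) ^+ 2)%:E
  = (I3 M W)%:E + \int[@heis_mu R]_(q in U) (w q * t q ^+ 2)%:E)%E.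
  rewrite -WE -ge0_integralD//.
  - apply: eq_integral => q; rewrite inE => Uq; rewrite -EFinD mulrDl.
    by rewrite {2}/u (normc_sqr_trial nu ht CS Uq).
  - exact: measurable_off_axis.
  - by move=> q Uq; rewrite lee_fin mulr_ge0 ?sqr_ge0// /hardy_weight divr_ge0 ?sqr_ge0.
  - have mW : measurable_fun setT W.
      by apply: continuous_measurable3; apply: (sf_cont (delta := delta) (L := L)); exact: sf_weight.
    have e q : U q -> W q = hardy_weight alpha q * ComplexField.Normc.normc (u q) ^+ 2.
      by move=> Uq; rewrite /W u2// (normc_sqr_trial nu ht CS Uq) /hardy_weight rad2E mulrA.
    apply/measurable_EFinP; apply: (eq_measurable_fun W); first by move=> q; rewrite inE => /e.
    exact: (measurable_funS measurableT (@subsetT _ U) mW).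
  - by move=> q Uq; rewrite lee_fin mulr_ge0 ?sqr_ge0// w0.
  - apply/measurable_EFinP; apply: measurable_funM; first exact: mw.
    have mt : measurable_fun setT (fun q => t q ^+ 2).
      by apply: continuous_measurable3; apply: (sf_cont (delta := delta) (L := L)); exact: sf_sqr.
    exact: (measurable_funS measurableT (@subsetT _ U) mt).
move=> h; rewrite EFinB leeBrDl//.
Qed.

End TrialWeight.

(** * Upper bound for the energy of the trial functions *)

Section EnergyBound.
Variable R : realType.
Local Notation heis := (heis R).
Local Notation U := (@heis_off_axis R).
Local Notation ez := (e_z R).
Local Notation RR := (measurableTypeR R).
Local Notation leb := (@lebesgue_measure R).
Local Notation leb2 := (@leb2 R).
Implicit Types (q v : heis).

Definition seg (r : R) : set RR := `[- r, r]%classic.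
Definition box (r h : R) : set (RR * RR * RR) := (seg r `*` seg r) `*` seg h.

Lemma segP (r x : R) : `|x| <= r -> seg r x.
Proof. by rewrite /seg /= in_itv /= -ler_norml. Qed.

Let mseg (r : R) : measurable (seg r). Proof. exact: measurable_itv. Qed.

Lemma measurable_box (r h : R) : measurable (box r h).
Proof. by apply: measurableX; [apply: measurableX|]; exact: mseg. Qed.

Lemma leb_seg (r : R) : 0 < r -> leb (seg r) = (2 * r)%:E.
Proof.
move=> r0; rewrite lebesgue_measure_itv /= lte_fin ifT; last by rewrite gtrN.
by rewrite -EFinB; congr (_%:E); ring.
Qed.

Lemma heis_mu_box (r h : R) : 0 < r -> 0 < h -> @heis_mu R (box r h) = (8 * r ^+ 2 * h)%:E.
Proof.
move=> r0 h0.
transitivity (leb2 (seg r `*` seg r) * leb (seg h))%E.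
  exact: (@product_measure1E _ _ (RR * RR)%type RR R leb2 leb _ _ (measurableX (mseg r) (mseg r)) (mseg h)).
rewrite (_ : leb2 (seg r `*` seg r) = leb (seg r) * leb (seg r))%E; last first.
  exact: (@product_measure1E _ _ RR RR R leb leb _ _ (mseg r) (mseg r)).
by rewrite !leb_seg// -!EFinM; congr (_%:E); ring.
Qed.

Lemma integral_boxes (I : Type) (s : seq I) (c r : I -> R) (h : R) :
  0 < h -> (forall i, 0 <= c i) -> (forall i, 0 < r i) ->
  (\int[@heis_mu R]_q (\sum_(i <- s) c i * \1_(box (r i) h) q)%:E =
   (\sum_(i <- s) c i * (8 * r i ^+ 2 * h))%:E)%E.
Proof.
move=> h0 c0 r0.
have m1 i : measurable_fun setT (fun q : RR * RR * RR => (\1_(box (r i) h) q : R)).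
  by have mb := measurable_box (r i) h; exact: measurable_indic.
transitivity (\int[@heis_mu R]_q (\sum_(i <- s) (c i * \1_(box (r i) h) q)%:E))%E.
  by apply: eq_integral => q _; rewrite sumEFin.
rewrite ge0_integral_sum//; last 2 first.
- by move=> i; apply/measurable_EFinP; apply: measurable_funM => //; exact: measurable_cst.
- by move=> i q _; rewrite lee_fin mulr_ge0.
rewrite -sumEFin; apply: eq_bigr => i _.
transitivity ((c i)%:E * \int[@heis_mu R]_q (\1_(box (r i) h) q)%:E)%E.
  rewrite -ge0_integralZl//; first by apply/measurable_EFinP; exact: m1.
  by rewrite lee_fin.
have e : (\int[@heis_mu R]_q (\1_(box (r i) h) q)%:E = @heis_mu R (box (r i) h))%E.
  have := @integral_indic _ (RR * RR * RR)%type R (@heis_mu R) setT measurableT _ (measurable_box (r i) h).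
  by rewrite setIT.
by rewrite (etrans e (heis_mu_box (r0 i) h0)).
Qed.

Variables (n : nat) (ht : R).
Hypotheses (n0 : (0 < n)%N) (ht0 : 0 < ht).
Local Notation nu := (n%:R : R).
Let nu0 : 0 < nu. Proof. by rewrite ltr0n. Qed.
Local Notation t := (trial nu ht).
Local Notation delta := (trial_delta nu).
Local Notation L := (trial_size nu ht).
Let tt : shell_fun delta L t. Proof. exact: sf_trial. Qed.
Let d0 : 0 < delta. Proof. exact: expR_gt0. Qed.

Definition trial_supp q := [/\ U q, expR (- nu) < rad2 q, rad2 q < expR nu & `|cz q| < ht].

Lemma trial_energy_out q : ~ trial_supp q -> trial_energy nu ht q = 0.
Proof.
move=> nq; have [Uq|nUq] := pselect (U q); last first.
  have ns : ~ shell delta L q by move=> /(shell_off_axis d0).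
  by rewrite /trial_energy (sf_euler d0 tt).2// (sf_dz tt).2// expr0n /= mul0r mulr0 addr0.
have r0 := rad2_gt0 Uq.
have [h|h] := leP 1 `|logr nu q|.
  rewrite /trial_energy euler_trial// dz_trial// (dcutoff_out h) (cutoff_out h) !mul0r.
  by rewrite expr0n /= mul0r mulr0 addr0.
have [h'|h'] := leP 1 `|height ht q|.
  rewrite /trial_energy euler_trial// dz_trial// (dcutoff_out h') (cutoff_out h') !mulr0 !mul0r.
  by rewrite expr0n /= mul0r mulr0 addr0.
exfalso; apply: nq; move: h h'.
rewrite /logr /height !normf_div [`|nu|]gtr0_norm// [`|ht|]gtr0_norm// !ltr_pdivrMr// !mul1r.
rewrite ltr_norml => /andP[h1 h2] h3; split=> //.
  by rewrite -(lnK r0) ltr_expR.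
by rewrite -(lnK r0) ltr_expR.
Qed.

(** All cutoffs are at most 1 and their squared derivatives at most 16: 64 is 16 times the square of
    the 2 in 2/nu, and 4 is 16/4 with the 1/4 of the vertical term. *)
Lemma trial_energy_le q : U q ->
  trial_energy nu ht q <= 64 / nu ^+ 2 / rad2 q + 4 / ht ^+ 2 * rad2 q.
Proof.
move=> Uq; have r0 := rad2_gt0 Uq.
have c2 x : cutoff x ^+ 2 <= 1 :> R by rewrite exprn_ile1 ?cutoff_ge0 ?cutoff_le1.
have pr (a b : R) : 0 <= a -> 0 <= b -> a <= 16 -> b <= 1 -> a * b <= 16.
  by move=> a0 b0 a1 b1; rewrite -[16]mulr1 ler_pM.
rewrite /trial_energy euler_trial// dz_trial//.
move: (c2 (logr nu q)) (c2 (height ht q)) (dcutoff_sqr_le (logr nu q)) (dcutoff_sqr_le (height ht q)).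
move: (cutoff (logr nu q)) (cutoff (height ht q)) (dcutoff (logr nu q)) (dcutoff (height ht q)).
move=> a b c d ha hb hc hd; apply: lerD.
  apply: ler_wpM2r; first by rewrite invr_ge0 ltW.
  rewrite !exprMn exprVn; have -> : 64 / nu ^+ 2 = 16 * (2 ^+ 2 / nu ^+ 2) by ring.
  apply: ler_wpM2r; first by rewrite divr_ge0 ?sqr_ge0.
  by apply: pr; rewrite ?sqr_ge0.
rewrite !exprMn exprVn.
have -> : 4 / ht ^+ 2 * rad2 q = rad2 q / 4 * (16 / ht ^+ 2) by field; rewrite gt_eqF.
apply: ler_wpM2l; first by rewrite divr_ge0// ltW.
apply: ler_wpM2r; first by rewrite invr_ge0 sqr_ge0.
by rewrite mulrC; apply: pr; rewrite ?sqr_ge0.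
Qed.

(** The weight 1/r^2 is integrated without polar coordinates: on the ring e^i <= e^n r^2 <= e^(i +
    1) it is bounded by a constant, and the ring is enclosed in a box of comparable width, whose
    measure is a product. Every ring then costs the same amount, and there are 2 n of them. *)
Definition ring_coef (i : nat) : R := 64 / nu ^+ 2 * expR (nu - i%:R).
Definition ring_side (i : nat) : R := expR ((i.+1%:R - nu) / 2).

Lemma box_of_rad2 q (a : R) : rad2 q <= expR a -> `|cz q| < ht -> box (expR (a / 2)) ht q.
Proof.
move=> ra /ltW z.
have h (x y : R) : x ^+ 2 + y ^+ 2 <= expR a -> `|x| <= expR (a / 2).
  move=> xy; rewrite -(@ler_pXn2r _ 2) ?nnegrE ?expR_ge0// real_normK ?num_real//.
  rewrite -expRM_natl mulrC divfK//; apply: le_trans xy.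
  by rewrite lerDl sqr_ge0.
split; last exact: segP z.
split; apply: segP; first exact: h ra.
by move: ra; rewrite /rad2 addrC => /h.
Qed.

Let ring_coef_ge0 i : 0 <= ring_coef i.
Proof. by rewrite mulr_ge0 ?expR_ge0// divr_ge0 ?sqr_ge0. Qed.

Lemma indic_eq1 (A : set heis) q : A q -> \1_A q = 1 :> R.
Proof. by move=> Aq; rewrite indicE mem_set. Qed.

(* On the shell e^i <= e^n r^2 <= e^(i+1) both 1/r^2 <= e^(n-i) and the point
   lies in a box of side comparable to e^((i+1-n)/2). *)
Lemma trial_energy_boxes q : trial_energy nu ht q <=
  \sum_(i <- iota 0 (2 * n)) ring_coef i * \1_(box (ring_side i) ht) q +
  \sum_(i <- [:: Datatypes.tt]) 4 / ht ^+ 2 * expR nu * \1_(box (expR (nu / 2)) ht) q.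
Proof.
have s0 : 0 <= \sum_(i <- iota 0 (2 * n)) ring_coef i * \1_(box (ring_side i) ht) q.
  by apply: sumr_ge0 => i _; rewrite mulr_ge0.
have [[Uq h1 h2 h3]|nq] := pselect (trial_supp q); last first.
  rewrite trial_energy_out// addr_ge0// big_seq1 mulr_ge0// mulr_ge0 ?expR_ge0//.
  by rewrite divr_ge0 ?sqr_ge0.
have r0 := rad2_gt0 Uq.
apply: le_trans (trial_energy_le Uq) _; apply: lerD; last first.
  rewrite big_seq1 indic_eq1 ?mulr1; last by apply: box_of_rad2 => //; exact: ltW.
  by apply: ler_wpM2l; [rewrite divr_ge0 ?sqr_ge0|exact: ltW].
pose l := ln (rad2 q).
have l1 : - nu < l by rewrite -ltr_expR lnK.
have l2 : l < nu by rewrite -ltr_expR lnK.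
pose j := Num.floor (l + nu).
have j0 : 0 <= j by rewrite floor_ge0 -lerBlDr sub0r ltW.
have [i ji] : exists i : nat, j = i%:Z by exists `|j|%N; rewrite gez0_abs.
have ij : (i%:R : R) = j%:~R by rewrite ji.
have i1 : i%:R <= l + nu by rewrite ij; exact: floor_le.
have i2 : l + nu < i.+1%:R by rewrite -natr1 ij; have := floorD1_gt (l + nu); rewrite intrD.
have i3 : (i < 2 * n)%N.
  by rewrite -(ltr_nat R) natrM (le_lt_trans i1)// mulr_natl mulr2n ltrD2r.
rewrite (perm_big _ (perm_to_rem (_ : i \in iota 0 (2 * n))))/=; last by rewrite mem_iota.
rewrite big_cons; apply: ler_wpDr.
  by apply: sumr_ge0 => k _; rewrite mulr_ge0.
rewrite indic_eq1 ?mulr1; last first.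
  apply: box_of_rad2 => //; rewrite -(lnK r0) ler_expR -/l lerBrDr; exact: ltW.
apply: ler_wpM2l; first by rewrite divr_ge0 ?sqr_ge0.
by rewrite -{1}(lnK r0) -expRN ler_expR -/l lerNl opprB lerBlDr.
Qed.

Lemma sf_trial_energy : shell_fun delta L (trial_energy nu ht).
Proof.
have oU := @open_off_axis R.
have si : smooth U (fun q => (rad2 q)^-1).
  by apply: (smooth_inv oU (smooth_rad2 oU)) => q Uq; rewrite gt_eqF// rad2_gt0.
have sr : smooth setT (fun q : heis => rad2 q / 4).
  by apply: (smoothM openT (smooth_rad2 openT)); exact: smooth_cst openT.
have t1 := sfM_off_axis d0 si (sf_sqr d0 (sf_euler d0 tt)).
have t2 := sfM d0 sr (sf_sqr d0 (sf_dz tt)).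
rewrite (_ : trial_energy nu ht = fun q => (rad2 q)^-1 * euler t q ^+ 2 + rad2 q / 4 * 'D_ez t q ^+ 2).
  exact: sfD.
by apply/funext => q; rewrite /trial_energy [euler t q ^+ 2 / _]mulrC.
Qed.

(** Each of the 2 n rings contributes 512 e ht / n^2. In the second term 4 e^n / ht^2 bounds the
    vertical energy density, and the enclosing box of half-side e^(n/2) has measure 8 e^n ht. *)
Lemma integral_trial_energy :
  (\int[@heis_mu R]_q (trial_energy nu ht q)%:E <=
   (1024 * expR 1 * ht / nu + 32 * expR nu ^+ 2 / ht)%:E)%E.
Proof.
have e1 := integral_boxes (iota 0 (2 * n)) ht0 ring_coef_ge0 (fun i => expR_gt0 _ : 0 < ring_side i).
have c0 : 0 <= 4 / ht ^+ 2 * expR nu by rewrite mulr_ge0 ?expR_ge0// divr_ge0 ?sqr_ge0.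
(* The single box of the vertical term is written as a sum over a one-element list, so that the same
   formula serves both terms. *)
have e2 := integral_boxes [:: Datatypes.tt] ht0 (fun=> c0) (fun=> expR_gt0 (nu / 2)).
have mb (r : R) (c : R) : measurable_fun setT (fun q : RR * RR * RR => c * \1_(box r ht) q).
  apply: measurable_funM; first exact: measurable_cst.
  by have mr := measurable_box r ht; exact: measurable_indic.
have m1 : measurable_fun setT (fun q : RR * RR * RR =>
    (\sum_(i <- iota 0 (2 * n)) ring_coef i * \1_(box (ring_side i) ht) q)%:E).
  by apply/measurable_EFinP; apply: measurable_sum => i; exact: mb.
have m2 : measurable_fun setT (fun q : RR * RR * RR =>
    (\sum_(i <- [:: Datatypes.tt]) 4 / ht ^+ 2 * expR nu * \1_(box (expR (nu / 2)) ht) q)%:E).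
  by apply/measurable_EFinP; apply: measurable_sum => i; exact: mb.
have m0 : measurable_fun setT (fun q : RR * RR * RR => (trial_energy nu ht q)%:E).
  by apply/measurable_EFinP; apply: continuous_measurable3; exact: sf_cont sf_trial_energy.
have p1 q : 0 <= \sum_(i <- iota 0 (2 * n)) ring_coef i * \1_(box (ring_side i) ht) q.
  by apply: sumr_ge0 => i _; rewrite mulr_ge0.
have p2 q : 0 <= \sum_(i <- [:: Datatypes.tt]) 4 / ht ^+ 2 * expR nu * \1_(box (expR (nu / 2)) ht) q.
  by apply: sumr_ge0 => i _; rewrite mulr_ge0.
have p0 q : 0 <= trial_energy nu ht q.
  have r0 : 0 <= rad2 q by rewrite addr_ge0 ?sqr_ge0.
  by apply: addr_ge0; [apply: divr_ge0 => //; exact: sqr_ge0|apply: mulr_ge0; [exact: divr_ge0|exact: sqr_ge0]].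
apply: (@le_trans _ _ (\int[@heis_mu R]_q (
   (\sum_(i <- iota 0 (2 * n)) ring_coef i * \1_(box (ring_side i) ht) q)%:E +
   (\sum_(i <- [:: Datatypes.tt]) 4 / ht ^+ 2 * expR nu * \1_(box (expR (nu / 2)) ht) q)%:E))%E).
  apply: ge0_le_integral => //.
  - by move=> q _; rewrite lee_fin.
  - exact: emeasurable_funD.
  - by move=> q _; rewrite -EFinD lee_fin; exact: trial_energy_boxes.
rewrite ge0_integralD//; last 2 first.
- by move=> q _; rewrite lee_fin.
- by move=> q _; rewrite lee_fin.
rewrite e1 e2 -EFinD lee_fin big_seq1.
have nn : nu != 0 by rewrite gt_eqF.
have hn : ht != 0 by rewrite gt_eqF.
apply: lerD.
  rewrite (eq_bigr (fun=> 512 * expR 1 * ht / nu ^+ 2)); last first.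
    move=> i _; rewrite /ring_coef /ring_side -expRM_natl mulrC.
    have -> : expR (2%:R * ((i.+1%:R - nu) / 2)) = expR 1 / expR (nu - i%:R) :> R.
      by rewrite -expRN -expRD -natr1; congr expR; field.
    have := expR_gt0 (nu - i%:R); move: (expR (nu - i%:R)) => x x0.
    by field; rewrite nn gt_eqF.
  rewrite big_const_seq count_predT size_iota iter_addr_0 -[X in X <= _]mulr_natl natrM.
  by rewrite le_eqVlt; apply/orP; left; apply/eqP; field.
have -> : expR (nu / 2) ^+ 2 = expR nu by rewrite -expRM_natl mulrC divfK.
by rewrite le_eqVlt; apply/orP; left; apply/eqP; field.
Qed.

End EnergyBound.

(** * Vanishing of an added weight *)

Section Optimality.
Variable R : realType.
Local Notation heis := (heis R).
Local Notation U := (@heis_off_axis R).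
Local Notation RR := (measurableTypeR R).
Local Notation leb := (@lebesgue_measure R).
Local Notation leb2 := (@leb2 R).
Implicit Types (q v : heis).

(** The nearest integer is the floor of [a] or its successor; its opposite is the frequency of the
    phase that minimizes |k + alpha|. *)
Lemma dist_int_attained (a : R) : exists k : int, (k%:~R + a) ^+ 2 = dist_int a ^+ 2.
Proof.
pose f := Num.floor a.
have f1 : f%:~R <= a by exact: floor_le.
have f2 : a < f%:~R + 1 by have := floorD1_gt a; rewrite intrD.
have low (j : int) : a - f%:~R <= `|a - j%:~R| \/ f%:~R + 1 - a <= `|a - j%:~R|.
  have [jf|fj] := leP j f.
    left; apply: le_trans (ler_norm _); rewrite lerD2l lerN2 ler_int//.
  right; rewrite distrC; apply: le_trans (ler_norm _); rewrite lerD2r.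
  by rewrite -[f%:~R + 1](intrD R f 1) ler_int lezD1.
have key (k : int) : (forall j : int, `|a - k%:~R| <= `|a - j%:~R|) ->
    exists k : int, (k%:~R + a) ^+ 2 = dist_int a ^+ 2.
  move=> h; exists (- k).
  have -> : dist_int a = `|a - k%:~R|.
    apply/eqP; rewrite eq_le dist_int_le/=; apply: lb_le_inf.
      by exists `|a - 0%:~R|, 0.
    by move=> _ [j _ <-].
  by rewrite real_normK ?num_real// mulrNz addrC.
have [h|h] := leP (a - f%:~R) (f%:~R + 1 - a).
  apply: (key f) => j; rewrite ger0_norm ?subr_ge0//.
  by have [//|] := low j; exact: le_trans.
apply: (key (f + 1)) => j; rewrite distrC intrD ger0_norm; last by rewrite subr_ge0 ltW.
by have [|//] := low j; apply: le_trans; exact: ltW.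
Qed.

(** Independence of z makes the integral grow linearly with the height. This is the gain to be
    played against the energy, whose main term is also linear in the height but carries a factor
    1/n. *)
Lemma integral_cylinder (G : RR * RR * RR -> R) (h : R) : 0 < h ->
  measurable_fun setT G -> (forall q, 0 <= G q) ->
  (forall x y z z', G (x, y, z) = G (x, y, z')) ->
  (\int[@heis_mu R]_q (G q * \1_(seg h) q.2)%:E =
   (2 * h)%:E * \int[leb2]_p (G (p, 0))%:E)%E.
Proof.
move=> h0 mG G0 Gz.
have m1 : measurable_fun setT (fun z : RR => (\1_(seg h) z : R)).
  by have ms : measurable (seg h) := measurable_itv _; exact: measurable_indic.
rewrite integral_heis_mu2; last 2 first.
- apply/measurable_EFinP; apply: measurable_funM => //.
  exact: (measurableT_comp m1 measurable_snd).
- by move=> q; rewrite lee_fin mulr_ge0.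
have mp : measurable_fun setT (fun p : RR * RR => (p, 0 : RR)).
  by apply: measurable_fun_pair => //; exact: measurable_cst.
rewrite -ge0_integralZl//; last 3 first.
- by apply/measurable_EFinP; exact: (measurableT_comp mG mp).
- by move=> p _; rewrite lee_fin.
- by rewrite lee_fin mulr_ge0// ltW.
apply: eq_integral => -[x y] _.
transitivity (\int[leb]_z ((G (x, y, 0))%:E * (\1_(seg h) z)%:E))%E.
  by apply: eq_integral => z _; rewrite -EFinM (Gz x y z 0).
rewrite ge0_integralZl//; last 2 first.
- by apply/measurable_EFinP.
- by rewrite lee_fin.
have e : (\int[leb]_z (\1_(seg h) z)%:E = leb (seg h))%E.
  have := @integral_indic _ RR R leb setT measurableT (seg h) (measurable_itv _).
  by rewrite setIT.
by rewrite e leb_seg// muleC.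
Qed.

Variables (alpha : R) (w : heis -> R).
Hypotheses (mw : measurable_fun U w) (w0 : forall q, U q -> 0 <= w q).
Hypothesis wz : forall x y z z' : R, w (x, y, z) = w (x, y, z').
Hypothesis hw : sublaplacian_ge U (A_alpha alpha) (fun q => hardy_weight alpha q + w q).

(** Logarithmic annuli, matched to [logr]; their union over m is the complement of the axis. *)
Definition annulus (m : nat) : set heis :=
  [set q | expR (- m%:R) <= rad2 q /\ rad2 q <= expR m%:R].

Lemma annulus_off_axis m : annulus m `<=` U.
Proof. by move=> q [h _]; rewrite off_axisE /=; apply: lt_le_trans h; exact: expR_gt0. Qed.

(** Extension by zero of the restriction of [w] to the annulus, since measurability and sign of [w]
    are given only off the axis. *)
Let G m q : R := if pselect (annulus m q) then w q else 0.

Let G0 m q : 0 <= G m q.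
Proof. by rewrite /G; case: pselect => //= h; apply: w0; exact: annulus_off_axis h. Qed.

Let measurable_annulus m : measurable (annulus m : set (RR * RR * RR)).
Proof.
have mr := @continuous_measurable3 R (@rad2 R) (@continuous_rad2 R).
have := mr measurableT `[expR (- m%:R), expR m%:R]%classic (measurable_itv _).
rewrite setTI (_ : _ @^-1` _ = annulus m)//.
by apply/seteqP; split=> q; rewrite /annulus /= in_itv /=; [move=> /andP[]|move=> [-> ->]].
Qed.

Let mG m : measurable_fun setT (G m : RR * RR * RR -> R).
Proof.
have mwa : measurable_fun (annulus m : set (RR * RR * RR)) w.
  exact: (measurable_funS (@measurable_off_axis R) (@annulus_off_axis m) mw).
have := (measurable_restrictT w (measurable_annulus m)).1 mwa.
apply: eq_measurable_fun => q _; rewrite /G /patch; case: pselect => h.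
  by rewrite mem_set.
by rewrite memNset.
Qed.

Let Gz m x y z z' : G m (x, y, z) = G m (x, y, z').
Proof.
have e : annulus m (x, y, z) = annulus m (x, y, z') by [].
by rewrite /G (wz x y z z') e.
Qed.

Let mass m := (\int[leb2]_p (G m (p, 0))%:E)%E.

(** With 2 m <= n and |z| <= ht/2 both arguments of the cutoffs are at most 1/2; a product of two
    factors, squared, gives the fourth power. *)
Let cutoff_bound m n (ht : R) q : (0 < n)%N -> (2 * m <= n)%N -> 0 < ht ->
  annulus m q -> `|cz q| <= ht / 2 -> cutoff_min R ^+ 4 <= trial n%:R ht q ^+ 2.
Proof.
move=> n0 mn ht0 aq zq; have Uq := annulus_off_axis aq; have r0 := rad2_gt0 Uq.
have c0 := cutoff_min_gt0 R; have nu0 : 0 < n%:R :> R by rewrite ltr0n.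
rewrite trialE// exprMn (exprD _ 2 2); apply: ler_pM; rewrite ?sqr_ge0//.
  rewrite lerXn2r ?nnegrE ?cutoff_ge0 ?(ltW c0)//; apply: cutoff_ge_min.
  rewrite /logr normf_div [`|n%:R|]gtr0_norm// ler_pdivrMr//.
  have h : `|ln (rad2 q)| <= m%:R.
    case: aq; rewrite -{1 2}(lnK r0) !ler_expR => a1 a2.
    by rewrite ler_norml a1.
  by rewrite (le_trans h)// mulrC ler_pdivlMr// -natrM ler_nat mulnC.
rewrite lerXn2r ?nnegrE ?cutoff_ge0 ?(ltW c0)//; apply: cutoff_ge_min.
by rewrite /height normf_div [`|ht|]gtr0_norm// ler_pdivrMr// mulrC.
Qed.

Let mass_bound m n : (0 < n)%N -> (2 * m <= n)%N ->
  ((cutoff_min R ^+ 4)%:E * mass m <= ((1024 * expR 1 + 32) / n%:R)%:E)%E.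
Proof.
move=> n0 mn; have c0 := cutoff_min_gt0 R; have nu0 : 0 < n%:R :> R by rewrite ltr0n.
(* With this height, e^(2 n) / ht^2 = 1/n^2, so after division by the height the vertical energy is
   dominated by the radial one. *)
pose ht : R := n%:R * expR n%:R; have ht0 : 0 < ht by rewrite mulr_gt0 ?expR_gt0.
have [k kd] := dist_int_attained alpha.
have h1 := trial_weight nu0 ht0 mw w0 hw kd.
have h2 := integral_trial_energy n0 ht0.
have ht20 : 0 < ht / 2 by rewrite divr_gt0.
have e := integral_cylinder ht20 (mG m) (G0 m) (Gz m).
have m1 : measurable_fun setT (fun q : RR * RR * RR => (G m q * \1_(seg (ht / 2)) q.2 : R)).
  apply: measurable_funM => //.
  have ms : measurable (seg (ht / 2)) := measurable_itv _.
  have m2 : measurable_fun setT (fun z : RR => (\1_(seg (ht / 2)) z : R)) by exact: measurable_indic.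
  exact: (measurableT_comp m2 measurable_snd).
have h3 : ((cutoff_min R ^+ 4)%:E * \int[@heis_mu R]_q (G m q * \1_(seg (ht / 2)) q.2)%:E
    <= \int[@heis_mu R]_(q in U) (w q * trial n%:R ht q ^+ 2)%:E)%E.
  rewrite -ge0_integralZl//; last 3 first.
  - exact/measurable_EFinP.
  - by move=> q _; rewrite lee_fin mulr_ge0.
  - by rewrite lee_fin exprn_ge0// ltW.
  rewrite [leRHS]integral_mkcond; apply: ge0_le_integral => //.
  - move=> q _; rewrite -EFinM lee_fin; apply: mulr_ge0; last exact: mulr_ge0.
    exact: exprn_ge0 (ltW c0).
  - by apply: measurable_funeM; apply/measurable_EFinP.
  - apply/(measurable_restrictT _ (@measurable_off_axis R)).
    apply/measurable_EFinP; apply: measurable_funM; first exact: mw.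
    have mt : measurable_fun setT (fun q => trial n%:R ht q ^+ 2).
      have st := sf_trial nu0 ht0.
      apply: continuous_measurable3; apply: sf_cont; apply: sf_sqr st; exact: expR_gt0.
    exact: (measurable_funS measurableT (@subsetT _ U) mt).
  - move=> q _; rewrite /patch -EFinM.
    have [aq|naq] := pselect (annulus m q); last first.
      have -> : G m q = 0 by rewrite /G; case: pselect.
      rewrite mul0r mulr0; case: ifPn => //; rewrite inE => Uq.
      by rewrite lee_fin mulr_ge0 ?sqr_ge0// w0.
    have Uq := annulus_off_axis aq; rewrite ifT ?mem_set// lee_fin.
    have -> : G m q = w q by rewrite /G; case: pselect.
    have [sq|nsq] := pselect (seg (ht / 2) q.2); last first.
      by rewrite indicE memNset// mulr0 mulr0 mulr_ge0 ?sqr_ge0// w0.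
    rewrite indicE mem_set// mulr1 mulrC; apply: ler_wpM2l; first exact: w0.
    by apply: (cutoff_bound n0 mn ht0 aq); move: sq; rewrite /seg /= in_itv /= -ler_norml.
have h4 := le_trans h3 (le_trans h1 h2).
(* The cylinder |z| <= ht/2 contributes a factor [ht] to the left side. Division by it leaves 1024 e
   / n from the rings and 32 / n^2 <= 32 / n from the vertical term. *)
move: h4; rewrite e mulrC divfK// muleCA -lee_pdivlMl//.
move=> h; apply: (le_trans h); rewrite -EFinM lee_fin mulrDr [leRHS]mulrDl; apply: lerD.
  by rewrite le_eqVlt; apply/orP; left; apply/eqP; field; rewrite !gt_eqF// expR_gt0.
rewrite /ht; have := expR_gt0 (n%:R : R); move: (expR _) => x x0.
have -> : (n%:R * x)^-1 * (32 * x ^+ 2 / (n%:R * x)) = 32 / n%:R * n%:R^-1.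
  by field; rewrite !gt_eqF.
by rewrite ler_piMr ?divr_ge0 ?(ltW nu0)// invf_le1// ler1n.
Qed.

Let mass_eq0 m : mass m = 0%E.
Proof.
have c0 := cutoff_min_gt0 R; have c4 : 0 < cutoff_min R ^+ 4 by rewrite exprn_gt0.
apply/eqP; rewrite eq_le; apply/andP; split; last first.
  by apply: integral_ge0 => p _; rewrite lee_fin.
apply/lee_addgt0Pr => e e0; rewrite add0e.
(* For n >= B the bound of [mass_bound] is at most e; the annulus is fixed while n grows. *)
pose B : R := (1024 * expR 1 + 32) / (cutoff_min R ^+ 4 * e).
have B0 : 0 <= B.
  apply: divr_ge0; last by apply: mulr_ge0; exact: ltW.
  exact: addr_ge0 (mulr_ge0 (ler0n R 1024) (expR_ge0 1)) (ler0n R 32).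
pose n := ((2 * m).+1 + Num.bound B)%N.
have n0 : (0 < n)%N by [].
have mn : (2 * m <= n)%N by rewrite /n addSn ltnW// ltnS leq_addr.
have nu0 : 0 < n%:R :> R by rewrite ltr0n.
have := mass_bound n0 mn; rewrite -lee_pdivlMl// => /le_trans; apply.
rewrite -EFinM lee_fin mulrA ler_pdivrMr// -ler_pdivrMl//.
have -> : e^-1 * ((cutoff_min R ^+ 4)^-1 * (1024 * expR 1 + 32)) = B.
  by rewrite /B; move: (cutoff_min R ^+ 4) (1024 * expR 1 + 32) => a b; rewrite invfM; ring.
rewrite (le_trans (ltW (archi_boundP B0)))// ler_nat /n; exact: leq_addl.
Qed.

Lemma weight_ae_eq0 : {ae @heis_mu R, forall q, U q -> w q = 0}.
Proof.
(* The sets given by an annulus and a height bound are countably many and exhaust the complement of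
   the axis, so it is enough to treat one of them. *)
have ae m : {ae @heis_mu R, forall q, annulus m q -> `|cz q| <= m.+1%:R -> w q = 0}.
  have h0 : 0 < m.+1%:R :> R by rewrite ltr0n.
  have e := integral_cylinder h0 (mG m) (G0 m) (Gz m); rewrite [X in (_ * X)%E]mass_eq0 mule0 in e.
  have m1 : measurable_fun setT (fun q : RR * RR * RR => (G m q * \1_(seg m.+1%:R) q.2)%:E).
    apply/measurable_EFinP; apply: measurable_funM => //.
    have ms : measurable (seg (m.+1%:R : R)) := measurable_itv _.
    have m2 : measurable_fun setT (fun z : RR => (\1_(seg m.+1%:R) z : R)) by exact: measurable_indic.
    exact: (measurableT_comp m2 measurable_snd).
  have e' : (\int[@heis_mu R]_q `|(G m q * \1_(seg m.+1%:R) q.2)%:E| = 0)%E.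
    by rewrite -e; apply: eq_integral => q _; rewrite gee0_abs// lee_fin mulr_ge0.
  have /(ae_eq_integral_abs (@heis_mu R) measurableT m1) := e'.
  apply: filterS => q /(_ I) /= [] + aq zq.
  have -> : G m q = w q by rewrite /G; case: pselect.
  rewrite indicE mem_set ?mulr1//; exact: segP.
have := ae_foralln ae; apply: filterS => q h Uq; have r0 := rad2_gt0 Uq.
pose b := Num.max `|ln (rad2 q)| `|cz q|.
have b0 : 0 <= b by rewrite le_max normr_ge0.
have := archi_boundP b0; rewrite /b gt_max => /andP[/ltW h1 /ltW h2].
apply: (h (Num.bound b)).
  move: h1; rewrite ler_norml => /andP[a1 a2].
  by rewrite /annulus /= -(lnK r0) !ler_expR.
by rewrite (le_trans h2)// ler_nat.
Qed.

End Optimality.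

Theorem theorem2p2 (R : realType) (A : form1 R)
    (hA : aharonov_bohm (@heis_off_axis R) A) :
  exists alpha : R,
    [/\ gauge_equivalent (@heis_off_axis R) A (A_alpha alpha),
        sublaplacian_ge (@heis_off_axis R) (A_alpha alpha) (hardy_weight alpha)
      & hardy_optimal (@heis_off_axis R) alpha].
Proof.
have [alpha hg] := gauge_A_alpha hA.
exists alpha; split; [exact: hg|exact: sublaplacian_hardy|].
by move=> w mw w0 wz hw; exact: weight_ae_eq0 mw w0 wz hw.
Qed.
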